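(* For every integer $g\geq 12$, \[ \dim\bigl(\mathbb{M}_{g,\underline{5}}^{\mathrm{nd}}\bigr)=\lfloor U(g,5)\rfloor-1, \] where $U(g,d)=g+\frac{2g}{d-1}+2d-3$ (so $U(g,5)=\frac{3g}{2}+7$).
   Context: Lattice polygon: convex hull of a nonempty finite subset of $\mathbb{Z}^2$; genus $g(P)$ = number of interior lattice points; $P^{(1)}$ = convex hull of interior lattice points. Lattice width $\mathrm{lw}$: least $s$ such that some map $x\mapsto Ax+b$ ($A\in\mathrm{GL}_2(\mathbb{Z})$, $b\in\mathbb{Z}^2$) sends the polygon into $\mathbb{R}\times[0,s]$; segments/points have lattice width $0$, the empty set $-1$. Expected gonality $\mathrm{egon}(P)=\mathrm{lw}(P^{(1)})+2$, except $\mathrm{egon}(P)=3$ for $P$ equivalent to $\mathrm{conv}\{(-2,-2),(2,0),(0,2)\}$. $\mathbb{M}_P$: set of metric graphs arising as skeletons (delete infinite rays, retract leaves, smooth 2-valent vertices) of smooth tropical plane curves with Newton polygon $P$ (min-plus tropical polynomials with finite coefficients at all lattice points of $P$ inducing a regular unimodular triangulation); a finite union of polyhedral cones indexed by regular unimodular triangulations, with $\dim\mathbb{M}_P$ the maximal cone dimension. $\mathbb{M}_{g,\underline{d}}^{\mathrm{nd}}=\bigcup\{\mathbb{M}_P:g(P)=g,\ \mathrm{egon}(P)=d\}$, with dimension $\max\dim\mathbb{M}_P$ over such $P$. *)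

(* Defs.v *)
From HB Require Import structures.
From mathcomp Require Import all_boot all_order all_algebra finmap.
From mathcomp Require Import all_classical all_reals all_analysis.

Set Implicit Arguments.
Unset Strict Implicit.
Unset Printing Implicit Defensive.

Import Order.TTheory GRing.Theory Num.Theory.
Import numFieldNormedType.Exports.

Local Open Scope classical_set_scope.
Local Open Scope ring_scope.

Definition is_max (A : set nat) (n : nat) : Prop := A n /\ ubound A n.

(* Points of Z^2 and R^2 are column vectors; coordinates are indexed by
   [0 : 'I_2] and [1 : 'I_2]. *)
Notation lat := 'cV[int]_2.

Section Polygons.
Variable R : realType.
Local Notation plane := 'cV[R]_2.
Implicit Types (P Q : set plane) (u v w : lat).

Definition emb v : plane := map_mx intr v.

Definition conv_hull (X : set plane) : set plane :=
  [set x | exists n (p : 'I_n -> plane) (t : 'I_n -> R),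
     [/\ forall i, X (p i), forall i, 0 <= t i, \sum_i t i = 1
       & x = \sum_i t i *: p i]].

Definition lattice_polygon P : Prop :=
  exists2 S : {fset lat}, S != fset0 & P = conv_hull (emb @` [set` S]).

Definition lattice_points P : set lat := [set v | P (emb v)].

Definition interior_lattice_points P : set lat := lattice_points (interior P).

(* Topological interior in R^2: a segment or a point has genus 0. *)
Definition genus P : nat := #|` fset_set (interior_lattice_points P)|.

Definition interior_polygon P : set plane :=
  conv_hull (emb @` interior_lattice_points P).

(* The map x |-> Ax + b, for A in GL_2(Z) (i.e. [A \in unitmx]) and b in Z^2. *)
Definition affine_map (A : 'M[int]_2) (b : lat) (x : plane) : plane :=
  map_mx intr A *m x + emb b.

Definition equivalent P Q : Prop :=
  exists A b, A \in unitmx /\ affine_map A b @` P = Q.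

Definition in_strip Q (s : nat) : Prop :=
  exists A b, A \in unitmx /\
    affine_map A b @` Q `<=` [set y | 0 <= y 1 0 <= s%:R].

(* For the empty set the value is -1 by convention. The default value [0] of
   [xget] is irrelevant: the sets considered are bounded. *)
Definition lattice_width Q : int :=
  if pselect (Q = set0) then -1
  else (xget 0%N [set s | in_strip Q s /\ forall t, in_strip Q t -> (s <= t)%N])%:Z.

Definition mkpt (a b : int) : lat := \col_(i < 2) if i == 0 then a else b.

Definition exceptional_triangle : set plane :=
  conv_hull (emb @` [set mkpt (- 2) (- 2); mkpt 2 0; mkpt 0 2]).

Definition egon P : int :=
  if pselect (equivalent P exceptional_triangle) then 3
  else lattice_width (interior_polygon P) + 2.

End Polygons.

Section RegularTriangulations.
Variable R : realType.
Local Notation plane := 'cV[R]_2.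
Implicit Types (P : set plane) (c : lat -> R) (x : plane).

(* The tropical polynomial with Newton polygon P and coefficients c is
   x |-> min_v (c v + <v, x>), v ranging over the lattice points of P; the
   values of c outside P are never used. *)
Definition term c (v : lat) x : R := c v + \sum_i (v i 0)%:~R * x i 0.

Definition minimizers P c x : set lat :=
  [set v | lattice_points P v /\
     forall w, lattice_points P w -> term c v x <= term c w x].

Definition area2 (u v w : lat) : int :=
  (v - u) 0 0 * (w - u) 1 0 - (v - u) 1 0 * (w - u) 0 0.

Definition two_dimensional (T : set lat) : Prop :=
  exists u v w, [/\ T u, T v, T w & area2 u v w != 0].

Definition unimodular_triangle (T : {fset lat}) : Prop :=
  exists u v w, T = [fset u; v; w]%fset /\ `|area2 u v w| = 1.

(* The two-dimensional cells of the regular subdivision induced by c (the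
   projection of the lower faces of the lifted points (v, c v)) are the
   two-dimensional sets of minimizers; they are dual to the vertices of the
   tropical curve. A triangulation is given by the set of its triangles, each
   triangle by the set of its vertices. *)
Definition induces P c (D : {fset {fset lat}}) : Prop :=
  (forall T : {fset lat}, T \in D -> unimodular_triangle T) /\
  [set [set` T] | T in [set` D]] =
    [set T | two_dimensional T /\ exists x, T = minimizers P c x].

Definition secondary_cone P (D : {fset {fset lat}}) : set (lat -> R) :=
  [set c | induces P c D].

Definition regular_unimodular P (D : {fset {fset lat}}) : Prop :=
  secondary_cone P D !=set0.

Definition dual_edge P c (e : {fset lat}) : set plane :=
  [set x | [set` e] `<=` minimizers P c x].

Definition primitive (u : lat) : Prop := coprimez (u 0 0) (u 1 0).

(* [l] such that the bounded edge dual to [e] is a segment from some x to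
   x + l u, with u a primitive integer vector. *)
Definition edge_length P c (e : {fset lat}) : R :=
  xget 0 [set l | 0 <= l /\ exists x u, primitive u /\
    dual_edge P c e = [set x + t *: emb R u | t in [set t | 0 <= t <= l]]].

End RegularTriangulations.

(* The dual graph of a triangulation D: its vertices are the triangles of D, its
   bounded edges correspond to the edges (pairs of lattice points) lying in two
   triangles of D; an edge lying in a single triangle is dual to an infinite ray
   of the tropical curve. *)
Section Skeleton.
Variable D : {fset {fset lat}}.
Local Open Scope fset_scope.

Definition star (e : {fset lat}) : {fset {fset lat}} :=
  [fset T in D | e `<=` T].

Definition bounded_edges : {fset {fset lat}} :=
  [fset e in \bigcup_(T <- D) fpowerset T | (#|` e| == 2)%N && (#|` star e| == 2)%N].

Definition degree (E : {fset {fset lat}}) (T : {fset lat}) : nat :=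
  #|` [fset e in E | e `<=` T]|.

Definition remove_leaves (E : {fset {fset lat}}) : {fset {fset lat}} :=
  [fset e in E | all (fun T => 1 < degree E T)%N (star e)].

Definition core : {fset {fset lat}} :=
  iter #|` bounded_edges| remove_leaves bounded_edges.

(* Smoothing the 2-valent vertices merges the edges meeting there, so the edges
   of the skeleton are the classes of core edges for the generated equivalence. *)
Definition merged (e f : core) : bool :=
  has (fun T => [&& degree core T == 2%N, val e `<=` T & val f `<=` T]) D.

Definition skel_edges : {set {set core}} :=
  equivalence_partition (connect merged) [set: core].

Definition skel_edge : finType := {C : {set core} | C \in skel_edges}.

Definition skel_vertices : {fset {fset lat}} :=
  [fset T in D | (2 < degree core T)%N].

Definition skel_vertex : finType := skel_vertices.

Definition skel_ends (C : skel_edge) : {set skel_vertex} :=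
  [set T : skel_vertex | [exists e in val C, val e `<=` val T]].

End Skeleton.

(* A loop has a single endpoint in [mg_ends]. *)
Record metric_graph (R : realType) := MetricGraph {
  mg_vertex : finType;
  mg_edge : finType;
  mg_ends : mg_edge -> {set mg_vertex};
  mg_length : {ffun mg_edge -> R^o} }.

Section Moduli.
Variable R : realType.
Local Notation plane := 'cV[R]_2.
Implicit Types (P : set plane) (D : {fset {fset lat}}).

Definition skeleton P D (c : lat -> R) : metric_graph R :=
  @MetricGraph R (skel_vertex D) (skel_edge D) (@skel_ends D)
    [ffun C : skel_edge D => (\sum_(e in val C) edge_length P c (val e) : R^o)].

(* M_P is the union, over the regular unimodular triangulations D of P, of these
   cones of edge length vectors of metric graphs. *)
Definition moduli_cone P D : set {ffun skel_edge D -> R^o} :=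
  [set l : {ffun skel_edge D -> R^o} |
     exists2 c, secondary_cone P D c & mg_length (skeleton P D c) = l].
Arguments moduli_cone : clear implicits.

(* Dimension of a convex cone: that of its linear span. *)
Definition cone_dim (V : vectType R) (C : set V) (n : nat) : Prop :=
  exists U : {vspace V},
    [/\ forall x, C x -> x \in U,
        forall W : {vspace V}, (forall x, C x -> x \in W) -> (U <= W)%VS
      & \dim U = n].

Definition dim_M P : nat -> Prop :=
  is_max [set n | exists D, regular_unimodular P D /\ cone_dim (moduli_cone P D) n].

Definition dim_M_nd (g d : nat) : nat -> Prop :=
  is_max [set n | exists P : set plane,
    [/\ lattice_polygon P, genus P = g, egon P = d%:Z & dim_M P n]].

End Moduli.

Definition U (g d : nat) : rat :=
  g%:R + 2 * g%:R / (d%:R - 1) + 2 * d%:R - 3.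

(* Main.v *)
(* Fix a regular unimodular triangulation induced by c. The length of the edge of
   the tropical curve dual to {u, v} is a linear function of c, so the lengths of
   the skeleton are given by a linear map, and dim M_P is bounded by the rank of
   the vectors f_z, the images of the indicators of the lattice points z. Affine
   functions are in its kernel, which saves 3.

   Upper bound. The interior polygon has lattice width 3, so in suitable
   coordinates the interior lattice points occupy the rows 0, ..., 3; as g >= 12,
   all lattice points lie in the rows -1, ..., 4. Triangles cutting off an ear are
   dual to leaves and can be removed, since they do not meet the core of the dual
   graph. Afterwards the apexes of the triangles based on the row -1 are interior
   and monotone along the row, and f_z = 0 whenever both triangles at z have the
   same apex. Hence this row contributes at most one more than the number of
   interior points of the row 0, and likewise for the row 4, while the inner rows
   contain at most 8 boundary points. Combining this with the convexity of the
   polygon gives twice the dimension at most 3 g + 12, except when one vertical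
   side carries four of these points and the count is off by one; then the same
   argument applied to this side, or a relation f_r = a f_b at a corner, saves one.

   Lower bound. The hexagon 0 <= x <= M, 0 <= y <= 5, j <= x + y <= M + i, with
   i in {2, 3} and j in {1, 2}, realizes every genus. Take its standard
   triangulation, induced by x^2 + x y + y^2 and its small perturbations, so that
   every f_z is in the span of the cone. If the lengths of a function c vanish,
   then c w + c w' = c v + c v' for each rhombus whose short diagonal {v, v'} is
   interior. Starting from the zeros (1, 2), (2, 2), (1, 3) these relations force
   c = 0 except at the six corners. A corner is then killed by the edge of the
   skeleton obtained by merging the edges around its interior neighbour; for j = 1
   two corners share this neighbour, and (1, 0) has to be a fourth initial zero. *)
From HB Require Import structures.
From mathcomp Require Import all_boot all_order all_algebra finmap.
From mathcomp Require Import all_classical all_reals all_analysis.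
From mathcomp Require Import ring lra zify.
Require Import Defs.
Set Implicit Arguments.
Unset Strict Implicit.
Unset Printing Implicit Defensive.

Import Order.TTheory GRing.Theory Num.Theory.
Import numFieldNormedType.Exports.

Local Open Scope classical_set_scope.
Local Open Scope ring_scope.

(** * Regular triangulations *)

(** The numbers behind the bound: the interior points contribute g - 3 vectors, so a family X
    spanning the boundary vectors with 2|X| <= g + 18 gives twice the dimension at most 3 g + 12,
    and floor(U(g,5)) - 1 is the floor of (3 g + 12)/2. The obstacle is that an apex over a boundary
    row may itself lie on the boundary, which ruins the comparison with the interior row. This
    happens only at an ear, whence their removal. Afterwards the lattice points are no longer those
    of P, while the skeleton is still that of the original triangulation. So the argument works with
    a finite set [L], a triangulation [D] of it and the original interior points [I], all tied to
    the original triangulation [D0] by [config]; symmetric situations are reached by changing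
    coordinates. The hypothesis g >= 12 enters the upper bound through crude counts: a lattice point
    further out would leave at most 10 interior points, an empty middle row at most 5. In the lower
    bound, the number of lattice points of the hexagon minus the number of initial zeros is exactly
    the upper bound, so independence of the remaining vectors suffices. *)

Notation px v := (v (0 : 'I_2) (0 : 'I_1)).
Notation py v := (v (1 : 'I_2) (0 : 'I_1)).

Lemma lat_eq (u v : lat) : px u = px v -> py u = py v -> u = v.
Proof.
move=> h0 h1; apply/matrixP => i j; rewrite (ord1 j).
case: (unliftP 0 i) => [k ->|-> //].
by rewrite (ord1 k) (_ : lift 0 0 = 1) //; apply/val_inj.
Qed.

Lemma area2E (u v w : lat) : area2 u v w =
  (px v - px u) * (py w - py u) - (py v - py u) * (px w - px u).
Proof. by rewrite /area2 !mxE. Qed.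

Lemma fset3P (T : choiceType) (a b c z : T) :
  (z \in [fset a; b; c]%fset) = [|| z == a, z == b | z == c].
Proof. by rewrite !inE orbA. Qed.

Lemma fset3_rot (T : choiceType) (a b c : T) :
  [fset a; b; c]%fset = [fset b; c; a]%fset.
Proof. by apply/fsetP => z; rewrite !fset3P orbC -orbA. Qed.

Lemma fset3_swap (T : choiceType) (a b c : T) :
  [fset a; b; c]%fset = [fset b; a; c]%fset.
Proof. by apply/fsetP => z; rewrite !fset3P orbCA. Qed.

Lemma area2_neq (u v w : lat) :
  area2 u v w != 0 -> [/\ u != v, u != w & v != w].
Proof.
rewrite area2E => h; split; apply/eqP => e; move: h; rewrite e; lia.
Qed.

Lemma area2_degenerate (a b u v w : lat) : (u == a) || (u == b) ->
  (v == a) || (v == b) -> (w == a) || (w == b) -> area2 u v w = 0.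
Proof.
by case/orP => /eqP-> /orP[] /eqP-> /orP[] /eqP->; rewrite area2E; ring.
Qed.

Lemma unimodular_card (T : {fset lat}) : unimodular_triangle T -> #|` T| = 3%N.
Proof.
move=> [u [v [w [-> h]]]].
have [uv uw vw] : [/\ u != v, u != w & v != w] by apply: area2_neq; lia.
by rewrite fsetUC cardfsU1 cardfs2 !inE negb_or uv !(eq_sym w) uw vw.
Qed.

Lemma unimodular_area (u v w : lat) :
  unimodular_triangle [fset u; v; w]%fset -> `|area2 u v w| = 1.
Proof.
move=> h; have := unimodular_card h.
case: h => a [b [c [e h]]].
have [hu hv hw] : [/\ u \in [fset a; b; c]%fset, v \in [fset a; b; c]%fset
  & w \in [fset a; b; c]%fset] by rewrite -e !fset3P !eqxx !orbT.
move=> h3.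
have [uv uw vw] : [/\ u != v, u != w & v != w].
  have h2 (x y : lat) : #|` [fset x; x; y]%fset| <> 3%N.
    rewrite (_ : [fset x; x; y]%fset = [fset x; y]%fset).
      by rewrite cardfs2; case: (_ != _).
    by apply/fsetP => z; rewrite !inE orbb.
  split; apply/eqP => E; move: h3; rewrite E; first exact: h2.
  - by rewrite fset3_swap fset3_rot; apply: h2.
  - by rewrite fset3_rot; apply: h2.
move: hu hv hw uv uw vw; rewrite !fset3P.
do 3!(case/or3P => /eqP ->); rewrite ?eqxx // => _ _ _; move: h; rewrite !area2E; lia.
Qed.

Lemma unimodular_neq (u v w : lat) : unimodular_triangle [fset u; v; w]%fset ->
  [/\ u != v, u != w & v != w].
Proof.
by move=> /unimodular_area h; apply: area2_neq; rewrite -normr_eq0 h.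
Qed.

Section RegularTriangulation.
Variable R : realType.

Definition af (f : R * R * R) (z : lat) : R :=
  f.1.1 + f.1.2 * (px z)%:~R + f.2 * (py z)%:~R.

Arguments af : simpl never.

(** Barycentric interpolation with denominators cleared: the areas are the barycentric coordinates
    of [z] times [area2 u v w]. *)
Lemma af_bary f (u v w z : lat) : af f z * (area2 u v w)%:~R =
  af f u * (area2 z v w)%:~R + af f v * (area2 u z w)%:~R
  + af f w * (area2 u v z)%:~R.
Proof.
by rewrite !area2E /af !(rmorphB, rmorphM) /=; ring.
Qed.

(** For a unimodular triangle [[u, a, b]] the vectors [a - u] and [b - u] form a lattice basis, so
    integer coefficients describe every lattice point of the real cone at [u]. *)
Definition incone (u a b z : lat) : Prop := exists p q : int,
  [/\ 0 <= p, 0 <= q, px z = px u + p * (px a - px u) + q * (px b - px u)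
    & py z = py u + p * (py a - py u) + q * (py b - py u)].

Lemma af_comb f (u a b z : lat) (p q : int) :
  px z = px u + p * (px a - px u) + q * (px b - px u) ->
  py z = py u + p * (py a - py u) + q * (py b - py u) ->
  af f z = af f u + p%:~R * (af f a - af f u) + q%:~R * (af f b - af f u).
Proof.
by move=> hx hy; rewrite /af hx hy !(rmorphD, rmorphB, rmorphM) /=; ring.
Qed.

Variable c : lat -> R.
Implicit Types (L : {fset lat}) (D : {fset {fset lat}}).

Definition supports L f : Prop := forall z, z \in L -> af f z <= c z.

Definition contact L f : {fset lat} := [fset z in L | af f z == c z]%fset.

Lemma contactP L f z : reflect (z \in L /\ af f z = c z) (z \in contact L f).
Proof. by rewrite !inE /=; apply: (iffP andP) => -[-> /eqP ->]. Qed.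

(** Lower faces of the lifted points in terms of supporting affine functions: by [rt_supp] each
    triangle is a face, by [rt_max] no two-dimensional face is missing. Unlike [induces], this makes
    sense for any finite [L] and so survives the removal of points. *)
Record regtri L D : Prop := {
  rt_tri : forall T, T \in D -> unimodular_triangle T;
  rt_supp : forall T, T \in D -> exists2 f, supports L f & contact L f = T;
  rt_max : forall f, supports L f -> two_dimensional [set` contact L f] ->
    contact L f \in D }.

Section Triangles.
Variables (L : {fset lat}) (D : {fset {fset lat}}).
Hypothesis rt : regtri L D.

Lemma rt_sub T : T \in D -> (T `<=` L)%fset.
Proof.
by move=> /(rt_supp rt)[f _ <-]; apply/fsubsetP => z /contactP[].
Qed.

(** Let [f1] and [f2] support the two triangles. They agree at [u], and [f2 <= c = f1] at [a] and
    [b], so [f2 <= f1] on the cone. At [z] this reads [c z <= f1 z], which makes [z] a contact point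
    of [f1]. *)
Lemma cone_mem u a b T z : [fset u; a; b]%fset \in D -> T \in D -> u \in T ->
  z \in T -> incone u a b z -> z \in [fset u; a; b]%fset.
Proof.
move=> h1 h2 uT zT [p [q [p0 q0 hx hy]]].
have [f1 s1 e1] := rt_supp rt h1; have [f2 s2 e2] := rt_supp rt h2.
have hc f S y : contact L f = S -> y \in S -> y \in L /\ af f y = c y.
  by move=> <- /contactP.
have [uL u1] := hc _ _ u e1 ltac:(by rewrite fset3P eqxx).
have [aL a1] := hc _ _ a e1 ltac:(by rewrite fset3P eqxx orbT).
have [bL b1] := hc _ _ b e1 ltac:(by rewrite fset3P eqxx !orbT).
have [_ u2] := hc _ _ u e2 uT; have [zL z2] := hc _ _ z e2 zT.
rewrite -e1; apply/contactP; split=> //; apply/le_anti; rewrite s1 //=.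
rewrite -z2 (af_comb f2 hx hy) (af_comb f1 hx hy) u1 u2 a1 b1.
by rewrite lerD // ?lerD // ler_wpM2l ?ler0z // lerD2r s2.
Qed.

Lemma triangle_eq u a b T : [fset u; a; b]%fset \in D -> T \in D ->
  (T `<=` [fset u; a; b])%fset -> T = [fset u; a; b]%fset.
Proof.
move=> h1 h2 s; apply/eqP; rewrite eqEfcard s.
by rewrite !unimodular_card //; apply: rt_tri rt _ _.
Qed.

(** The two supporting functions agree at [u] and [v], so their difference is a multiple of
    [area2 u v]. Its sign, read off at [w], makes [f1] touch [c] at [w'] as well. *)
Lemma same_side u v w w' : [fset u; v; w]%fset \in D ->
  [fset u; v; w']%fset \in D -> 0 < area2 u v w -> 0 < area2 u v w' -> w = w'.
Proof.
move=> h1 h2 a1 a2.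
have [f1 s1 e1] := rt_supp rt h1; have [f2 s2 e2] := rt_supp rt h2.
have hc f S y : contact L f = S -> y \in S -> y \in L /\ af f y = c y.
  by move=> <- /contactP.
have [uL u1] := hc _ _ u e1 ltac:(by rewrite fset3P eqxx).
have [vL v1] := hc _ _ v e1 ltac:(by rewrite fset3P eqxx orbT).
have [wL w1] := hc _ _ w e1 ltac:(by rewrite fset3P eqxx !orbT).
have [_ u2] := hc _ _ u e2 ltac:(by rewrite fset3P eqxx).
have [_ v2] := hc _ _ v e2 ltac:(by rewrite fset3P eqxx orbT).
have [wL' w2] := hc _ _ w' e2 ltac:(by rewrite fset3P eqxx !orbT).
have : w' \in contact L f1.
  apply/contactP; split=> //; apply/le_anti; rewrite s1 //=.
  have B1 := af_bary f1 u v w w'; have B2 := af_bary f2 u v w w'.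
  have a1R : 0 < (area2 u v w)%:~R :> R by rewrite ltr0z.
  rewrite -(ler_pM2r a1R) -w2 B1 B2 u1 u2 v1 v2 w1 lerD2l.
  by rewrite ler_pM2r ?ltr0z // s2.
rewrite e1 fset3P => /or3P[] /eqP e //; move: a2; rewrite e area2E; lia.
Qed.

Lemma opposite_side u v w w' : [fset u; v; w]%fset \in D ->
  [fset u; v; w']%fset \in D -> w != w' -> area2 u v w = 1 -> area2 u v w' = -1.
Proof.
move=> h1 h2 ww a1; have := unimodular_area (rt_tri rt h2).
case: (ltP 0 (area2 u v w')) => ha; last by lia.
have a1' : 0 < area2 u v w by rewrite a1.
by case/eqP: ww; apply: (same_side h1 h2 a1' ha).
Qed.

End Triangles.

(** As [L] lies in the cone of the triangle at [u], no other triangle contains [u]. The point to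
    check is that removing [u] uncovers no new face. *)
Lemma regtri_remove L D u a b : regtri L D -> [fset u; a; b]%fset \in D ->
  (forall z, z \in L -> incone u a b z) ->
  regtri (L `\ u)%fset (D `\ [fset u; a; b])%fset.
Proof.
move=> rt hT hL; set T := [fset u; a; b]%fset.
have only T' : T' \in D -> u \in T' -> T' = T.
  move=> hT' uT'; apply: (triangle_eq rt) => //; apply/fsubsetP => z zT'.
  apply: (cone_mem rt hT hT') => //; apply: hL.
  exact: (fsubsetP (rt_sub rt hT')).
have [f0 s0 e0] := rt_supp rt hT.
have inT y : y \in T -> y \in L /\ af f0 y = c y by rewrite /T -e0 => /contactP.
have [uL u1] := inT u ltac:(by rewrite fset3P eqxx).
have [aL a1] := inT a ltac:(by rewrite fset3P eqxx orbT).
have [bL b1] := inT b ltac:(by rewrite fset3P eqxx !orbT).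
have ar : `|area2 u a b| = 1 by apply/unimodular_area/(rt_tri rt).
have [ua ub ab] : [/\ u != a, u != b & a != b] by apply: area2_neq; lia.
split.
- by move=> T'; rewrite !inE => /andP[_ /(rt_tri rt)].
- move=> T'; rewrite !inE => /andP[TT' hT'].
  have uT' : u \notin T' by apply: contra TT' => /(only _ hT') ->.
  have [f s e] := rt_supp rt hT'; exists f.
    by move=> z; rewrite !inE => /andP[_ /s].
  rewrite -e; apply/fsetP => z; apply/contactP/contactP; rewrite !inE.
    by case=> /andP[].
  case=> zL fz; rewrite zL andbT; split=> //; apply: contra uT' => /eqP <-.
  by rewrite -e; apply/contactP.
move=> f s td.
have [fu|fu] := leP (af f u) (c u).
  have sL : supports L f.
    by move=> z zL; have [->//|zu] := eqVneq z u; apply: s; rewrite !inE zu.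
  have sub : (contact (L `\ u) f `<=` contact L f)%fset.
    by apply/fsubsetP => z /contactP[]; rewrite !inE => /andP[_ zL] fz; rewrite zL fz eqxx.
  have tdL : two_dimensional [set` contact L f].
    have [x [y [z [hx hy hz hh]]]] := td.
    by exists x, y, z; split=> //=; apply: (fsubsetP sub).
  have hC := rt_max rt sL tdL.
  have ceq : contact (L `\ u)%fset f = (contact L f `\ u)%fset.
    by apply/fsetP => z; rewrite !inE andbA.
  have uC : u \notin contact L f.
    apply/negP => uC; have CT := only _ hC uC.
    have [x [y [z [hx hy hz hh]]]] := td.
    move: hx hy hz hh; rewrite /= ceq CT !inE.
    move=> /andP[/negbTE-> /=] hx /andP[/negbTE-> /=] hy /andP[/negbTE-> /=] hz.
    by rewrite (area2_degenerate hx hy hz) eqxx.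
  have -> : contact (L `\ u)%fset f = contact L f.
    rewrite ceq; apply/fsetP => z; rewrite in_fsetD1.
    by case: eqP => // ->; rewrite (negbTE uC).
  rewrite in_fsetD1 hC andbT; apply: contra uC => /eqP ->.
  by rewrite fset3P eqxx.
(* Here [f] exceeds [c] at [u], so it did not support [L]. On the rest of the cone, where
   [p + q >= 1], it stays below [f0]; its contact points are then among [a] and [b], and the face
   degenerates. *)
have fa : af f a <= c a by apply: s; rewrite !inE eq_sym ua.
have fb : af f b <= c b by apply: s; rewrite !inE eq_sym ub.
have key z : z \in contact (L `\ u)%fset f -> (z == a) || (z == b).
  move=> /contactP[]; rewrite !inE => /andP[zu zL] fz.
  have [p [q [p0 q0 hx hy]]] := hL _ zL.
  have pq : 1 <= p + q.
    rewrite leNgt; apply: contra zu => h; apply/eqP.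
    have [p00 q00] : p = 0 /\ q = 0 by move: p0 q0 h; clear; lia.
    by apply: lat_eq; rewrite ?hx ?hy p00 q00 !mul0r !addr0.
  have pqR : 1 <= p%:~R + q%:~R :> R by rewrite -rmorphD /= (ler1z R).
  have hz : af f z <= af f0 z.
    rewrite (af_comb f hx hy) (af_comb f0 hx hy) u1 a1 b1.
    have pR : 0 <= p%:~R :> R by rewrite ler0z.
    have qR : 0 <= q%:~R :> R by rewrite ler0z.
    nra.
  have : z \in T.
    by rewrite /T -e0; apply/contactP; split=> //; apply/le_anti; rewrite s0 //= -fz.
  by rewrite fset3P (negbTE zu).
have [x [y [z [hx hy hz hh]]]] := td.
by move: hh; rewrite (area2_degenerate (key _ hx) (key _ hy) (key _ hz)) eqxx.
Qed.

End RegularTriangulation.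

(** * Edge lengths of tropical curves *)

Section DualEdge.
Variable R : realType.
Local Notation plane := 'cV[R]_2.
Implicit Types (P : set plane) (c : lat -> R) (x : plane).

Lemma plane_eq (x y : plane) : px x = px y -> py x = py y -> x = y.
Proof.
move=> h0 h1; apply/matrixP => i j; rewrite (ord1 j).
case: (unliftP 0 i) => [k ->|-> //].
by rewrite (ord1 k) (_ : lift 0 0 = 1) //; apply/val_inj.
Qed.

Definition mkplane (a b : R) : plane := \col_(i < 2) if i == 0 then a else b.

Lemma px_mkplane a b : px (mkplane a b) = a. Proof. by rewrite mxE. Qed.
Lemma py_mkplane a b : py (mkplane a b) = b. Proof. by rewrite mxE. Qed.
Lemma px_mkpt a b : px (mkpt a b) = a. Proof. by rewrite mxE. Qed.
Lemma py_mkpt a b : py (mkpt a b) = b. Proof. by rewrite mxE. Qed.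

Lemma termE c v x :
  Defs.term c v x = c v + (px v)%:~R * px x + (py v)%:~R * py x.
Proof.
rewrite /Defs.term !big_ord_recl big_ord0 addr0 addrA.
by have -> : lift ord0 ord0 = 1 :> 'I_2 by apply/val_inj.
Qed.

(* The affine function with slope [- x] that lies below [c] and touches it
   exactly at the minimizers of [x] if [t] is the value of the tropical
   polynomial at [x]. *)
Definition plane_af x (t : R) : R * R * R := (t, - px x, - py x).

Lemma plane_afE x t z :
  af (plane_af x t) z = t - (px z)%:~R * px x - (py z)%:~R * py x.
Proof. by rewrite /af /=; ring. Qed.

Section Finite.
Variables (P : set plane) (c : lat -> R).
Hypothesis finP : finite_set (lattice_points P).
Let L := fset_set (lattice_points P).

Lemma mem_latpts z : z \in L <-> lattice_points P z.
Proof. by rewrite in_fset_set //; split=> [/set_mem|/mem_set]. Qed.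

Lemma minimizers_support x v : minimizers P c x v ->
  supports c L (plane_af x (Defs.term c v x)) /\
  minimizers P c x = [set` contact c L (plane_af x (Defs.term c v x))].
Proof.
move=> [hv hm]; split.
  by move=> z /mem_latpts/hm; rewrite plane_afE (termE c z); lra.
apply/seteqP; split=> z /=.
  move=> [hz hz']; apply/contactP; split; first exact/mem_latpts.
  have := hm _ hz; have := hz' _ hv; rewrite plane_afE (termE c z); lra.
move=> /contactP[/mem_latpts hz e]; split=> // w hw.
apply: le_trans (hm _ hw); move: e; rewrite plane_afE (termE c z); lra.
Qed.

Lemma support_minimizers f : supports c L f -> (exists z, z \in contact c L f) ->
  minimizers P c (mkplane (- f.1.2) (- f.2)) = [set` contact c L f].
Proof.
move=> sf [z0 /contactP[z0L e0]].
have E z : Defs.term c z (mkplane (- f.1.2) (- f.2)) = c z - af f z + f.1.1.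
  by rewrite termE px_mkplane py_mkplane /af; ring.
apply/seteqP; split=> z /=.
  move=> [hz hm]; apply/contactP; split; first exact/mem_latpts.
  have := hm z0 (proj1 (mem_latpts _) z0L); rewrite !E e0.
  have := sf z (proj2 (mem_latpts _) hz); lra.
move=> /contactP[zL e]; split; first exact/mem_latpts.
by move=> w /mem_latpts/sf; rewrite !E e; lra.
Qed.

Lemma regtri_of_induces D : induces P c D -> regtri c L D.
Proof.
move=> [tri eqD]; split=> //.
- move=> T TD.
  have : [set [set` T] | T in [set` D]] [set` T] by exists T.
  rewrite eqD /= => -[[u [v [w [hu hv hw hh]]]] [x ex]].
  have hmin : minimizers P c x u by rewrite -ex.
  have [s e] := minimizers_support hmin; exists (plane_af x (Defs.term c u x)) => //.
  by apply/fsetP => z; have := congr1 (fun A : set lat => A z) e;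
    rewrite -ex /= propeqE => h; apply/idP/idP => /h.
- move=> f sf td.
  have : [set T | two_dimensional T /\ exists x, T = minimizers P c x] [set` contact c L f].
    split=> //; exists (mkplane (- f.1.2) (- f.2)).
    rewrite support_minimizers //.
    by have [u [_ [_ [hu _ _ _]]]] := td; exists u.
  rewrite -eqD => -[T TD e].
  suff <- : T = contact c L f by [].
  by apply/fsetP => z; have := congr1 (fun A : set lat => A z) e;
    rewrite /= propeqE => h; apply/idP/idP => /h.
Qed.

Lemma two_dimensional_unimodular T : unimodular_triangle T -> two_dimensional [set` T].
Proof.
move=> [u [v [w [-> h]]]]; exists u, v, w; split => /=; rewrite ?fset3P ?eqxx ?orbT //.
by rewrite -normr_eq0 h.
Qed.

Lemma induces_of_regtri D : regtri c L D -> induces P c D.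
Proof.
move=> rt; split; first exact: rt_tri rt.
apply/seteqP; split=> A /=.
  move=> [T TD <-]; have tdT := two_dimensional_unimodular (rt_tri rt TD).
  split=> //; have [f sf e] := rt_supp rt TD.
  exists (mkplane (- f.1.2) (- f.2)); rewrite support_minimizers ?e //.
  by have [u [_ [_ [hu _ _ _]]]] := tdT; exists u.
move=> [td [x ex]]; have [u [_ [_ [hu _ _ _]]]] := td.
have hmin : minimizers P c x u by rewrite -ex.
have [s e] := minimizers_support hmin.
by exists (contact c L (plane_af x (Defs.term c u x))); rewrite ?ex //;
   apply: (rt_max rt s); rewrite -e -ex.
Qed.

End Finite.

(* By the affine relation between the vertices of the quadrilateral, this is the
   amount by which [c] fails to be affine across [{u, v}], the common edge of the
   triangles with apexes [w] and [w'] and with area 1 and -1. *)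
Definition lam c (u v w w' : lat) : R :=
  c w + c w' - (area2 v w w')%:~R * c u - (area2 u w' w)%:~R * c v.

Lemma mulz_eq1 (k m : int) : k * m = 1 -> k = 1 \/ k = -1.
Proof.
move=> h; have /eqP : (`|k| * `|m| = 1)%N by lia.
by rewrite muln_eq1; lia.
Qed.

Lemma primitive_parallel (p q : lat) : primitive p -> primitive q ->
  px p * py q = py p * px q -> q = p \/ q = - p.
Proof.
move=> /coprimezP[[a b] /= hp] /coprimezP[[a' b'] /= hq] e.
set k := a * px q + b * py q.
have kx : k * px p = px q.
  transitivity (a * px p * px q + b * (px p * py q)); first by rewrite /k; ring.
  by rewrite e -[RHS]mul1r -hp; ring.
have ky : k * py p = py q.
  transitivity (a * (py p * px q) + b * py p * py q); first by rewrite /k; ring.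
  by rewrite -e -[RHS]mul1r -hp; ring.
have k1 : k * (a' * px p + b' * py p) = 1 by rewrite -hq -kx -ky; ring.
have : k = 1 \/ k = -1.
  by apply: mulz_eq1 k1.
case=> ek; [left|right]; apply: lat_eq; rewrite -?kx -?ky ?mxE -?kx -?ky ek ?mul1r ?mulN1r //.
Qed.

(** Used in both directions, this makes the length in [edge_length] independent of the chosen
    starting point and primitive direction. *)
Lemma segment_length_le (x x' : plane) (p q : lat) (l l' : R) :
  primitive p -> primitive q -> 0 <= l -> 0 <= l' ->
  [set x + t *: emb R p | t in [set t | 0 <= t <= l]] =
  [set x' + t *: emb R q | t in [set t | 0 <= t <= l']] -> l' <= l.
Proof.
move=> pp pq l0 l0' e.
have [->//|l'n] := eqVneq l' 0.
have h0 : [set x' + t *: emb R q | t in [set t | 0 <= t <= l']] x'.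
  by exists 0; rewrite ?scale0r ?addr0 //= lexx.
have h1 : [set x' + t *: emb R q | t in [set t | 0 <= t <= l']] (x' + l' *: emb R q).
  by exists l' => //=; rewrite lexx l0'.
move: h0 h1; rewrite -e => -[t0 /= ht0 e0] [t1 /= ht1 e1].
have ex : l' * (px q)%:~R = (t1 - t0) * (px p)%:~R.
  have := congr1 (fun y : plane => px y) e1; have := congr1 (fun y : plane => px y) e0.
  by rewrite /emb !mxE; lra.
have ey : l' * (py q)%:~R = (t1 - t0) * (py p)%:~R.
  have := congr1 (fun y : plane => py y) e1; have := congr1 (fun y : plane => py y) e0.
  by rewrite /emb !mxE; lra.
have par : px p * py q = py p * px q.
  apply/eqP; rewrite -(eqr_int R) !rmorphM /=; apply/eqP.
  apply: (mulfI l'n); transitivity ((px p)%:~R * (l' * (py q)%:~R)); first by ring.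
  rewrite ey; transitivity ((py p)%:~R * (l' * (px q)%:~R)); last by ring.
  by rewrite ex; ring.
have [a|b] : (px p)%:~R != 0 :> R \/ (py p)%:~R != 0 :> R.
  have [h|h] := eqVneq ((px p)%:~R : R) 0; last by left.
  right; apply/eqP => h'; move: pp h h' => /coprimezP[[a b] /= hp].
  move=> /eqP; rewrite intr_eq0 => /eqP h /eqP; rewrite intr_eq0 => /eqP h'.
  by move: hp; rewrite h h' !mulr0.
- case: (primitive_parallel pp pq par) => eq; move: ex; rewrite eq ?mxE ?rmorphN.
    by move=> /(mulIf a); lra.
  move=> h; have : - l' = t1 - t0 by apply: (mulIf a); rewrite -h; ring.
  lra.
- case: (primitive_parallel pp pq par) => eq; move: ey; rewrite eq ?mxE ?rmorphN.
    by move=> /(mulIf b); lra.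
  move=> h; have : - l' = t1 - t0 by apply: (mulIf b); rewrite -h; ring.
  lra.
Qed.

Section EdgeLength.
Variables (P : set plane) (c : lat -> R) (D : {fset {fset lat}}).
Hypothesis finP : finite_set (lattice_points P).
Hypothesis rt : regtri c (fset_set (lattice_points P)) D.
Variables u v w w' : lat.
Hypotheses (hT : [fset u; v; w]%fset \in D) (hT' : [fset u; v; w']%fset \in D).
Hypotheses (area1 : area2 u v w = 1) (area1' : area2 u v w' = -1).
Let L := fset_set (lattice_points P).

(** The edge vector turned by a right angle, oriented so that its product with [z - u] is
    [area2 u v z]. *)
Definition conormal : lat := mkpt (- (py v - py u)) (px v - px u).

Lemma conormal_primitive : primitive conormal.
Proof.
apply/coprimezP; exists (px w - px u, py w - py u) => /=.
by rewrite px_mkpt py_mkpt; move: area1; rewrite area2E => <-; ring.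
Qed.

(* Moving along the dual edge by [t] changes the supporting affine function by
   a multiple of [area2 u v], which vanishes on the line through [u] and [v]. *)
Lemma dual_edge_segment : exists x, 0 <= lam c u v w w' /\
  dual_edge P c [fset u; v]%fset =
  [set x + t *: emb R conormal | t in [set t | 0 <= t <= lam c u v w w']].
Proof.
have [f s e] := rt_supp rt hT; have [f' s' e'] := rt_supp rt hT'.
have hc g S y : contact c L g = S -> y \in S -> y \in L /\ af g y = c y.
  by move=> <- /contactP.
have [uL fu] := hc _ _ u e ltac:(by rewrite fset3P eqxx).
have [vL fv] := hc _ _ v e ltac:(by rewrite fset3P eqxx orbT).
have [wL fw] := hc _ _ w e ltac:(by rewrite fset3P eqxx !orbT).
have [_ fu'] := hc _ _ u e' ltac:(by rewrite fset3P eqxx).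
have [_ fv'] := hc _ _ v e' ltac:(by rewrite fset3P eqxx orbT).
have [wL' fw'] := hc _ _ w' e' ltac:(by rewrite fset3P eqxx !orbT).
have tilt g : af g u = c u -> af g v = c v -> forall z,
    af g z = af f z + (af g w - c w) * (area2 u v z)%:~R.
  move=> gu gv z; have := af_bary g u v w z; have := af_bary f u v w z.
  by rewrite area1 fu fv fw gu gv !mulr1 => -> ->; ring.
have hl : af f' w - c w = - lam c u v w w'.
  have := tilt f' fu' fv' w'; rewrite fw' area1'.
  have := af_bary f u v w w'; rewrite area1 area1' fu fv fw /lam mulr1.
  rewrite (_ : area2 w' v w = area2 v w w'); last by rewrite !area2E; ring.
  by rewrite rmorphN /= => -> ->; lra.
set l := lam c u v w w' in hl *.
have l0 : 0 <= l by have := s' w wL; lra.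
set x0 := mkplane (- f.1.2) (- f.2).
exists x0; split=> //.
have E z t : af f z - t * (area2 u v z)%:~R =
    af (plane_af (x0 + t *: emb R conormal)
      (f.1.1 - t * ((py v - py u) * px u - (px v - px u) * py u)%:~R)) z.
  rewrite plane_afE area2E /af /x0 /emb !mxE /=.
  by rewrite !(rmorphB, rmorphM, rmorphN) /=; ring.
apply/seteqP; split=> x /=.
  move=> hx.
  have hu : minimizers P c x u by apply: hx; rewrite /= !inE eqxx.
  have hv : minimizers P c x v by apply: hx; rewrite /= !inE eqxx orbT.
  have [sg eg] := minimizers_support finP hu.
  set g := plane_af x _ in sg eg.
  have gu : af g u = c u by move: hu; rewrite eg => /contactP[].
  have gv : af g v = c v by move: hv; rewrite eg => /contactP[].
  have hg := tilt g gu gv; set t := c w - af g w.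
  exists t.
    apply/andP; split; first by have := sg w wL; rewrite /t; lra.
    have := sg w' wL'; rewrite hg area1'.
    have := tilt f' fu' fv' w'; rewrite fw' area1' hl rmorphN /= /t; lra.
  have hgz z : af g z = af f z - t * (area2 u v z)%:~R by rewrite hg /t; ring.
  have ax z : af f z - t * (area2 u v z)%:~R = _ := E z t.
  (* Two affine functions that agree at three independent points have equal slopes, which identifies
     [x] on the segment. *)
  have h0 := hgz (mkpt 0 0); have h1 := hgz (mkpt 1 0); have h2 := hgz (mkpt 0 1).
  move: h0 h1 h2; rewrite !ax !plane_afE !px_mkpt !py_mkpt => h0 h1 h2.
  by apply: plane_eq; move: h0 h1 h2; rewrite ?mul0r ?mul1r; lra.
move=> [t /andP[t0 tl] <-] z zuv.
set g := plane_af (x0 + t *: emb R conormal)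
  (f.1.1 - t * ((py v - py u) * px u - (px v - px u) * py u)%:~R).
have sg : supports c L g.
  move=> y yL; rewrite -E; have fy := s y yL.
  have [a0|a0] := leP 0 (area2 u v y).
    have : 0 <= t * (area2 u v y)%:~R by rewrite mulr_ge0 // ler0z.
    lra.
  have := s' y yL; rewrite (tilt f') // hl.
  have : (area2 u v y)%:~R < 0 :> R by rewrite ltrz0.
  nra.
have zg : z \in contact c L g.
  apply/contactP; rewrite -E; move: zuv; rewrite /= !inE => /orP[] /eqP->.
    by rewrite fu (_ : area2 u v u = 0) ?mulr0 ?subr0 // area2E; ring.
  by rewrite fv (_ : area2 u v v = 0) ?mulr0 ?subr0 // area2E; ring.
have := support_minimizers finP sg (ex_intro _ z zg).
rewrite (_ : mkplane _ _ = x0 + t *: emb R conormal) => [->//|].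
by apply: plane_eq; rewrite ?px_mkplane ?py_mkplane /= opprK.
Qed.

Lemma edge_length_quad : edge_length P c [fset u; v]%fset = lam c u v w w'.
Proof.
have [x [l0 e]] := dual_edge_segment.
have hl : 0 <= lam c u v w w' /\ exists x u0, primitive u0 /\
    dual_edge P c [fset u; v]%fset =
    [set x + t *: emb R u0 | t in [set t | 0 <= t <= lam c u v w w']].
  by split=> //; exists x, conormal; split=> //; apply: conormal_primitive.
rewrite /edge_length; case: xgetP => [l -> [l0' [x' [q [pq e']]]]|/(_ _ hl)//].
have pc := conormal_primitive; apply/le_anti/andP; split.
  by apply: (segment_length_le pc pq l0 l0' (etrans (esym e) e')).
by apply: (segment_length_le pq pc l0' l0 (etrans (esym e') e)).
Qed.

End EdgeLength.

End DualEdge.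

(** * The dual graph and its core *)

Section FsetAux.
Local Open Scope fset_scope.

Lemma cardfs2_ex (T : choiceType) (A : {fset T}) : #|` A| = 2%N ->
  exists a b, a != b /\ A = [fset a; b].
Proof.
move=> h; have /fset0Pn[a aA] : A != fset0 by rewrite -cardfs_eq0 h.
have : #|` A `\ a| == 1%N by move/eqP: h; rewrite (cardfsD1 a A) aA add1n eqSS.
move=> /cardfs1P[b eb]; exists a, b.
have : b \in A `\ a by rewrite eb inE.
rewrite !inE => /andP[ba bA]; split; first by rewrite eq_sym.
by rewrite -(fsetD1K aA) eb.
Qed.

Lemma unimodular_third (T : {fset lat}) (u v : lat) : unimodular_triangle T ->
  u \in T -> v \in T -> u != v -> exists w, T = [fset u; v; w].
Proof.
move=> [a [b [c [-> _]]]]; rewrite !fset3P.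
case/or3P => /eqP-> /or3P[] /eqP->; rewrite ?eqxx // => _;
 first [exists a; apply/fsetP => z; rewrite !fset3P;
        by case: (z == a); case: (z == b); case: (z == c)
      | exists b; apply/fsetP => z; rewrite !fset3P;
        by case: (z == a); case: (z == b); case: (z == c)
      | exists c; apply/fsetP => z; rewrite !fset3P;
        by case: (z == a); case: (z == b); case: (z == c)].
Qed.

End FsetAux.

Section DualGraph.
Local Open Scope fset_scope.
Variable D : {fset {fset lat}}.
Implicit Types (e T : {fset lat}) (E : {fset {fset lat}}).

Lemma starP e T : (T \in star D e) = (T \in D) && (e `<=` T).
Proof. by rewrite !inE. Qed.

Lemma boundedP e : reflect
  [/\ exists2 T, T \in D & e `<=` T, #|` e| = 2%N & #|` star D e| = 2%N]
  (e \in bounded_edges D).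
Proof.
rewrite !inE /=; apply: (iffP andP).
  move=> [/bigfcupP[T /andP[TD _]]]; rewrite fpowersetE => eT.
  by move=> /andP[/eqP-> /eqP->]; split=> //; exists T.
move=> [[T TD eT] -> ->]; split=> //; apply/bigfcupP.
by exists T; rewrite ?TD ?fpowersetE.
Qed.

Lemma remove_leaves_sub E : remove_leaves D E `<=` E.
Proof. by apply/fsubsetP => e; rewrite !inE => /andP[]. Qed.

Lemma iter_remove_sub n E : iter n (remove_leaves D) E `<=` E.
Proof.
by elim: n => //= n IH; apply: fsubset_trans (remove_leaves_sub _) IH.
Qed.

Lemma core_bounded : core D `<=` bounded_edges D.
Proof. exact: iter_remove_sub. Qed.

(** Each round either changes nothing or removes at least one edge, so as many rounds as there are
    edges reach the fixed point. *)
Lemma core_fixed : remove_leaves D (core D) = core D.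
Proof.
set E := bounded_edges D.
suff h n : remove_leaves D (iter n (remove_leaves D) E) = iter n (remove_leaves D) E
    \/ (#|` iter n (remove_leaves D) E| + n <= #|` E|)%N.
  case: (h #|` E|) => //; rewrite -[leqRHS]add0n leq_add2r leqn0 cardfs_eq0 -/(core D).
  by move=> /eqP ->; apply/eqP; rewrite -fsubset0 remove_leaves_sub.
elim: n => [|n [IH|IH]]; first by right; rewrite addn0.
  by left; rewrite iterS !IH.
rewrite iterS; set X := iter n _ _ in IH *.
have [e|ne] := eqVneq (remove_leaves D X) X; first by left; rewrite !e.
right; apply: leq_trans IH; rewrite addnS ltn_add2r fproper_ltn_card //.
by rewrite fproperEneq ne remove_leaves_sub.
Qed.

Lemma core_leafless e T : e \in core D -> T \in star D e -> (1 < degree (core D) T)%N.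
Proof. move=> he hT; have : e \in remove_leaves D (core D) by rewrite core_fixed.
by rewrite in_fset => /andP[_ /allP/(_ T hT)].
Qed.

Lemma core_maximal : (forall e T, e \in bounded_edges D -> T \in star D e ->
  (1 < degree (bounded_edges D) T)%N) -> core D = bounded_edges D.
Proof.
move=> h; have fx : remove_leaves D (bounded_edges D) = bounded_edges D.
  apply/eqP; rewrite eqEfsubset remove_leaves_sub; apply/fsubsetP => e he.
  by rewrite in_fset; apply/andP; split=> //; apply/allP => T; apply: h.
by rewrite /core; elim: #|` _| => //= n ->.
Qed.

(** The edge is oriented, with [w] on its left and [w'] on its right. This leaves a single
    ambiguity, reversing the edge and exchanging the apexes. *)
Definition is_quad e (u v w w' : lat) : Prop :=
  [/\ e = [fset u; v], star D e = [fset [fset u; v; w]; [fset u; v; w']],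
      area2 u v w = 1 & area2 u v w' = -1].

Lemma quad_neq e u v w w' : is_quad e u v w w' ->
  [/\ u != v, [/\ u != w, v != w, u != w' & v != w'] & w != w'].
Proof.
move=> [_ _ a1 a2]; have [-> -> ->] : [/\ u != v, u != w & v != w].
  by apply: area2_neq; rewrite a1.
have [_ -> ->] : [/\ u != v, u != w' & v != w'].
  by apply: area2_neq; rewrite a2.
by split=> //; apply/eqP => h; move: a2; rewrite -h a1.
Qed.

Lemma quad_star e u v w w' : is_quad e u v w w' -> forall T,
  (T \in D) && (e `<=` T) = (T == [fset u; v; w]) || (T == [fset u; v; w']).
Proof. by move=> [_ h _ _] T; rewrite -starP h !inE. Qed.

Lemma quad_in e u v w w' : is_quad e u v w w' ->
  [fset u; v; w] \in D /\ [fset u; v; w'] \in D.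
Proof.
move=> q; have := quad_star q [fset u; v; w']; have := quad_star q [fset u; v; w].
by rewrite !eqxx orbT => /andP[-> _] /andP[-> _].
Qed.

Lemma quad_bounded e u v w w' : is_quad e u v w w' -> e \in bounded_edges D.
Proof.
move=> q; have [uv [uw vw uw' vw'] ww'] := quad_neq q.
have [h1 h2] := quad_in q; have [-> sE _ _] := q.
apply/boundedP; split; last 1 first.
- rewrite sE cardfs2.
  suff -> : [fset u; v; w] != [fset u; v; w'] by [].
  apply/eqP => h; have : w \in [fset u; v; w'] by rewrite -h fset3P eqxx !orbT.
  by rewrite fset3P !(eq_sym w) (negbTE uw) (negbTE vw) eq_sym (negbTE ww').
- by exists [fset u; v; w] => //; apply: fsubsetUl.
- by rewrite cardfs2 uv.
Qed.

Lemma quad_unique e u v w w' a b d d' : is_quad e u v w w' -> is_quad e a b d d' ->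
  [/\ a = u, b = v, d = w & d' = w'] \/ [/\ a = v, b = u, d = w' & d' = w].
Proof.
move=> q q'; have [uv [uw vw uw' vw'] ww'] := quad_neq q.
have [ab [ad bd ad' bd'] dd'] := quad_neq q'.
have [eE _ a1 a2] := q; have [eE' _ b1 b2] := q'.
have [hd hd'] := quad_in q'.
have apex z : z != a -> z != b -> [fset a; b; z] \in D -> z = w \/ z = w'.
  move=> za zb zD; have : ([fset a; b; z] \in D) && (e `<=` [fset a; b; z]).
    by rewrite zD eE' fsubsetUl.
  have zn : (z == u) || (z == v) = false.
    transitivity (z \in e); first by rewrite eE !inE.
    by rewrite eE' !inE (negbTE za) (negbTE zb).
  have zz : z \in [fset a; b; z] by rewrite fset3P eqxx !orbT.
  by rewrite (quad_star q) => /orP[] /eqP h; move: zz; rewrite h fset3P orbA zn => /eqP; [left|right].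
have ha : a \in e by rewrite eE' !inE eqxx.
have hb : b \in e by rewrite eE' !inE eqxx orbT.
have hd1 := apex d ltac:(by rewrite eq_sym) ltac:(by rewrite eq_sym) hd.
have hd2 := apex d' ltac:(by rewrite eq_sym) ltac:(by rewrite eq_sym) hd'.
have sw x y z : area2 y x z = - area2 x y z by rewrite !area2E; ring.
move: ha hb; rewrite eE !inE => /orP[] /eqP ea /orP[] /eqP eb.
- by move: ab; rewrite ea eb eqxx.
- left; split=> //.
    by case: hd1 => // h; move: b1; rewrite ea eb h a2.
  by case: hd2 => // h; move: b2; rewrite ea eb h a1.
- right; split=> //.
    by case: hd1 => // h; move: b1; rewrite ea eb h sw a1.
  by case: hd2 => // h; move: b2; rewrite ea eb h sw a2.
- by move: ab; rewrite ea eb eqxx.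
Qed.

Section Regular.
Variables (R : realType) (c : lat -> R) (L : {fset lat}).
Hypothesis rt : regtri c L D.

(** By [same_side] an edge has at most one triangle on each side, so the two given ones form its
    whole star. *)
Lemma quad_of_pair u v w w' : [fset u; v; w] \in D -> [fset u; v; w'] \in D ->
  area2 u v w = 1 -> area2 u v w' = -1 -> is_quad [fset u; v] u v w w'.
Proof.
move=> h1 h2 a1 a2; split=> //.
have [uv _ _] : [/\ u != v, u != w & v != w] by apply: area2_neq; rewrite a1.
have sw x y z : area2 y x z = - area2 x y z by rewrite !area2E; ring.
apply/fsetP => T; rewrite starP !inE; apply/andP/orP; last first.
  by move=> [] /eqP->; split=> //; apply: fsubsetUl.
move=> [TD /fsubsetP eT].
have uT : u \in T by apply: eT; rewrite !inE eqxx.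
have vT : v \in T by apply: eT; rewrite !inE eqxx orbT.
have [z eT'] := unimodular_third (rt_tri rt TD) uT vT uv.
rewrite eT' in TD; have hz := unimodular_area (rt_tri rt TD).
case: (ltP 0 (area2 u v z)) => h.
  by left; rewrite eT' (same_side rt h1 TD _ h) ?a1.
right; rewrite eT'; apply/eqP; congr (_ `|` [fset _]).
have TD' := TD; have h2' := h2.
move: TD' h2'; rewrite !(fset3_swap u v) => TD' h2'.
apply/esym/(same_side rt h2' TD'); rewrite sw ?a2 //.
by move: hz h; clear; lia.
Qed.

Lemma bounded_quad e : e \in bounded_edges D -> exists u v w w', is_quad e u v w w'.
Proof.
move=> /boundedP[_ /cardfs2_ex[u [v [uv ->]]] /cardfs2_ex[T [T' [TT' sE]]]].
have sw x y z : area2 y x z = - area2 x y z by rewrite !area2E; ring.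
have hT : T \in star D [fset u; v] by rewrite sE !inE eqxx.
have hT' : T' \in star D [fset u; v] by rewrite sE !inE eqxx orbT.
have third S : S \in star D [fset u; v] -> exists w, S = [fset u; v; w].
  rewrite starP => /andP[SD /fsubsetP eS].
  by apply: unimodular_third (rt_tri rt SD) (eS _ _) (eS _ _) uv; rewrite !inE eqxx ?orbT.
have [w eT] := third _ hT; have [w' eT'] := third _ hT'.
move: hT hT'; rewrite !starP eT eT' => /andP[hT _] /andP[hT' _].
have ww : w != w' by apply: contra TT' => /eqP h; rewrite eT eT' h.
have := unimodular_area (rt_tri rt hT).
case: (ltP 0 (area2 u v w)) => h hh.
  have a1 : area2 u v w = 1 by move: h hh; clear; lia.
  exists u, v, w, w'; apply: quad_of_pair => //.
  exact: (opposite_side rt hT hT' ww a1).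
have a1 : area2 v u w = 1 by rewrite sw; move: h hh; clear; lia.
move: hT hT'; rewrite !(fset3_swap u v) => hT hT'.
exists v, u, w, w'; rewrite fsetUC; apply: quad_of_pair => //.
exact: (opposite_side rt hT hT' ww a1).
Qed.

End Regular.

End DualGraph.

(** * Edge lengths of the skeleton *)

Section SkeletonVectors.
Variables (R : realType) (D : {fset {fset lat}}).
Implicit Types (c : lat -> R) (e : {fset lat}) (C : skel_edge D).

(** The quadrilateral around [e] is chosen arbitrarily; by [quad_unique] the only other choice
    reverses the edge, and [lam] is invariant under this. Sets without a quadrilateral get 0. *)
Definition edge_form c e : R :=
  match pselect (exists q : (lat * lat) * (lat * lat),
                   is_quad D e q.1.1 q.1.2 q.2.1 q.2.2) with
  | left h => let q := projT1 (cid h) in lam c q.1.1 q.1.2 q.2.1 q.2.2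
  | right _ => 0
  end.

Lemma edge_formE c e u v w w' : is_quad D e u v w w' ->
  edge_form c e = lam c u v w w'.
Proof.
move=> q; rewrite /edge_form; case: pselect => [h|]; last first.
  by case; exists ((u, v), (w, w')).
case: (cid h) => -[[a b] [d d']] /= q'.
case: (quad_unique q q') => -[-> -> -> ->] //.
by rewrite /lam; ring.
Qed.

(** The affine dependence between the vertices of two unimodular triangles with a common edge. Its
    coefficients are those of [lam], which therefore vanishes on affine functions. *)
Lemma quad_relation (u v w w' : lat) : area2 u v w = 1 -> area2 u v w' = -1 ->
  [/\ px w + px w' = area2 v w w' * px u + area2 u w' w * px v,
      py w + py w' = area2 v w w' * py u + area2 u w' w * py v
    & area2 v w w' + area2 u w' w = 2].
Proof.
move=> a1 a2.
have h : area2 v w w' + area2 u w' w = area2 u v w - area2 u v w'.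
  by rewrite !area2E; ring.
have hA : area2 v w w' = 2 - area2 u w' w by move: h; rewrite a1 a2; clear; lia.
split; last by rewrite hA subrK.
- rewrite hA; apply/eqP; rewrite -subr_eq0; apply/eqP.
  transitivity ((px w - px u) * (area2 u v w' + 1) - (px w' - px u) * (area2 u v w - 1)).
    by rewrite !area2E; ring.
  by rewrite a1 a2; ring.
- rewrite hA; apply/eqP; rewrite -subr_eq0; apply/eqP.
  transitivity ((py w - py u) * (area2 u v w' + 1) - (py w' - py u) * (area2 u v w - 1)).
    by rewrite !area2E; ring.
  by rewrite a1 a2; ring.
Qed.

Lemma edge_form_affine f e : edge_form (af f) e = 0.
Proof.
rewrite /edge_form; case: pselect => // h; case: (cid h) => -[[u v] [w w']] /= q.
have [_ _ a1 a2] := q; have [hx hy hs] := quad_relation a1 a2.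
have hB : (area2 v w w')%:~R = 2 - (area2 u w' w)%:~R :> R.
  by rewrite (_ : area2 v w w' = 2 - area2 u w' w) ?rmorphB //; move: hs; clear; lia.
have hxR := congr1 (fun z : int => z%:~R : R) hx.
have hyR := congr1 (fun z : int => z%:~R : R) hy.
move: hxR hyR; rewrite /= !rmorphD !rmorphM /= /lam /af hB => hxR hyR.
transitivity (f.1.2 * ((px w)%:~R + (px w')%:~R - (2 - (area2 u w' w)%:~R) * (px u)%:~R
   - (area2 u w' w)%:~R * (px v)%:~R) + f.2 * ((py w)%:~R + (py w')%:~R
   - (2 - (area2 u w' w)%:~R) * (py u)%:~R - (area2 u w' w)%:~R * (py v)%:~R)).
  by ring.
by rewrite hxR hyR; ring.
Qed.

Definition delta (z : lat) : lat -> R := fun y => (y == z)%:R.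

Lemma delta_sum c (S : {fset lat}) p : p \in S ->
  c p = \sum_(z <- S) c z * delta z p.
Proof.
move=> pS; rewrite (bigD1_seq p) //= /delta eqxx mulr1 big1 ?addr0 //.
by move=> z zp; rewrite eq_sym (negbTE zp) mulr0.
Qed.

Lemma edge_form_sum c (S : {fset lat}) e u v w w' : is_quad D e u v w w' ->
  [/\ u \in S, v \in S, w \in S & w' \in S] ->
  edge_form c e = \sum_(z <- S) c z * edge_form (delta z) e.
Proof.
move=> q [uS vS wS wS']; rewrite (edge_formE _ q) /lam.
rewrite (delta_sum c uS) (delta_sum c vS) (delta_sum c wS) (delta_sum c wS').
rewrite !mulr_sumr -big_split -sumrB -sumrB; apply: eq_bigr => z _.
by rewrite (edge_formE _ q) /lam /=; ring.
Qed.

(** The linear map from coefficients to skeleton lengths, defined for every [c], whether or not it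
    induces [D]. The vector f_z is [skel_vec D (delta R z)]. *)
Definition skel_vec c : {ffun skel_edge D -> R^o} :=
  [ffun C : skel_edge D => (\sum_(e in val C) edge_form c (val e) : R^o)].

Lemma skel_vec_affine f : skel_vec (af f) = 0.
Proof.
by apply/ffunP => C; rewrite !ffunE big1 // => e _; rewrite edge_form_affine.
Qed.

Section Core.
Variables (L : {fset lat}).
Hypothesis inL : forall T, T \in D -> (T `<=` L)%fset.

Lemma quad_inL e u v w w' : is_quad D e u v w w' ->
  [/\ u \in L, v \in L, w \in L & w' \in L].
Proof.
move=> q; have [/inL/fsubsetP h1 /inL/fsubsetP h2] := quad_in q.
by split; [apply: h1|apply: h1|apply: h1|apply: h2]; rewrite fset3P eqxx ?orbT.
Qed.

Lemma skel_vec_sum c :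
  (forall e, e \in core D -> exists u v w w', is_quad D e u v w w') ->
  skel_vec c = \sum_(z <- L) c z *: skel_vec (delta z).
Proof.
move=> hq; apply/ffunP => C; rewrite sum_ffunE !ffunE.
under [RHS]eq_bigr do rewrite !ffunE /GRing.scale /= mulr_sumr.
rewrite exchange_big /=; apply: eq_bigr => e _.
have [u [v [w [w' q]]]] := hq _ (valP e).
exact: edge_form_sum q (quad_inL q).
Qed.

End Core.

(** Stated for an arbitrary set [e], and false outside the core, so that formulas can mention edges
    not known to be core edges. *)
Definition class_has C e : bool := [exists f in val C, val f == e].

Lemma class_merged C (e f : core D) : connect (@merged D) e f ->
  e \in val C -> f \in val C.
Proof.
move=> ef; have /imsetP[x _ ->] := valP C; rewrite !inE /= => xe.
exact: connect_trans xe ef.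
Qed.

Lemma class_has_merge C e f T : e \in core D -> f \in core D -> T \in D ->
  degree (core D) T = 2%N -> (e `<=` T)%fset -> (f `<=` T)%fset ->
  class_has C e = class_has C f.
Proof.
move=> he hf TD d2 eT fT.
have m (a b : {fset lat}) : a \in core D -> b \in core D -> (a `<=` T)%fset ->
    (b `<=` T)%fset -> class_has C a -> class_has C b.
  move=> ha hb aT bT /existsP[x /andP[xC /eqP xa]].
  apply/existsP; exists [` hb]%fset; rewrite /= eqxx andbT.
  apply: class_merged xC; apply/connect1/hasP; exists T => //.
  by rewrite d2 eqxx xa aT.
by apply/idP/idP; apply: m.
Qed.

Lemma class_exists e (he : e \in core D) : exists C,
  class_has C e /\ val C = [set f | connect (@merged D) [` he]%fset f]%SET.
Proof.
have h : [set f | connect (@merged D) [` he]%fset f]%SET \in skel_edges D.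
  by apply/imsetP; exists [` he]%fset => //; apply/setP => f; rewrite !inE.
exists (exist (fun X => X \in skel_edges D) _ h); split=> //; apply/existsP; exists [` he]%fset.
by rewrite /= inE connect0 eqxx.
Qed.

End SkeletonVectors.

Section ModuliCone.
Variables (R : realType) (P : set 'cV[R]_2) (D : {fset {fset lat}}).
Hypothesis finP : finite_set (lattice_points P).
Let L := fset_set (lattice_points P).

Lemma skeleton_length c : regtri c L D ->
  mg_length (skeleton P D c) = skel_vec D c.
Proof.
move=> rt; apply/ffunP => C; rewrite !ffunE; apply: eq_bigr => e _.
have [u [v [w [w' q]]]] := bounded_quad rt (fsubsetP (core_bounded D) _ (valP e)).
have [eE _ a1 a2] := q; have [h1 h2] := quad_in q.
by rewrite (edge_formE _ q) eE (edge_length_quad finP rt h1 h2 a1 a2).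
Qed.

(** The affine function that is 1 at [z1] and 0 at [z2] and [z3] has zero skeleton lengths; this
    relation is solved for the vector of [z1]. *)
Lemma affine_relation (c : lat -> R) (W : {vspace {ffun skel_edge D -> R^o}})
    (z1 z2 z3 : lat) : regtri c L D -> area2 z1 z2 z3 != 0 ->
  z1 \in L -> (forall z, z \in L -> z \notin [fset z1; z2; z3]%fset ->
     skel_vec D (delta R z) \in W) ->
  skel_vec D (delta R z1) \in W.
Proof.
move=> rt a0 z1L hW.
have hq e (he : e \in core D) := bounded_quad rt (fsubsetP (core_bounded D) _ he).
set A : R := (area2 z1 z2 z3)%:~R.
have A0 : A != 0 by rewrite intr_eq0.
have [f fE] : exists f, forall z, af f z = (area2 z z2 z3)%:~R / A.
  exists (((px z2 * py z3 - py z2 * px z3)%:~R / A,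
    (py z2 - py z3)%:~R / A), (px z3 - px z2)%:~R / A) => z.
  by rewrite /af /= !area2E !(rmorphB, rmorphM) /=; field.
have [z1z2 z1z3 _] := area2_neq a0.
have := skel_vec_sum (rt_sub rt) (af f) hq.
rewrite skel_vec_affine (bigD1_seq z1 z1L (fset_uniq L)) fE mulfV //= scale1r => /esym/eqP.
rewrite addr_eq0 => /eqP->; rewrite memvN big_seq_cond memv_suml // => z /andP[zL zz].
have [e2|n2] := eqVneq z z2.
  by rewrite fE (_ : area2 z z2 z3 = 0) ?mul0r ?scale0r ?mem0v // e2 area2E; ring.
have [e3|n3] := eqVneq z z3.
  by rewrite fE (_ : area2 z z2 z3 = 0) ?mul0r ?scale0r ?mem0v // e3 area2E; ring.
by rewrite memvZ // hW // fset3P (negbTE zz) (negbTE n2).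
Qed.

Lemma cone_dim_le (c : lat -> R) n (S : seq lat) (z1 z2 z3 : lat) :
  regtri c L D -> cone_dim (@moduli_cone R P D) n -> area2 z1 z2 z3 != 0 ->
  z1 \in L -> z2 \in L -> z3 \in L ->
  (forall z, z \in L -> z \notin [fset z1; z2; z3]%fset ->
     skel_vec D (delta R z) \in <<[seq skel_vec D (delta R y) | y <- S]>>%VS) ->
  (n <= size S)%N.
Proof.
move=> rt [U [hU minU <-]] a0 z1L z2L z3L hW.
set W := <<_>>%VS in hW.
have rot (x y z : lat) : area2 x y z = area2 y z x by rewrite !area2E; ring.
have all z : z \in L -> skel_vec D (delta R z) \in W.
  move=> zL; have [|h] := boolP (z \in [fset z1; z2; z3]%fset); last exact: hW.
  rewrite fset3P => /or3P[] /eqP->.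
  - exact: affine_relation rt a0 z1L hW.
  - apply: (affine_relation rt _ z2L (z2 := z3) (z3 := z1)); first by rewrite -rot.
    by move=> y yL; rewrite -fset3_rot; apply: hW.
  - apply: (affine_relation rt _ z3L (z2 := z1) (z3 := z2)); first by rewrite rot.
    by move=> y yL; rewrite fset3_rot; apply: hW.
(* Elements of the cone come from other functions [c'], but these induce the same [D], on which
   alone the vectors of the points depend. *)
have UW : (U <= W)%VS.
  apply: minU => x [c' hc' <-].
  have rt' : regtri c' L D by apply: regtri_of_induces.
  have hq e (he : e \in core D) := bounded_quad rt' (fsubsetP (core_bounded D) _ he).
  rewrite skeleton_length // (skel_vec_sum (rt_sub rt') _ hq).
  by rewrite big_seq memv_suml // => z zL; rewrite memvZ // all.
apply: leq_trans (dimvS UW) _; apply: leq_trans (dim_span _) _.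
by rewrite size_map.
Qed.

End ModuliCone.

(** * Removal of ears *)

Lemma fset2_sub3 (e : {fset lat}) (u a v : lat) : #|` e| = 2%N ->
  (e `<=` [fset u; a; v])%fset ->
  [\/ e = [fset u; v]%fset, e = [fset a; v]%fset | e = [fset u; a]%fset].
Proof.
move=> /cardfs2_ex[x [y [xy ->]]] /fsubsetP h.
have := h x; have := h y; rewrite !fset3P !in_fset2 !eqxx orbT => /(_ isT) hy /(_ isT) hx.
have C (p q : lat) : [fset p; q]%fset = [fset q; p]%fset by rewrite fsetUC.
case/or3P: hx hy xy => /eqP-> /or3P[] /eqP->; rewrite ?eqxx // => _; rewrite 1?C;
  by [apply: Or31|apply: Or32|apply: Or33|rewrite C; apply: Or31|rewrite C; apply: Or32|rewrite C; apply: Or33].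
Qed.

(* A regular triangulation [D] of a set of lattice points [L] that still carries
   the whole skeleton of the triangulation [D0]; [I] plays the role of the
   interior lattice points. *)
Record config (R : realType) (D0 : {fset {fset lat}}) (c : lat -> R)
    (I L : {fset lat}) (D : {fset {fset lat}}) : Prop := {
  cf_rt : regtri c L D;
  cf_sub : forall T, T \in D -> T \in D0;
  cf_core : forall e T, e \in core D0 -> T \in star D0 e -> T \in D;
  cf_int : forall z, z \in I -> z \in L;
  cf_conv : forall (p q z : lat) (m n : int), p \in L -> q \in L -> 0 < m -> 0 < n ->
    (m + n) * px z = m * px p + n * px q ->
    (m + n) * py z = m * py p + n * py q -> z \in L;
  cf_mix : forall (v p q z : lat) (k m n : int), v \in I -> p \in L -> q \in L ->
    0 < k -> 0 <= m -> 0 <= n ->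
    (k + m + n) * px z = k * px v + m * px p + n * px q ->
    (k + m + n) * py z = k * py v + m * py p + n * py q -> z \in I }.

(** An ear is expressed by its cone at [u] containing all of [L], which is exactly the hypothesis
    under which the triangle can be removed. *)
Definition no_ears (I L : {fset lat}) (D : {fset {fset lat}}) : Prop :=
  forall u a b, u \in L -> u \notin I -> [fset u; a; b]%fset \in D ->
  ~ (forall z, z \in L -> incone u a b z).

Section Reduction.
Variables (R : realType) (D0 : {fset {fset lat}}) (c : lat -> R).
Variables (I L0 : {fset lat}).
Hypothesis rt0 : regtri c L0 D0.

Lemma core_quad e : e \in core D0 -> exists u v w w', is_quad D0 e u v w w'.
Proof. by move=> he; apply: (bounded_quad rt0 (fsubsetP (core_bounded _) _ he)). Qed.

Lemma core_card e : e \in core D0 -> #|` e| = 2%N.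
Proof. by move=> /(fsubsetP (core_bounded _))/boundedP[]. Qed.

(* An ear [u, a, b] of the triangulation is dual to a leaf, so that no core edge
   of the dual graph crosses it. *)
Lemma config_remove L D u a b : config D0 c I L D -> u \in L -> u \notin I ->
  [fset u; a; b]%fset \in D -> (forall z, z \in L -> incone u a b z) ->
  config D0 c I (L `\ u)%fset (D `\ [fset u; a; b])%fset.
Proof.
move=> cf uL uI hT hL; have rt := cf_rt cf.
set T := [fset u; a; b]%fset in hT *.
have only T' : T' \in D -> u \in T' -> T' = T.
  move=> hT' uT'; apply: (triangle_eq rt) => //; apply/fsubsetP => z zT'.
  apply: (cone_mem rt hT hT') => //; apply: hL.
  exact: (fsubsetP (rt_sub rt hT')).
have ar := unimodular_area (rt_tri rt hT).
split.
- exact: regtri_remove.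
- by move=> T'; rewrite !inE => /andP[_ /(cf_sub cf)].
- move=> e T' he hT'; rewrite in_fsetD1 (cf_core cf he hT') andbT.
  apply/eqP => eT; have := core_leafless he hT'; rewrite eT.
  (* An edge of [T] at [u] lies in no second triangle of [D], whereas both triangles of a core edge
     belong to [D]. So [T] would have degree at most 1, which triangles along core edges do not. *)
  suff h f : f \in core D0 -> (f `<=` T)%fset -> f = [fset a; b]%fset.
    rewrite ltnNge => /negP; apply.
    rewrite -(cardfs1 [fset a; b]%fset); apply: fsubset_leq_card.
    by apply/fsubsetP => f; rewrite !inE => /andP[hf fT]; rewrite (h f).
  move=> hf fT.
  have uf : u \notin f.
    apply/negP => uf; have [x [y [w [w' q]]]] := core_quad hf.
    have [_ _ ww'] := quad_neq q; have [fE sE _ _] := q.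
    have sub z : u \in [fset x; y; z]%fset by move: uf; rewrite fE !inE => ->.
    have h1 : [fset x; y; w]%fset \in D by apply: (cf_core cf hf); rewrite sE !inE eqxx.
    have h2 : [fset x; y; w']%fset \in D by apply: (cf_core cf hf); rewrite sE !inE eqxx orbT.
    have := only _ h1 (sub _); rewrite -(only _ h2 (sub _)) => h.
    have : w \in [fset x; y; w']%fset by rewrite -h fset3P eqxx !orbT.
    have [_ [/negbTE xw /negbTE yw _ _] _] := quad_neq q.
    by rewrite fset3P !(eq_sym w) xw yw eq_sym (negbTE ww').
  case: (fset2_sub3 (core_card hf) fT) uf => -> //; rewrite !inE eqxx //.
- move=> z zI; rewrite !inE (cf_int cf zI) andbT.
  by apply: contra uI => /eqP <-.
- move=> p q z m n; rewrite !inE => /andP[pu pL] /andP[qu qL] m0 n0 hx hy.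
  rewrite (cf_conv cf pL qL m0 n0 hx hy) andbT; apply/eqP => zu.
  (* Both end points have nonnegative coordinates in the basis [a - u], [b - u]. If [u] were
     strictly between them, these coordinates would all vanish. *)
  have [p1 [p2 [p10 p20 px1 py1]]] := hL _ pL.
  have [q1 [q2 [q10 q20 qx1 qy1]]] := hL _ qL.
  rewrite zu px1 qx1 in hx; rewrite zu py1 qy1 in hy.
  set ax := px a - px u in px1 qx1 hx; set ay := py a - py u in py1 qy1 hy.
  set bx := px b - px u in px1 qx1 hx; set bY := py b - py u in py1 qy1 hy.
  have dt : `|ax * bY - ay * bx| = 1 by rewrite -ar area2E.
  have hx' : (m * p1 + n * q1) * ax + (m * p2 + n * q2) * bx = 0.
    by move: hx; clear; lia.
  have hy' : (m * p1 + n * q1) * ay + (m * p2 + n * q2) * bY = 0.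
    by move: hy; clear; lia.
  have d0 : ax * bY - ay * bx != 0 by rewrite -normr_eq0 dt.
  have s1 : m * p1 + n * q1 = 0.
    apply: (mulIf d0); rewrite mul0r.
    transitivity (((m * p1 + n * q1) * ax + (m * p2 + n * q2) * bx) * bY
      - ((m * p1 + n * q1) * ay + (m * p2 + n * q2) * bY) * bx); first by ring.
    by rewrite hx' hy'; ring.
  have s2 : m * p2 + n * q2 = 0.
    apply: (mulIf d0); rewrite mul0r.
    transitivity (((m * p1 + n * q1) * ay + (m * p2 + n * q2) * bY) * ax
      - ((m * p1 + n * q1) * ax + (m * p2 + n * q2) * bx) * ay); first by ring.
    by rewrite hx' hy'; ring.
  have p1z : p1 = 0 by move: s1 m0 n0 p10 q10; clear; nia.
  have p2z : p2 = 0 by move: s2 m0 n0 p20 q20; clear; nia.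
  by case/eqP: pu; apply: lat_eq; rewrite ?px1 ?py1 p1z p2z !mul0r !addr0.
- move=> v p q z k m n vI; rewrite !inE => /andP[_ pL] /andP[_ qL].
  exact: (cf_mix cf).
Qed.

Lemma config_reduce L D : config D0 c I L D ->
  exists L' D', [/\ config D0 c I L' D', no_ears I L' D' & (L' `<=` L)%fset].
Proof.
have [n] := ubnP #|` L|; elim: n => // n IH in L D *; rewrite ltnS => Ln cf.
have [ne|nne] := pselect (no_ears I L D); first by exists L, D.
apply: contrapT => H; apply: nne => u a b uL uI hT hL; apply: H.
have [|L' [D' [cf' ne' sub]]] := IH _ _ _ (config_remove cf uL uI hT hL).
  by move: Ln; rewrite (cardfsD1 u L) uL.
by exists L', D'; split=> //; apply: fsubset_trans sub (fsubD1set _ _).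
Qed.

Section Kernel.
Variables (L : {fset lat}) (D : {fset {fset lat}}).
Hypothesis cf : config D0 c I L D.

Lemma core_triangle e x y w w' : e \in core D0 -> is_quad D0 e x y w w' ->
  [fset x; y; w]%fset \in D /\ [fset x; y; w']%fset \in D.
Proof.
by move=> he [_ sE _ _]; split; apply: (cf_core cf he); rewrite sE !inE eqxx ?orbT.
Qed.

(** Both triangles of a core edge belong to [D], so the four points entering its length lie in
    [L]. *)
Lemma skel_vec_out z : z \notin L -> skel_vec D0 (delta R z) = 0.
Proof.
move=> zL; apply/ffunP => C; rewrite !ffunE big1 // => e _.
have he := valP e; have [x [y [w [w' q]]]] := core_quad he.
have [/(rt_sub (cf_rt cf))/fsubsetP h1 /(rt_sub (cf_rt cf))/fsubsetP h2] := core_triangle he q.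
have nz (p : lat) : p \in L -> delta R z p = 0.
  by move=> pL; rewrite /delta; case: eqP => // h; rewrite -h pL in zL.
rewrite (edge_formE _ q) /lam !nz ?mulr0 ?subr0 ?addr0 //.
- by apply: h1; rewrite fset3P eqxx orbT.
- by apply: h1; rewrite fset3P eqxx.
- by apply: h2; rewrite fset3P eqxx !orbT.
- by apply: h1; rewrite fset3P eqxx !orbT.
Qed.

Lemma sum_class_has (C : skel_edge D0) e :
  \sum_(f in val C) (val f == e)%:R = (class_has C e)%:R :> R.
Proof.
have [/existsP[f /andP[fC /eqP fe]]|h] := boolP (class_has C e).
  rewrite (bigD1 f) //= fe eqxx big1 ?addr0 // => f' /andP[_ ff'].
  by rewrite -fe (inj_eq val_inj) (negbTE ff').
rewrite big1 // => f fC; case: eqP => // fe; case/existsP: h.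
by exists f; rewrite fC fe eqxx.
Qed.

Section InnerVertex.
Variables (u a b v : lat) (k : int).
Hypotheses (h1 : [fset u; a; v]%fset \in D) (h2 : [fset u; b; v]%fset \in D).
Hypothesis ab : a != b.
Hypothesis only : forall T, T \in D -> u \in T ->
  T = [fset u; a; v]%fset \/ T = [fset u; b; v]%fset.

Let n1 : [/\ u != a, u != v & a != v].
Proof. exact: (unimodular_neq (rt_tri (cf_rt cf) h1)). Qed.
Let n2 : [/\ u != b, u != v & b != v].
Proof. exact: (unimodular_neq (rt_tri (cf_rt cf) h2)). Qed.

(** The outer edges [[u, a]] and [[u, b]] each lie in a single triangle of [D], as [u] has only two
    triangles, while a core edge needs both of its triangles in [D]. *)
Lemma inner_edge e : e \in core D0 ->
  (e `<=` [fset u; a; v])%fset \/ (e `<=` [fset u; b; v])%fset ->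
  [\/ e = [fset u; v]%fset, e = [fset a; v]%fset | e = [fset b; v]%fset].
Proof.
move=> he sub; have c2 := core_card he.
have [x [y [w [w' q]]]] := core_quad he.
have [_ [xw yw _ _] ww'] := quad_neq q; have [eE _ _ _] := q.
have [t1 t2] := core_triangle he q.
have T12 : [fset x; y; w]%fset <> [fset x; y; w']%fset.
  move=> h; have : w \in [fset x; y; w']%fset by rewrite -h fset3P eqxx !orbT.
  by rewrite fset3P !(eq_sym w) (negbTE xw) (negbTE yw) eq_sym (negbTE ww').
have both : u \in e -> ([fset x; y; w] = [fset u; a; v])%fset /\
    ([fset x; y; w'] = [fset u; b; v])%fset \/
    ([fset x; y; w] = [fset u; b; v])%fset /\
    ([fset x; y; w'] = [fset u; a; v])%fset.
  rewrite eE => ue.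
  have u1 : u \in [fset x; y; w]%fset by rewrite in_fsetU ue.
  have u2 : u \in [fset x; y; w']%fset by rewrite in_fsetU ue.
  case: (only t1 u1) (only t2 u2) => e1 [] e2; rewrite ?e1 ?e2.
  - by case: T12; rewrite e1 e2.
  - by left.
  - by right.
  - by case: T12; rewrite e1 e2.
have [ua uv av] := n1; have [ub _ bv] := n2.
have sube : (e `<=` [fset x; y; w])%fset /\ (e `<=` [fset x; y; w'])%fset.
  by rewrite eE; split; apply: fsubsetUl.
have bad z z' : z \in e -> z \notin [fset u; z'; v]%fset ->
    ([fset x; y; w] = [fset u; z'; v])%fset \/ ([fset x; y; w'] = [fset u; z'; v])%fset ->
    False.
  by move=> ze /negP zn [] h; apply: zn; rewrite -h; [apply: (fsubsetP sube.1)|apply: (fsubsetP sube.2)].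
have na : a \notin [fset u; b; v]%fset by rewrite fset3P !negb_or eq_sym ua ab av.
have nb : b \notin [fset u; a; v]%fset by rewrite fset3P !negb_or eq_sym ub eq_sym ab bv.
case: sub => sub; case: (fset2_sub3 c2 sub) => ee; [by apply: Or31|by apply: Or32| |by apply: Or31|by apply: Or33| ].
  exfalso; have ue : u \in e by rewrite ee !inE eqxx.
  have ae : a \in e by rewrite ee !inE eqxx orbT.
  by apply: (bad a b ae na); case: (both ue) => -[? ?]; [right|left].
exfalso; have ue : u \in e by rewrite ee !inE eqxx.
have be : b \in e by rewrite ee !inE eqxx orbT.
by apply: (bad b a be nb); case: (both ue) => -[? ?]; [left|right].
Qed.

End InnerVertex.
End Kernel.

End Reduction.

Section InnerVertex.
Variables (R : realType) (D0 : {fset {fset lat}}) (c : lat -> R).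
Variables (I L0 L : {fset lat}) (D : {fset {fset lat}}).
Hypotheses (rt0 : regtri c L0 D0) (cf : config D0 c I L D).

(** A triangle along a core edge has degree at least 2, and [inner_edge] leaves only two candidates
    in it. *)
Lemma inner_degree u a b v e : [fset u; a; v]%fset \in D -> [fset u; b; v]%fset \in D ->
  a != b -> (forall T, T \in D -> u \in T ->
    T = [fset u; a; v]%fset \/ T = [fset u; b; v]%fset) ->
  e \in core D0 -> (e `<=` [fset u; a; v])%fset ->
  [/\ degree (core D0) [fset u; a; v]%fset = 2%N, [fset u; v]%fset \in core D0
    & [fset a; v]%fset \in core D0].
Proof.
move=> h1 h2 ab only he eT.
have [ua uv av] : [/\ u != a, u != v & a != v].
  exact: (unimodular_neq (rt_tri (cf_rt cf) h1)).
have [ub _ bv] : [/\ u != b, u != v & b != v].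
  exact: (unimodular_neq (rt_tri (cf_rt cf) h2)).
set T := [fset u; a; v]%fset in h1 eT *.
have hs : T \in star D0 e by rewrite starP (cf_sub cf h1).
have := core_leafless he hs.
set A := [fset f in core D0 | (f `<=` T)%fset]%fset.
have neq : [fset u; v]%fset != [fset a; v]%fset.
  apply/eqP => h; have : u \in [fset a; v]%fset by rewrite -h !inE eqxx.
  by rewrite !inE (negbTE ua) (negbTE uv).
have sub : (A `<=` [fset [fset u; v]; [fset a; v]])%fset.
  apply/fsubsetP => f; rewrite !inE => /andP[hf fT].
  have [->|->|fb] := inner_edge rt0 cf h1 h2 ab only hf (or_introl fT).
  - by rewrite eqxx.
  - by rewrite eqxx orbT.
  - move: fT; rewrite fb => /fsubsetP/(_ b); rewrite !inE eqxx => /(_ isT).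
    by rewrite -orbA eq_sym (negbTE ub) eq_sym (negbTE ab) (negbTE bv).
have c2 : #|` [fset [fset u; v]; [fset a; v]]%fset| = 2%N by rewrite cardfs2 neq.
rewrite /degree -/A => hA.
have eA : A = [fset [fset u; v]; [fset a; v]]%fset.
  by apply/eqP; rewrite eqEfcard sub c2.
split; first by rewrite eA.
- have : [fset u; v]%fset \in A by rewrite eA !inE eqxx.
  by rewrite !inE => /andP[].
- have : [fset a; v]%fset \in A by rewrite eA !inE eqxx orbT.
  by rewrite !inE => /andP[].
Qed.

Lemma class_has_core (C : skel_edge D0) e : class_has C e -> e \in core D0.
Proof. by move=> /existsP[f /andP[_ /eqP <-]]; apply: valP. Qed.

Lemma inner_class u a b v (C : skel_edge D0) :
  [fset u; a; v]%fset \in D -> [fset u; b; v]%fset \in D ->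
  a != b -> (forall T, T \in D -> u \in T ->
    T = [fset u; a; v]%fset \/ T = [fset u; b; v]%fset) ->
  class_has C [fset u; v]%fset = class_has C [fset a; v]%fset.
Proof.
move=> h1 h2 ab only.
have s1 : ([fset u; v] `<=` [fset u; a; v])%fset.
  by apply/fsubsetP => z; rewrite !inE => /orP[] ->; rewrite ?orbT.
have s2 : ([fset a; v] `<=` [fset u; a; v])%fset.
  by apply/fsubsetP => z; rewrite !inE => /orP[] ->; rewrite ?orbT.
have [h|h] := boolP ([fset u; v]%fset \in core D0).
  have [d2 _ h'] := inner_degree h1 h2 ab only h s1.
  exact: (class_has_merge _ h h' (cf_sub cf h1)).
rewrite (introF idP (fun x => negP h (class_has_core x))).
apply/esym/negbTE/negP => /class_has_core h'.
by have [_ h'' _] := inner_degree h1 h2 ab only h' s2; rewrite h'' in h.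
Qed.

Lemma coef_eq (A B k p q s : int) : s = k * p + (2 - k) * q ->
  s = A * p + B * q -> A + B = 2 -> (A - k) * (p - q) = 0.
Proof.
move=> -> h AB; have -> : A - k = A - k + (2 - (A + B)) by rewrite AB subrr addr0.
transitivity (A * p + B * q - (k * p + (2 - k) * q) - (A + B - 2) * p); first by ring.
by rewrite h AB; ring.
Qed.

(** The point [u] is an apex of the quadrilaterals around [[a, v]] and [[b, v]], with coefficient 1,
    and an end point of [[u, v]], where the relation between the four points gives the coefficient
    [- k]. No other core edge sees it. *)
Lemma inner_form u a b v (k : int) e :
  [fset u; a; v]%fset \in D -> [fset u; b; v]%fset \in D ->
  a != b -> (forall T, T \in D -> u \in T ->
    T = [fset u; a; v]%fset \/ T = [fset u; b; v]%fset) ->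
  px a + px b = k * px u + (2 - k) * px v ->
  py a + py b = k * py u + (2 - k) * py v -> e \in core D0 ->
  edge_form D0 (delta R u) e = (e == [fset a; v]%fset)%:R +
    (e == [fset b; v]%fset)%:R - k%:~R * (e == [fset u; v]%fset)%:R :> R.
Proof.
move=> h1 h2 ab only hx hy he.
have [ua uv av] : [/\ u != a, u != v & a != v].
  exact: (unimodular_neq (rt_tri (cf_rt cf) h1)).
have [ub _ bv] : [/\ u != b, u != v & b != v].
  exact: (unimodular_neq (rt_tri (cf_rt cf) h2)).
have [x [y [w [w' q]]]] := core_quad rt0 he.
have [xy [xw yw xw' yw'] ww'] := quad_neq q; have [eE _ a1 a2] := q.
have [t1 t2] := core_triangle cf he q.
rewrite (edge_formE _ q) /lam /delta.
have nuav : u \notin [fset a; v]%fset by rewrite !inE negb_or ua uv.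
have nubv : u \notin [fset b; v]%fset by rewrite !inE negb_or ub uv.
have iuv : u \in [fset u; v]%fset by rewrite !inE eqxx.
have sa1 : ([fset u; v] `<=` [fset u; a; v])%fset.
  by apply/fsubsetP => z; rewrite !inE => /orP[] ->; rewrite ?orbT.
have sb1 : ([fset u; v] `<=` [fset u; b; v])%fset.
  by apply/fsubsetP => z; rewrite !inE => /orP[] ->; rewrite ?orbT.
have sa2 : ([fset a; v] `<=` [fset u; a; v])%fset.
  by apply/fsubsetP => z; rewrite !inE => /orP[] ->; rewrite ?orbT.
have sb2 : ([fset b; v] `<=` [fset u; b; v])%fset.
  by apply/fsubsetP => z; rewrite !inE => /orP[] ->; rewrite ?orbT.
have apex z d : [fset u; z; v]%fset \in D -> (e `<=` [fset u; z; v])%fset ->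
    d \in [fset u; z; v]%fset -> d \notin e -> d = w \/ d = w'.
  move=> hD es dT de; have := quad_star q [fset u; z; v]%fset.
  rewrite (cf_sub cf hD) es => /esym/orP[] /eqP h; move: dT de; rewrite h eE !inE negb_or;
    rewrite -orbA => /or3P[] /eqP->; rewrite ?eqxx ?andbF //; by [left|right].
have [ue|ue] := boolP (u \in e).
  have e0 z : u \notin z -> (e == z) = false by move=> uz; apply: contraNF uz => /eqP <-.
  have ue' := ue; rewrite eE !inE in ue'.
  have eqe : e = [fset u; v]%fset.
    have uT : u \in [fset x; y; w]%fset by rewrite in_fsetU -eE ue.
    have sub : (e `<=` [fset u; a; v])%fset \/ (e `<=` [fset u; b; v])%fset.
      by case: (only _ t1 uT) => <-; [left|right]; rewrite eE fsubsetUl.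
    case: (inner_edge rt0 cf h1 h2 ab only he sub) => // h; move: ue; rewrite h => ue.
      by rewrite ue in nuav.
    by rewrite ue in nubv.
  have ae : a \notin e by rewrite eqe !inE negb_or eq_sym ua av.
  have be : b \notin e by rewrite eqe !inE negb_or eq_sym ub bv.
  have ha : a = w \/ a = w'.
    by apply: (apex a); rewrite // ?eqe // fset3P eqxx orbT.
  have hb : b = w \/ b = w'.
    by apply: (apex b); rewrite // ?eqe // fset3P eqxx orbT.
  have wu : w != u.
    apply/eqP => h; move: ue'; rewrite -h => /orP[] /eqP h'.
      by rewrite h' eqxx in xw.
    by rewrite h' eqxx in yw.
  have wu' : w' != u.
    apply/eqP => h; move: ue'; rewrite -h => /orP[] /eqP h'.
      by rewrite h' eqxx in xw'.
    by rewrite h' eqxx in yw'.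
  have [qx qy qs] := quad_relation a1 a2.
  have sx : px a + px b = px w + px w'.
    by case: ha hb ab => -> [] ->; rewrite ?eqxx // addrC.
  have sy : py a + py b = py w + py w'.
    by case: ha hb ab => -> [] ->; rewrite ?eqxx // addrC.
  have uvc (p : int) : p * (px u - px v) = 0 -> p * (py u - py v) = 0 -> p = 0.
    move=> p1 p2; apply/eqP; apply: contraNT uv => p0; apply/eqP; apply: lat_eq.
      by apply/eqP; rewrite -subr_eq0; move/eqP: p1; rewrite mulf_eq0 (negbTE p0).
    by apply/eqP; rewrite -subr_eq0; move/eqP: p2; rewrite mulf_eq0 (negbTE p0).
  rewrite (negbTE wu) (negbTE wu') (e0 _ nuav) (e0 _ nubv) eqe eqxx.
  case/orP: ue' => /eqP h.
    have yv : y = v.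
      have : y \in [fset u; v]%fset by rewrite -eqe eE !inE eqxx orbT.
      by rewrite !inE -h in xy * => /orP[/eqP h'|/eqP//]; rewrite h' eqxx in xy.
    rewrite -h yv eqxx eq_sym (negbTE uv).
    rewrite -h yv in qs; suff -> : area2 v w w' = k by rewrite /= !(mulr0, subr0).
    apply/eqP; rewrite -subr_eq0; apply/eqP; apply: uvc.
      by apply: coef_eq hx _ qs; rewrite sx qx -h yv.
    by apply: coef_eq hy _ qs; rewrite sy qy -h yv.
  have xv : x = v.
    have : x \in [fset u; v]%fset by rewrite -eqe eE !inE eqxx.
    by rewrite !inE -h in xy * => /orP[/eqP h'|/eqP//]; rewrite h' eqxx in xy.
  rewrite -h xv eqxx eq_sym (negbTE uv).
  rewrite -h xv in qs; suff -> : area2 v w' w = k by rewrite /= !(mulr0, subr0).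
  apply/eqP; rewrite -subr_eq0; apply/eqP; apply: uvc.
    by apply: coef_eq hx _ (etrans (addrC _ _) qs); rewrite sx qx -h xv addrC.
  by apply: coef_eq hy _ (etrans (addrC _ _) qs); rewrite sy qy -h xv addrC.
have [xu yu] : x != u /\ y != u.
  by move: ue; rewrite eE !inE negb_or !(eq_sym u) => /andP[].
rewrite (negbTE xu) (negbTE yu) !mulr0 !subr0.
rewrite (_ : e == [fset u; v]%fset = false); last first.
  by apply: contraNF ue => /eqP ->.
rewrite mulr0 subr0.
have neq : [fset a; v]%fset != [fset b; v]%fset.
  apply/eqP => h; have : a \in [fset b; v]%fset by rewrite -h !inE eqxx.
  by rewrite !inE (negbTE ab) (negbTE av).
have val1 z : [fset u; z; v]%fset \in D -> e = [fset z; v]%fset ->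
    ([fset z; v] `<=` [fset u; z; v])%fset -> (w == u)%:R + (w' == u)%:R = 1 :> R.
  move=> hD ez sub; have [h|h] : u = w \/ u = w'.
  - by apply: (apex z); rewrite // ?ez // fset3P eqxx.
  - by rewrite h eqxx eq_sym (negbTE ww') addr0.
  - by rewrite h eqxx (negbTE ww') add0r.
have [ea|nea] := eqVneq e [fset a; v]%fset.
  by rewrite (val1 a) // ea (negbTE neq) addr0.
have [eb|neb] := eqVneq e [fset b; v]%fset.
  by rewrite (val1 b) // add0r.
have out (z : lat) : (z == w) || (z == w') -> z != u.
  move=> hz; apply/eqP => zu; rewrite zu in hz.
  have sub : (e `<=` [fset u; a; v])%fset \/ (e `<=` [fset u; b; v])%fset.
    case/orP: hz => /eqP h.
      have uT : u \in [fset x; y; w]%fset by rewrite h fset3P eqxx !orbT.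
      by case: (only _ t1 uT) => <-; [left|right]; rewrite eE fsubsetUl.
    have uT : u \in [fset x; y; w']%fset by rewrite h fset3P eqxx !orbT.
    by case: (only _ t2 uT) => <-; [left|right]; rewrite eE fsubsetUl.
  case: (inner_edge rt0 cf h1 h2 ab only he sub) => h; move: nea neb ue; rewrite h ?eqxx //.
  by rewrite iuv.
by rewrite !(negbTE (out _ _)) ?eqxx ?orbT // addr0.
Qed.

(** Smoothing puts the three edges [[a, v]], [[u, v]], [[b, v]] into one class, where their
    coefficients add up to [1 + 1 - k]. *)
Lemma skel_vec_inner u a b v (k : int) (C : skel_edge D0) :
  [fset u; a; v]%fset \in D -> [fset u; b; v]%fset \in D ->
  a != b -> (forall T, T \in D -> u \in T ->
    T = [fset u; a; v]%fset \/ T = [fset u; b; v]%fset) ->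
  px a + px b = k * px u + (2 - k) * px v ->
  py a + py b = k * py u + (2 - k) * py v ->
  skel_vec D0 (delta R u) C = (2 - k)%:~R * (class_has C [fset u; v]%fset)%:R :> R.
Proof.
move=> h1 h2 ab only hx hy; rewrite ffunE.
under eq_bigr => e _ do rewrite (inner_form h1 h2 ab only hx hy (valP e)).
rewrite sumrB big_split /= -mulr_sumr !sum_class_has.
have only' T : T \in D -> u \in T ->
    T = [fset u; b; v]%fset \/ T = [fset u; a; v]%fset.
  by move=> TD uT; case: (only T TD uT); [right|left].
rewrite -(inner_class C h1 h2 ab only) -(inner_class C h2 h1 _ only') 1?eq_sym //.
by rewrite rmorphB /=; ring.
Qed.

End InnerVertex.

(** * Rows of boundary points *)

(* An affine coordinate system of the lattice; sub-configurations are normalized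
   by changing the frame instead of moving the polygon. *)
Definition frame (pt : int -> int -> lat) : Prop := exists z0 e1 e2 : lat,
  `|px e1 * py e2 - py e1 * px e2| = 1 /\
  forall x y, px (pt x y) = px z0 + x * px e1 + y * px e2 /\
              py (pt x y) = py z0 + x * py e1 + y * py e2.

Lemma frame_comp pt (a b s d e t : int) : frame pt -> `|a * e - b * d| = 1 ->
  frame (fun x y => pt (a * x + b * y + s) (d * x + e * y + t)).
Proof.
move=> [z0 [e1 [e2 [dt h]]]] dt'.
exists (pt s t), (mkpt (a * px e1 + d * px e2) (a * py e1 + d * py e2)),
  (mkpt (b * px e1 + e * px e2) (b * py e1 + e * py e2)).
split.
  rewrite !px_mkpt !py_mkpt.
  rewrite (_ : _ - _ = (a * e - b * d) * (px e1 * py e2 - py e1 * px e2)); last by ring.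
  by rewrite normrM dt dt'.
by move=> x y; rewrite !px_mkpt !py_mkpt; split;
   rewrite ?(proj1 (h _ _)) ?(proj2 (h _ _)); ring.
Qed.

Section Frame.
Variable pt : int -> int -> lat.
Hypothesis fr : frame pt.

Lemma frame_inv : exists X Y : lat -> int, forall z, pt (X z) (Y z) = z.
Proof.
have [z0 [e1 [e2 [dt h]]]] := fr.
set d := px e1 * py e2 - py e1 * px e2 in dt.
have d2 : d * d = 1 by move: (d) dt; clear; nia.
exists (fun z => d * ((px z - px z0) * py e2 - (py z - py z0) * px e2)).
exists (fun z => d * ((py z - py z0) * px e1 - (px z - px z0) * py e1)).
move=> z; apply: lat_eq; rewrite ?(proj1 (h _ _)) ?(proj2 (h _ _)).
  transitivity (px z0 + d * d * (px z - px z0)); first by rewrite /d; ring.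
  by rewrite d2; ring.
transitivity (py z0 + d * d * (py z - py z0)); first by rewrite /d; ring.
by rewrite d2; ring.
Qed.

Lemma frame_inj x y x' y' : pt x y = pt x' y' -> x = x' /\ y = y'.
Proof.
have [z0 [e1 [e2 [dt h]]]] := fr; move=> e.
have := congr1 (fun z : lat => px z) e; have := congr1 (fun z : lat => py z) e.
rewrite /= !(proj1 (h _ _)) !(proj2 (h _ _)) => hy hx.
set d := px e1 * py e2 - py e1 * px e2 in dt.
have d0 : d != 0 by rewrite -normr_eq0 dt.
split; apply: (mulIf d0); apply/eqP; rewrite -subr_eq0; apply/eqP.
  transitivity ((px z0 + x * px e1 + y * px e2 - (px z0 + x' * px e1 + y' * px e2)) * py e2
    - (py z0 + x * py e1 + y * py e2 - (py z0 + x' * py e1 + y' * py e2)) * px e2).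
    by rewrite /d; ring.
  by rewrite hx hy; ring.
transitivity ((py z0 + x * py e1 + y * py e2 - (py z0 + x' * py e1 + y' * py e2)) * px e1
  - (px z0 + x * px e1 + y * px e2 - (px z0 + x' * px e1 + y' * px e2)) * py e1).
  by rewrite /d; ring.
by rewrite hx hy; ring.
Qed.

Lemma frame_eq x y x' y' : (pt x y == pt x' y') = (x == x') && (y == y').
Proof.
by apply/eqP/andP => [/frame_inj[-> ->]//|[/eqP-> /eqP->]].
Qed.

Lemma frame_area : exists2 d : int, `|d| = 1 & forall xa ya xb yb xc yc,
  area2 (pt xa ya) (pt xb yb) (pt xc yc) =
  d * ((xb - xa) * (yc - ya) - (yb - ya) * (xc - xa)).
Proof.
have [z0 [e1 [e2 [dt h]]]] := fr; eexists; first exact: dt.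
by move=> *; rewrite area2E !(proj1 (h _ _)) !(proj2 (h _ _)); ring.
Qed.

Lemma frame_incone xu yu xa ya xb yb x y (p q : int) : 0 <= p -> 0 <= q ->
  x = xu + p * (xa - xu) + q * (xb - xu) ->
  y = yu + p * (ya - yu) + q * (yb - yu) ->
  incone (pt xu yu) (pt xa ya) (pt xb yb) (pt x y).
Proof.
have [z0 [e1 [e2 [dt h]]]] := fr.
move=> p0 q0 -> ->; exists p, q; split=> //;
 by rewrite !(proj1 (h _ _), proj2 (h _ _)); ring.
Qed.

Lemma frame_comb2 x0 y0 x1 y1 x y (m n : int) :
  (m + n) * x = m * x0 + n * x1 -> (m + n) * y = m * y0 + n * y1 ->
  (m + n) * px (pt x y) = m * px (pt x0 y0) + n * px (pt x1 y1) /\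
  (m + n) * py (pt x y) = m * py (pt x0 y0) + n * py (pt x1 y1).
Proof.
have [z0 [e1 [e2 [dt h]]]] := fr; move=> hx hy.
by split; rewrite !(proj1 (h _ _), proj2 (h _ _)) mulrDr mulrDr mulrA hx mulrA hy; ring.
Qed.

Lemma frame_comb3 x0 y0 x1 y1 x2 y2 x y (k m n : int) :
  (k + m + n) * x = k * x0 + m * x1 + n * x2 ->
  (k + m + n) * y = k * y0 + m * y1 + n * y2 ->
  (k + m + n) * px (pt x y) =
    k * px (pt x0 y0) + m * px (pt x1 y1) + n * px (pt x2 y2) /\
  (k + m + n) * py (pt x y) =
    k * py (pt x0 y0) + m * py (pt x1 y1) + n * py (pt x2 y2).
Proof.
have [z0 [e1 [e2 [dt h]]]] := fr; move=> hx hy.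
by split; rewrite !(proj1 (h _ _), proj2 (h _ _)) mulrDr mulrDr mulrA hx mulrA hy; ring.
Qed.

Variable R : realType.

Lemma frame_af (f : R * R * R) : exists A B C : R, forall x y,
  af f (pt x y) = A + B * x%:~R + C * y%:~R.
Proof.
have [z0 [e1 [e2 [dt h]]]] := fr.
exists (af f z0), (f.1.2 * (px e1)%:~R + f.2 * (py e1)%:~R),
  (f.1.2 * (px e2)%:~R + f.2 * (py e2)%:~R) => x y.
by rewrite /af !(proj1 (h _ _), proj2 (h _ _)) !(rmorphD, rmorphM) /=; ring.
Qed.

Lemma frame_affine (A B C : R) : exists f, forall x y,
  af f (pt x y) = A + B * x%:~R + C * y%:~R.
Proof.
have [z0 [e1 [e2 [dt h]]]] := fr.
set d := px e1 * py e2 - py e1 * px e2 in dt.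
have d2 : d * d = 1 by move: (d) dt; clear; nia.
pose b : R := d%:~R * (B * (py e2)%:~R - C * (py e1)%:~R).
pose g : R := d%:~R * (C * (px e1)%:~R - B * (px e2)%:~R).
have d2R : d%:~R * d%:~R = 1 :> R by rewrite -rmorphM d2.
exists (A - b * (px z0)%:~R - g * (py z0)%:~R, b, g) => x y.
rewrite /af !(proj1 (h _ _), proj2 (h _ _)) !(rmorphD, rmorphM) /=.
transitivity (A + B * (d%:~R * d%:~R) * x%:~R + C * (d%:~R * d%:~R) * y%:~R).
  by rewrite /b /g {2 4}/d !(rmorphB, rmorphM) /=; ring.
by rewrite d2R !mulr1.
Qed.

End Frame.

Lemma fset_min (T : choiceType) (R : realType) (S : {fset T}) (F : T -> R) :
  (exists z, z \in S) -> exists2 z, z \in S & forall y, y \in S -> F z <= F y.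
Proof.
move=> [z0 z0S]; have [i _ h] := Order.TotalTheory.arg_minP (fun i : S => F (val i))
  (isT : predT [` z0S]%fset).
by exists (val i); [apply: valP|move=> y yS; apply: (h [` yS]%fset)].
Qed.

Definition irange (s e : int) : seq int :=
  [seq s + i%:Z | i <- iota 0 (absz (Num.max 0 (e - s + 1)))].

Lemma mem_irange s e x : (x \in irange s e) = (s <= x <= e).
Proof.
apply/mapP/idP => [[i]|h]; first by rewrite mem_iota; lia.
exists `|x - s|%N; last by lia.
by rewrite mem_iota; lia.
Qed.

Lemma irange_uniq s e : uniq (irange s e).
Proof. by rewrite map_inj_uniq ?iota_uniq // => i j; lia. Qed.

Lemma size_irange s e : (size (irange s e))%:Z = Num.max 0 (e - s + 1).
Proof. by rewrite size_map size_iota; lia. Qed.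

Section BoundaryRow.
Variables (R : realType) (c : lat -> R) (L : {fset lat}) (D : {fset {fset lat}}).
Hypothesis rt : regtri c L D.
Variable pt : int -> int -> lat.
Hypothesis fr : frame pt.

Lemma triangle_of_mem (u v w : lat) T : T \in D -> u \in T -> v \in T -> w \in T ->
  u != v -> u != w -> v != w -> T = [fset u; v; w]%fset.
Proof.
move=> TD uT vT wT uv uw vw.
have [z e] := unimodular_third (rt_tri rt TD) uT vT uv.
by move: wT; rewrite e fset3P => /or3P[] /eqP h; rewrite ?h // in uw vw *; rewrite eqxx in uw vw.
Qed.

(** A lower face over the base edge is constructed: a lowest segment of the lifted row above the
    midpoint of the edge, then a plane through it, tilted about the row as far as the points above
    permit. Unimodularity forces the face to be the desired triangle. *)
Lemma base_triangle s : (forall x y, pt x y \in L -> -1 <= y) ->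
  pt s (-1) \in L -> pt (s + 1) (-1) \in L ->
  (exists x y, pt x y \in L /\ 0 <= y) ->
  exists x, [fset pt s (-1); pt (s + 1) (-1); pt x 0]%fset \in D.
Proof.
move=> hb sL sL' [x0 [y0 [z0L y00]]].
have [X [Y XY]] := frame_inv fr.
have XE x y : X (pt x y) = x by have /(frame_inj fr)[] := XY (pt x y).
have YE x y : Y (pt x y) = y by have /(frame_inj fr)[] := XY (pt x y).
(* Half-integral, so every point of the row lies strictly on one side of [m]; [M] is the height at
   [m] of the segment joining two lifted points. *)
pose m : R := s%:~R + 1 / 2.
pose M (p : lat * lat) : R := (c p.1 * ((X p.2)%:~R - m) + c p.2 * (m - (X p.1)%:~R))
  / ((X p.2)%:~R - (X p.1)%:~R).
pose Q (p : lat * lat) := [&& Y p.1 == -1, X p.1 <= s, Y p.2 == -1 & s + 1 <= X p.2].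
pose S := [fset p in (L `*` L) | Q p]%fset.
have [] := @fset_min _ _ S M.
  exists (pt s (-1), pt (s + 1) (-1)).
  by rewrite !inE /= sL sL' /Q /= !XE !YE !eqxx !lexx.
move=> [z1 z2]; rewrite !inE /= => /andP[/andP[z1L z2L]].
move=> /and4P[/= /eqP y1 x1 /eqP y2 x2] hmin.
pose a := X z1; pose b := X z2.
have z1E : z1 = pt a (-1) by rewrite -y1 XY.
have z2E : z2 = pt b (-1) by rewrite -y2 XY.
have am : a%:~R < m :> R.
  have : a%:~R <= s%:~R :> R by rewrite ler_int.
  by rewrite /m; lra.
have mb : m < b%:~R :> R.
  have : (s + 1)%:~R <= b%:~R :> R by rewrite ler_int.
  by rewrite rmorphD /= /m; lra.
(* By minimality, replacing the end point on the side of [x] does not lower the height at [m], so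
   the lifted point over [x] is not below the line. *)
have row x : pt x (-1) \in L ->
    c z1 * (b%:~R - x%:~R) + c z2 * (x%:~R - a%:~R) <= c (pt x (-1)) * (b%:~R - a%:~R).
  move=> xL; have [xs|xs] := leP x s.
    have xm : x%:~R < m :> R.
      have : x%:~R <= s%:~R :> R by rewrite ler_int.
      by rewrite /m; lra.
    have := hmin (pt x (-1), z2); rewrite !inE /= xL z2L /Q /= XE YE y2 xs x2 !eqxx.
    move=> /(_ isT); rewrite /M /= XE -/a -/b.
    rewrite ler_pdivrMr ?subr_gt0; last by lra.
    rewrite mulrAC ler_pdivlMr ?subr_gt0; last by lra.
    rewrite -subr_ge0 => h.
    rewrite -subr_ge0 -(pmulr_rge0 _ (_ : 0 < b%:~R - m)) ?subr_gt0 //.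
    by move: h; congr (0 <= _); ring.
  have xm : m < x%:~R :> R.
    have : (s + 1)%:~R <= x%:~R :> R by rewrite ler_int; move: xs; clear; lia.
    by rewrite rmorphD /= /m; lra.
  have := hmin (z1, pt x (-1)); rewrite !inE /= xL z1L /Q /= XE YE y1 x1 !eqxx.
  rewrite (_ : s + 1 <= x); last by move: xs; clear; lia.
  move=> /(_ isT); rewrite /M /= XE -/a -/b.
  rewrite ler_pdivrMr ?subr_gt0; last by lra.
  rewrite mulrAC ler_pdivlMr ?subr_gt0; last by lra.
  rewrite -subr_ge0 => h.
  rewrite -subr_ge0 -(pmulr_rge0 _ (_ : 0 < m - a%:~R)) ?subr_gt0 //.
  by move: h; congr (0 <= _); ring.
have ba : 0 < b%:~R - a%:~R :> R by lra.
pose r (x : int) : R := (c z1 * (b%:~R - x%:~R) + c z2 * (x%:~R - a%:~R)) / (b%:~R - a%:~R).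
have [] := @fset_min _ _ [fset z in L | 0 <= Y z]%fset
  (fun z => (c z - r (X z)) / ((Y z)%:~R + 1)).
  by exists (pt x0 y0); rewrite !inE /= z0L YE y00.
move=> z3; rewrite !inE /= => /andP[z3L y30] hmin3.
pose t := (c z3 - r (X z3)) / ((Y z3)%:~R + 1).
have pos z : 0 <= Y z -> 0 < (Y z)%:~R + 1 :> R.
  by move=> h; have : 0 <= (Y z)%:~R :> R; [rewrite ler0z|lra].
have [f fE] := frame_affine fr
  ((c z1 * b%:~R - c z2 * a%:~R) / (b%:~R - a%:~R) + t)
  ((c z2 - c z1) / (b%:~R - a%:~R)) t.
have ba0 : b%:~R - a%:~R != 0 :> R by rewrite gt_eqF.
have fE' x y : af f (pt x y) = r x + t * (y%:~R + 1).
  by rewrite fE /r; field.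
have sf : supports c L f.
  move=> z zL; rewrite -(XY z) fE' XY.
  have := hb (X z) (Y z); rewrite XY => /(_ zL) hy.
  have [y0z|y0z] := leP 0 (Y z).
    rewrite -lerBrDl -ler_pdivlMr ?pos //; apply: hmin3.
    by rewrite !inE /= zL y0z.
  have yz : Y z = -1 by move: hy y0z; clear; lia.
  rewrite yz rmorphN /= addNr mulr0 addr0 /r ler_pdivrMr //.
  by have := row (X z); rewrite -yz XY; apply.
have c1 : z1 \in contact c L f.
  apply/contactP; split=> //; rewrite {1}z1E fE' rmorphN /= addNr mulr0 addr0 /r subrr mulr0 addr0.
  by rewrite mulfK.
have c2 : z2 \in contact c L f.
  apply/contactP; split=> //; rewrite {1}z2E fE' rmorphN /= addNr mulr0 addr0 /r subrr mulr0 add0r.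
  by rewrite mulfK.
have c3 : z3 \in contact c L f.
  apply/contactP; split=> //; rewrite -{1}(XY z3) fE' /t divfK; first by rewrite addrC subrK.
  by rewrite gt_eqF ?pos.
have [d d1 dE] := frame_area fr.
have ab : a < b by rewrite -(ltr_int R) -subr_gt0.
have ar : `|area2 z1 z2 z3| = (b - a) * (Y z3 + 1).
  rewrite z1E z2E -(XY z3) dE normrM d1 mul1r (XY z3) [X in `|X|](_ : _ = (b - a) * (Y z3 + 1)); last by ring.
  by rewrite ger0_norm // mulr_ge0 //; move: ab y30; clear; lia.
have ar0 : area2 z1 z2 z3 != 0.
  by rewrite -normr_eq0 ar mulf_neq0 //; move: ab y30; clear; lia.
have TD : contact c L f \in D.
  by apply: (rt_max rt sf); exists z1, z2, z3.
have [n12 n13 n23] := area2_neq ar0.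
have eT := triangle_of_mem TD c1 c2 c3 n12 n13 n23.
(* The area 1 is a product of the positive integers [b - a] and [Y z3 + 1]. *)
rewrite eT in TD; have := unimodular_area (rt_tri rt TD); rewrite ar => h1.
have ba1 : b = a + 1 by case: (mulz_eq1 h1); move: ab; clear; lia.
have y3 : Y z3 = 0.
  by rewrite mulrC in h1; case: (mulz_eq1 h1); move: y30; clear; lia.
have as_ : a = s by move: x1 x2 ba1; rewrite -/a -/b; clear; lia.
exists (X z3); move: TD; rewrite z1E z2E -{1}(XY z3) y3 ba1 as_.
by [].
Qed.

(** Comparing the supporting functions on the row -1 gives slopes [B <= B'], and on the row 0 gives
    [0 <= (B' - B) * (b - a)]. Equal slopes would make the functions agree on the row -1 and put
    [pt (j + 1) (-1)] into the first triangle. *)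
Lemma apex_monotone i j a b : i < j ->
  [fset pt i (-1); pt (i + 1) (-1); pt a 0]%fset \in D ->
  [fset pt j (-1); pt (j + 1) (-1); pt b 0]%fset \in D -> a <= b.
Proof.
move=> ij h1 h2.
have [f s e] := rt_supp rt h1; have [f' s' e'] := rt_supp rt h2.
have hc g S y : contact c L g = S -> y \in S -> y \in L /\ af g y = c y.
  by move=> <- /contactP.
have [L1 f1] := hc _ _ (pt i (-1)) e ltac:(by rewrite fset3P eqxx).
have [L2 f2] := hc _ _ (pt (i + 1) (-1)) e ltac:(by rewrite fset3P eqxx orbT).
have [L3 f3] := hc _ _ (pt a 0) e ltac:(by rewrite fset3P eqxx !orbT).
have [M1 g1] := hc _ _ (pt j (-1)) e' ltac:(by rewrite fset3P eqxx).
have [M2 g2] := hc _ _ (pt (j + 1) (-1)) e' ltac:(by rewrite fset3P eqxx orbT).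
have [M3 g3] := hc _ _ (pt b 0) e' ltac:(by rewrite fset3P eqxx !orbT).
have [A [B [C fE]]] := frame_af fr f; have [A' [B' [C' fE']]] := frame_af fr f'.
have u1 := s' _ L1; have u2 := s' _ L3; have u3 := s _ M1; have u4 := s _ M3.
have u5 := s _ M2.
rewrite -f1 in u1; rewrite -f3 in u2; rewrite -g1 in u3; rewrite -g3 in u4.
rewrite !fE !fE' !(rmorphN, rmorphD) /= in u1 u2 u3 u4.
have ijR : i%:~R < j%:~R :> R by rewrite ltr_int.
have BB : B <= B'.
  by rewrite -subr_ge0 -(pmulr_lge0 _ (_ : 0 < j%:~R - i%:~R)) ?subr_gt0 //; lra.
move: BB; rewrite le_eqVlt => /orP[/eqP BB|BB]; last first.
  rewrite -(ler_int R) -subr_ge0 -(pmulr_rge0 _ (_ : 0 < B' - B)) ?subr_gt0 //; lra.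
have : pt (j + 1) (-1) \in contact c L f.
  apply/contactP; split=> //; rewrite -g2 !fE !fE' -BB !rmorphN /=.
  by move: u1 u3; rewrite -BB; lra.
rewrite e fset3P !(frame_eq fr) => /or3P[] /andP[/eqP h /eqP h'] //; move: h ij; clear; lia.
Qed.

(** The cones of the two triangles cover [L], so by [cone_mem] the only other possible triangle at
    [u] is [[u, a, b]]. It is excluded by its area or by [v] lying in its cone. *)
Lemma two_triangles u a b v T : [fset u; a; v]%fset \in D -> [fset u; b; v]%fset \in D ->
  a != b -> (forall z, z \in L -> incone u a v z \/ incone u b v z) ->
  `|area2 u a b| != 1 \/ incone u a b v -> T \in D -> u \in T ->
  T = [fset u; a; v]%fset \/ T = [fset u; b; v]%fset.
Proof.
move=> h1 h2 ab hL hab TD uT.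
have [ua uv av] := unimodular_neq (rt_tri rt h1).
have [ub _ bv] := unimodular_neq (rt_tri rt h2).
have inT z : z \in T -> z \in [fset u; a; v]%fset \/ z \in [fset u; b; v]%fset.
  move=> zT; have zL := fsubsetP (rt_sub rt TD) _ zT.
  by case: (hL _ zL) => h; [left; apply: (cone_mem rt h1 TD)|right; apply: (cone_mem rt h2 TD)].
have [aT|aT] := boolP (a \in T); last first.
  right; apply: (triangle_eq rt h2 TD); apply/fsubsetP => z zT.
  case: (inT _ zT) => //; rewrite !fset3P => /or3P[] /eqP h; rewrite h ?eqxx ?orbT //.
  by rewrite -h zT in aT.
have [bT|bT] := boolP (b \in T); last first.
  left; apply: (triangle_eq rt h1 TD); apply/fsubsetP => z zT.
  case: (inT _ zT) => //; rewrite !fset3P => /or3P[] /eqP h; rewrite h ?eqxx ?orbT //.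
  by rewrite -h zT in bT.
have eT := triangle_of_mem TD uT aT bT ua ub ab; rewrite eT in TD.
case: hab => [h|h]; first by rewrite (unimodular_area (rt_tri rt TD)) in h.
have : v \in [fset u; a; b]%fset.
  by apply: (cone_mem rt TD h1) => //; rewrite fset3P eqxx ?orbT.
by rewrite fset3P !(eq_sym v) (negbTE uv) (negbTE av) (negbTE bv).
Qed.

End BoundaryRow.

Section ConfigFrame.
Variables (R : realType) (D0 : {fset {fset lat}}) (c : lat -> R).
Variables (I L0 L : {fset lat}) (D : {fset {fset lat}}).
Hypotheses (rt0 : regtri c L0 D0) (cf : config D0 c I L D) (ne : no_ears I L D).

Lemma config_conv pt x0 y0 x1 y1 x y (m n : int) : frame pt ->
  pt x0 y0 \in L -> pt x1 y1 \in L -> 0 < m -> 0 < n ->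
  (m + n) * x = m * x0 + n * x1 -> (m + n) * y = m * y0 + n * y1 -> pt x y \in L.
Proof.
move=> fr h0 h1 m0 n0 hx hy; have [ex ey] := frame_comb2 fr hx hy.
exact: (cf_conv cf h0 h1 m0 n0 ex ey).
Qed.

Lemma config_mix pt x0 y0 x1 y1 x2 y2 x y (k m n : int) : frame pt ->
  pt x0 y0 \in I -> pt x1 y1 \in L -> pt x2 y2 \in L -> 0 < k -> 0 <= m -> 0 <= n ->
  (k + m + n) * x = k * x0 + m * x1 + n * x2 ->
  (k + m + n) * y = k * y0 + m * y1 + n * y2 -> pt x y \in I.
Proof.
move=> fr h0 h1 h2 k0 m0 n0 hx hy; have [ex ey] := frame_comb3 fr hx hy.
exact: (cf_mix cf h0 h1 h2 k0 m0 n0 ex ey).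
Qed.

(* A side of the polygon in the row [y = -1], next to the row [y = 0] of interior
   lattice points. *)
Record boundary_row (pt : int -> int -> lat) (l r s e : int) : Prop := {
  br_frame : frame pt;
  br_low : forall x y, pt x y \in L -> -1 <= y;
  br_lr : l <= r;
  br_int : forall x, pt x 0 \in I <-> l <= x <= r;
  br_row0 : forall x, pt x 0 \in L -> l - 1 <= x <= r + 1;
  br_nint : forall x, pt x (-1) \notin I;
  br_se : s <= e;
  br_row : forall x, pt x (-1) \in L <-> s <= x <= e }.

Lemma boundary_row_flip pt l r s e : boundary_row pt l r s e ->
  boundary_row (fun x y => pt (- x) y) (- r) (- l) (- e) (- s).
Proof.
move=> [fr h1 h2 h3 h4 h5 h6 h7]; split.
- have [z0 [e1 [e2 [dt h]]]] := frame_comp 0 0 fr (ltac:(by []) : `|(-1) * 1 - 0 * 0| = 1 :> int).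
  exists z0, e1, e2; split=> // x y.
  by have := h x y; rewrite !mul0r mul1r mulN1r !addr0 add0r.
- by move=> x y /h1.
- by move: h2; clear; lia.
- by move=> x; rewrite h3; clear; lia.
- by move=> x /h4; clear; lia.
- by move=> x.
- by move: h6; clear; lia.
- by move=> x; rewrite h7; clear; lia.
Qed.

(* An apex of the first base edge to the left of [l] would be on the boundary,
   making the corner [pt s (-1)] an ear. *)
Lemma first_apex pt l r s e a : boundary_row pt l r s e ->
  [fset pt s (-1); pt (s + 1)%R (-1); pt a 0]%fset \in D -> l <= a.
Proof.
move=> br hT; have fr := br_frame br.
have sub := fsubsetP (rt_sub (cf_rt cf) hT).
have aL : pt a 0 \in L by apply: sub; rewrite fset3P eqxx !orbT.
have sL : pt s (-1) \in L by apply: sub; rewrite fset3P eqxx.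
have ha := br_row0 br aL; rewrite leNgt; apply/negP => al.
have ea : a = l - 1 by move: ha al; clear; lia.
apply: (ne sL (br_nint br s) hT) => z zL.
have [X [Y XY]] := frame_inv fr; rewrite -(XY z) in zL *.
move: (X z) (Y z) zL => x y zL {z X Y XY}.
have y1 := br_low br zL.
have key : 0 <= x - s - (y + 1) * (a - s).
  rewrite leNgt; apply/negP => d0.
  have y0 : 0 <= y.
    rewrite leNgt; apply/negP => y0.
    have ey : y = -1 by move: y1 y0; clear; lia.
    rewrite ey in zL d0; move/(br_row br): zL; move: d0; clear; lia.
  (* This measures how far [pt x y] lies beyond the line through [pt s (-1)] and [pt a 0]. With
     weights [k], [y] and 1, the boundary point [pt (l - 1) 0] becomes a mean of [pt l 0],
     [pt s (-1)] and [pt x y], hence interior. *)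
  pose k := - (x - s - (y + 1) * (a - s)).
  have : pt (l - 1) 0 \in I.
    apply: (@config_mix pt l 0 s (-1) x y (l - 1) 0 k y 1) => //.
    - by apply/(br_int br); rewrite lexx (br_lr br).
    - by rewrite oppr_gt0.
    - by rewrite /k ea; ring.
    - by ring.
  by move=> /(br_int br); clear; lia.
apply: (frame_incone fr (p := x - s - (y + 1) * (a - s)) (q := y + 1)) => //.
- by move: y1; clear; lia.
- by ring.
- by ring.
Qed.

Section Line.
Variables (pt : int -> int -> lat) (l r s e : int).
Hypothesis br : boundary_row pt l r s e.
Let fr := br_frame br.

Lemma last_apex a :
  [fset pt (e - 1) (-1); pt e (-1); pt a 0]%fset \in D -> a <= r.
Proof.
move=> h; have := first_apex (a := - a) (boundary_row_flip br).
rewrite opprK fset3_swap (_ : - (- e + 1) = e - 1); last by ring.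
by rewrite opprK => /(_ h); clear; lia.
Qed.

Lemma row_apexes : exists al : int -> int, forall x, s <= x -> x < e ->
  [/\ [fset pt x (-1); pt (x + 1) (-1); pt (al x) 0]%fset \in D, l <= al x & al x <= r].
Proof.
have ex x : exists a, s <= x -> x < e ->
    [fset pt x (-1); pt (x + 1) (-1); pt a 0]%fset \in D.
  have [h|h] := boolP ((s <= x) && (x < e)); last first.
    by exists 0 => h1 h2; rewrite h1 h2 in h.
  have [|||a ha] := base_triangle (cf_rt cf) fr (s := x) (br_low br).
  - by apply/(br_row br); move: h; clear; lia.
  - by apply/(br_row br); move: h; clear; lia.
  - exists l, 0; split=> //; apply: (cf_int cf); apply/(br_int br).
    by rewrite lexx (br_lr br).
  by exists a.
have [al hal] := choice ex; exists al => x sx xe; split; first exact: hal.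
- have [es|ns] := eqVneq x s.
    by apply: (first_apex br); rewrite -es; apply: hal.
  have hs := hal s (lexx _) (le_lt_trans sx xe).
  apply: le_trans (first_apex br hs) _.
  apply: (apex_monotone (cf_rt cf) fr _ hs (hal x sx xe)).
  by move: sx ns; clear; lia.
- have he : [fset pt (e - 1) (-1); pt e (-1); pt (al (e - 1)) 0]%fset \in D.
    have := hal (e - 1); rewrite subrK; apply; move: sx xe; clear; lia.
  have [en|nn] := eqVneq x (e - 1); first by apply: last_apex; rewrite en.
  apply: le_trans (last_apex he).
  rewrite -{2}(subrK 1 e) in he.
  apply: (apex_monotone (cf_rt cf) fr _ (hal x sx xe) he).
  by move: xe nn; clear; lia.
Qed.

(** The point is the midpoint of its neighbours in the row, so [skel_vec_inner] applies with [k = 2]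
    and the factor [2 - k] vanishes. *)
Lemma row_inner_zero x a : s < x -> x < e ->
  [fset pt (x - 1) (-1); pt x (-1); pt a 0]%fset \in D ->
  [fset pt x (-1); pt (x + 1) (-1); pt a 0]%fset \in D ->
  skel_vec D0 (delta R (pt x (-1))) = 0.
Proof.
move=> sx xe h1 h2; apply/ffunP => C.
rewrite fset3_swap in h1.
have ab : pt (x - 1) (-1) != pt (x + 1) (-1).
  by rewrite (frame_eq fr) negb_and; apply/orP; left; clear; lia.
have [d _ dE] := frame_area fr.
have only T : T \in D -> pt x (-1) \in T ->
    T = [fset pt x (-1); pt (x - 1) (-1); pt a 0]%fset \/
    T = [fset pt x (-1); pt (x + 1) (-1); pt a 0]%fset.
  apply: (two_triangles (cf_rt cf) h1 h2 ab) => [z zL|]; last first.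
    by left; rewrite dE subrr mul0r mulr0 subrr mulr0 normr0.
  have [X [Y XY]] := frame_inv fr; rewrite -(XY z) in zL *.
  move: (X z) (Y z) zL => zx zy zL {z X Y XY}; have y1 := br_low br zL.
  have [h|h] := leP (zx - x - (zy + 1) * (a - x)) 0.
    left; apply: (frame_incone fr (p := - (zx - x - (zy + 1) * (a - x))) (q := zy + 1)).
    - by rewrite oppr_ge0.
    - by move: y1; clear; lia.
    - by ring.
    - by ring.
  right; apply: (frame_incone fr (p := zx - x - (zy + 1) * (a - x)) (q := zy + 1)).
  - exact: ltW.
  - by move: y1; clear; lia.
  - by ring.
  - by ring.
have hc (m n y : int) : px (pt (x - 1) (-1)) + px (pt (x + 1) (-1)) =
    2 * px (pt x (-1)) + (2 - 2) * px (pt a 0) /\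
    py (pt (x - 1) (-1)) + py (pt (x + 1) (-1)) =
    2 * py (pt x (-1)) + (2 - 2) * py (pt a 0).
  have [||hx hy] := @frame_comb2 _ fr (x - 1) (-1) (x + 1) (-1) x (-1) 1 1; try by ring.
  by rewrite !subrr !mul0r !addr0; move: hx hy; rewrite !mul1r => -> ->.
have [hx hy] := hc 0 0 0.
by rewrite (skel_vec_inner rt0 cf C h1 h2 ab only hx hy) subrr mul0r ffunE.
Qed.

Definition kept x : bool :=
  [|| x == s, x == e | skel_vec D0 (delta R (pt x (-1))) != 0].

(* The apex of the base edge following a kept point strictly exceeds that of the
   preceding edge: with equal apexes, the indicator of the point contributes
   nothing. *)
Lemma row_count : ((size [seq x <- irange s e | kept x])%:Z <= r - l + 2) /\
  ((size [seq x <- irange s e | kept x])%:Z <= r - l + 1 \/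
   s < e /\ [fset pt (e - 1) (-1); pt e (-1); pt r 0]%fset \in D).
Proof.
have lr := br_lr br; have se := br_se br.
have [al hal] := row_apexes.
(* No base edge follows the last point; the value [r + 1] keeps [h] strictly increasing on the kept
   points, with values from [l] to [r + 1]. *)
pose h x := if x == e then r + 1 else al x.
have mono x y : s <= x -> x < y -> y <= e -> kept y -> h x < h y.
  move=> sx xy ye ky; rewrite /h (lt_eqF (lt_le_trans xy ye)).
  have [hx hx1 hx2] := hal x sx (lt_le_trans xy ye).
  have [_|yne] := eqVneq y e; first by move: hx2; clear; lia.
  have ye' : y < e by move: ye yne; clear; lia.
  have sy : s <= y by move: sx xy; clear; lia.
  have [hy hy1 hy2] := hal y sy ye'.
  have [hz hz1 hz2] : [/\ [fset pt (y - 1) (-1); pt y (-1); pt (al (y - 1)) 0]%fset \in D,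
      l <= al (y - 1) & al (y - 1) <= r].
    have := hal (y - 1); rewrite subrK; apply.
      by move: sx xy; clear; lia.
    by move: ye; clear; lia.
  have xz : al x <= al (y - 1).
    have [->//|xn] := eqVneq x (y - 1).
    rewrite -{2}(subrK 1 y) in hz; apply: (apex_monotone (cf_rt cf) fr _ hx hz).
    by move: xy xn; clear; lia.
  have zy : al (y - 1) <= al y.
    rewrite -{2}(subrK 1 y) in hz; apply: (apex_monotone (cf_rt cf) fr _ hz hy).
    by clear; lia.
  suff : al (y - 1) != al y by move: xz zy; clear; lia.
  apply/eqP => eq; move: ky; rewrite /kept (negbTE yne).
  have -> : (y == s) = false by move: sx xy; clear; lia.
  rewrite (@row_inner_zero y (al y)) ?eqxx //.
    by move: sx xy; clear; lia.
  by rewrite -eq.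
have inj : {in [seq x <- irange s e | kept x] &, injective h}.
  move=> x y; rewrite !mem_filter !mem_irange => /andP[kx /andP[x1 x2]] /andP[ky /andP[y1 y2]] hh.
  case: (ltgtP x y) => // xy.
    by have := mono x y x1 xy y2 ky; rewrite hh ltxx.
  by have := mono y x y1 xy x2 kx; rewrite hh ltxx.
have un : uniq [seq h x | x <- [seq x <- irange s e | kept x]].
  by rewrite map_inj_in_uniq // filter_uniq // irange_uniq.
have hr x : x \in [seq x <- irange s e | kept x] -> x != e -> l <= al x <= r.
  rewrite mem_filter mem_irange => /andP[_ /andP[x1 x2]] xe.
  have [_ -> ->] := hal x x1 ltac:(by move: x2 xe; clear; lia).
  by [].
split.
  have : (size [seq x <- irange s e | kept x] <= size (irange l (r + 1)))%N.
    rewrite -(size_map h); apply: uniq_leq_size un _ => y /mapP[x hx ->].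
    rewrite mem_irange /h; case: eqVneq => [_|/(hr x hx)]; move: lr; clear; lia.
  by have := size_irange l (r + 1); move: lr; clear; lia.
have [ee|ne'] := eqVneq s e.
  left; rewrite -ee; have : (size [seq x <- irange s s | kept x] <= 1)%N.
    rewrite size_filter; apply: leq_trans (count_size _ _) _.
    by rewrite -lez_nat size_irange subrr.
  by move: lr; clear; lia.
have se' : s < e by move: se ne'; clear; lia.
have [hz hz1 hz2] : [/\ [fset pt (e - 1) (-1); pt e (-1); pt (al (e - 1)) 0]%fset \in D,
    l <= al (e - 1) & al (e - 1) <= r].
  have := hal (e - 1); rewrite subrK; apply; first by move: se'; clear; lia.
  by clear; lia.
have [er|nr] := eqVneq (al (e - 1)) r; first by right; rewrite -er.
(* The last apex is less than [r], so by monotonicity [h] misses the value [r]. *)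
left; have : (size [seq x <- irange s e | kept x] <= (size (irange l (r - 1)%R)).+1)%N.
  rewrite -(size_map h) -(size_rcons _ (r + 1)%R).
  apply: uniq_leq_size un _ => y /mapP[x hx ->].
  rewrite mem_rcons in_cons mem_irange /h; have [xe|xe] := eqVneq x e; first by rewrite eqxx.
  have := hr x hx xe; suff : al x <= al (e - 1) by move: hz2 nr; clear; lia.
  move: hx; rewrite mem_filter mem_irange => /andP[_ /andP[x1 x2]].
  have [->//|xn] := eqVneq x (e - 1).
  have xe' : x < e by move: x2 xe; clear; lia.
  have [hx _ _] := hal x x1 xe'.
  rewrite -{2}(subrK 1 e) in hz; apply: (apex_monotone (cf_rt cf) fr _ hx hz).
  by move: xe' xn; clear; lia.
by have := size_irange l (r - 1); move: hz1 hz2 nr; clear; lia.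
Qed.

End Line.
End ConfigFrame.

(** * Corners cut off by a short edge between a horizontal and a vertical side *)

Section Corner.
Variables (R : realType) (D0 : {fset {fset lat}}) (c : lat -> R).
Variables (I L0 L : {fset lat}) (D : {fset {fset lat}}).
Hypotheses (rt0 : regtri c L0 D0) (cf : config D0 c I L D) (ne : no_ears I L D).
Variables (pt : int -> int -> lat) (a : int).
Hypotheses (fr : frame pt) (a1 : 1 <= a).
Hypothesis low : forall x y, pt x y \in L -> -1 <= y.
Hypothesis right : forall x y, pt x y \in L -> x <= 0.
Hypothesis cut : forall x, pt x (-1) \in L -> x <= - a.
Hypotheses (bI : pt (- a) (-1) \notin I) (rI : pt 0 0 \notin I).
Hypotheses (vI : pt (-1) 0 \in I).

(** The short edge from [b = pt (- a) (-1)] to [r = pt 0 0] spans the line [x = a y]. *)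
Let slanted x y : pt x y \in L -> x <= a * y.
Proof.
move=> zL; have y1 := low zL; have x0 := right zL.
have [y0|y0] := leP 0 y; first by apply: le_trans x0 _; rewrite mulr_ge0 //; move: a1; clear; lia.
have ey : y = -1 by move: y1 y0; clear; lia.
by rewrite ey in zL *; have := cut zL; clear; lia.
Qed.

(* Neither [b] nor [r] is the tip of an ear, which leaves a single candidate for
   the third vertex of the triangle on the short boundary edge [b, r]. *)
Lemma corner_triangle : pt (- a) (-1) \in L -> pt 0 0 \in L ->
  [fset pt (- a) (-1); pt 0 0; pt (-1) 0]%fset \in D.
Proof.
move=> bL rL.
(* In this frame the line of the short edge is the row -1, and [[b, r]] is its base edge from -1 to
   0. *)
pose pt' := fun x y => pt (a * x + (-1) * y + -1) (1 * x + 0 * y + 0).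
have fr' : frame pt'.
  by apply: frame_comp fr _; rewrite mulr0 mulN1r sub0r opprK.
have E x y : pt' x y = pt (a * x - y - 1) x.
  by rewrite /pt'; congr pt; ring.
have [||||x hT] := base_triangle (cf_rt cf) fr' (s := -1).
- by move=> x y; rewrite E => /slanted; clear; lia.
- by rewrite E (_ : a * -1 - -1 - 1 = - a) //; ring.
- by rewrite E (_ : a * (-1 + 1) - -1 - 1 = 0) //; ring.
- by exists 0, 0; rewrite E; split=> //; apply: (cf_int cf); rewrite mulr0 subr0 sub0r.
move: hT; rewrite !E (_ : a * -1 - -1 - 1 = - a); last by ring.
rewrite (_ : a * (-1 + 1) - -1 - 1 = 0); last by ring.
rewrite (_ : -1 + 1 = 0 :> int) // subr0 => hT.
have zL : pt (a * x - 1) x \in L.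
  by apply: (fsubsetP (rt_sub (cf_rt cf) hT)); rewrite fset3P eqxx !orbT.
have x1 := low zL; have x2 := right zL.
(* The apex lies on the parallel line through [pt (-1) 0]. The value -1 makes [b] the tip of an ear,
   the value 1 does so for [r]. *)
have : x = 0 \/ (x = -1 \/ x = 1 /\ a = 1) by move: x1 x2 a1; clear; nia.
case=> [ex|[ex|[ex ea]]].
- by move: hT; rewrite ex mulr0 sub0r.
- exfalso.
  have hT' : [fset pt (- a) (-1); pt (a * x - 1) x; pt 0 0]%fset \in D.
    by rewrite fset3_swap fset3_rot.
  apply: (ne bL bI hT') => z zL'.
  have [X [Y XY]] := frame_inv fr; rewrite -(XY z) in zL' *.
  move: (X z) (Y z) zL' => zx zy zL' {z X Y XY}.
  apply: (frame_incone fr (p := a * zy - zx) (q := zy + 1)).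
  + by rewrite subr_ge0; apply: slanted.
  + by have := low zL'; clear; lia.
  + by rewrite ex; ring.
  + by rewrite ex; ring.
- exfalso.
  have hT' : [fset pt 0 0; pt (- a) (-1); pt (a * x - 1) x]%fset \in D.
    by rewrite fset3_swap.
  apply: (ne rL rI hT') => z zL'.
  have [X [Y XY]] := frame_inv fr; rewrite -(XY z) in zL' *.
  move: (X z) (Y z) zL' => zx zy zL' {z X Y XY}.
  apply: (frame_incone fr (p := - zx) (q := zy - zx)).
  + by have := right zL'; clear; lia.
  + by have := slanted zL'; rewrite ea; clear; lia.
  + by rewrite ex ea; ring.
  + by rewrite ex; ring.
Qed.

(* Both vectors are multiples of the indicator of the chain of edges around the
   interior point [pt (-1) 0], which smoothing merges into one. *)
Lemma corner_relation : [fset pt (- a - 1) (-1); pt (- a) (-1); pt (-1) 0]%fset \in D ->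
  [fset pt 0 1; pt 0 0; pt (-1) 0]%fset \in D ->
  skel_vec D0 (delta R (pt 0 0)) = a%:~R *: skel_vec D0 (delta R (pt (- a) (-1))).
Proof.
move=> hb hr.
have sub T : T \in D -> forall z, z \in T -> z \in L.
  by move=> TD; apply/fsubsetP/(rt_sub (cf_rt cf) TD).
have bL : pt (- a) (-1) \in L by apply: (sub _ hb); rewrite fset3P eqxx orbT.
have rL : pt 0 0 \in L by apply: (sub _ hr); rewrite fset3P eqxx orbT.
have hbr := corner_triangle bL rL.
have hb' : [fset pt (- a) (-1); pt (- a - 1) (-1); pt (-1) 0]%fset \in D.
  by rewrite fset3_swap.
have hr' : [fset pt 0 0; pt 0 1; pt (-1) 0]%fset \in D by rewrite fset3_swap.
have hrb : [fset pt 0 0; pt (- a) (-1); pt (-1) 0]%fset \in D by rewrite fset3_swap.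
have n1 : pt (- a - 1) (-1) != pt 0 0 by rewrite (frame_eq fr) andbF.
have n2 : pt (- a) (-1) != pt 0 1 by rewrite (frame_eq fr) andbF.
have [d d1 dE] := frame_area fr.
have onlyb T : T \in D -> pt (- a) (-1) \in T ->
    T = [fset pt (- a) (-1); pt (- a - 1) (-1); pt (-1) 0]%fset \/
    T = [fset pt (- a) (-1); pt 0 0; pt (-1) 0]%fset.
  apply: (two_triangles (cf_rt cf) hb' hbr n1) => [z zL|]; last first.
    right; apply: (frame_incone fr (p := 1) (q := 1)) => //; by ring.
  have [X [Y XY]] := frame_inv fr; rewrite -(XY z) in zL *.
  move: (X z) (Y z) zL => zx zy zL {z X Y XY}; have y1 := low zL.
  have [h|h] := leP (zx + a) ((a - 1) * (zy + 1)).
    left; apply: (frame_incone fr (p := (a - 1) * (zy + 1) - (zx + a)) (q := zy + 1)).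
    - by rewrite subr_ge0.
    - by move: y1; clear; lia.
    - by ring.
    - by ring.
  right; apply: (frame_incone fr (p := zx + a - (a - 1) * (zy + 1)) (q := a * zy - zx)).
  - by rewrite subr_ge0 ltW.
  - by rewrite subr_ge0; apply: slanted.
  - by ring.
  - by ring.
have onlyr T : T \in D -> pt 0 0 \in T ->
    T = [fset pt 0 0; pt (- a) (-1); pt (-1) 0]%fset \/
    T = [fset pt 0 0; pt 0 1; pt (-1) 0]%fset.
  apply: (two_triangles (cf_rt cf) hrb hr' n2) => [z zL|]; last first.
    have [ea|na] := eqVneq a 1.
      by right; apply: (frame_incone fr (p := 1) (q := 1)) => //; rewrite ea.
    by left; rewrite dE normrM d1; move: a1 na; clear; lia.
  have [X [Y XY]] := frame_inv fr; rewrite -(XY z) in zL *.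
  move: (X z) (Y z) zL => zx zy zL {z X Y XY}.
  have y1 := low zL; have x0 := right zL.
  have [h|h] := leP 0 zy.
    right; apply: (frame_incone fr (p := zy) (q := - zx)) => //.
    - by move: x0; clear; lia.
    - by ring.
    - by ring.
  have ey : zy = -1 by move: h y1; clear; lia.
  rewrite ey in zL *; have xa := cut zL.
  left; apply: (frame_incone fr (p := 1) (q := - a - zx)) => //.
  - by move: xa; clear; lia.
  - by ring.
  - by ring.
(* The relations at the two corners: the neighbours of [b] add up to [b + v], so [k = 1]; those of
   [r] add up to [(2 - a) r + a v], so [k = 2 - a]. Hence the factors 1 and [a]. *)
have [||bx by_] := @frame_comb3 _ fr (- a) (-1) (-1) 0 0 0 (- a - 1) (-1) 1 1 (-1); try by ring.
have [||rx ry] := @frame_comb3 _ fr (-1) 0 0 0 0 1 (- a) (-1) a (2 - a) (-1); try by ring.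
have [bx1 by1] : px (pt (- a - 1) (-1)) + px (pt 0 0) =
   1 * px (pt (- a) (-1)) + (2 - 1) * px (pt (-1) 0) /\
   py (pt (- a - 1) (-1)) + py (pt 0 0) =
   1 * py (pt (- a) (-1)) + (2 - 1) * py (pt (-1) 0).
  by move: bx by_; rewrite (_ : 1 + 1 + -1 = 1 :> int) // ?(_ : 2 - 1 = 1 :> int) // !mul1r => -> ->; split; ring.
have [rx1 ry1] : px (pt (- a) (-1)) + px (pt 0 1) =
   (2 - a) * px (pt 0 0) + (2 - (2 - a)) * px (pt (-1) 0) /\
   py (pt (- a) (-1)) + py (pt 0 1) =
   (2 - a) * py (pt 0 0) + (2 - (2 - a)) * py (pt (-1) 0).
  have e2 : 2 - (2 - a) = a by ring.
  have e1 : a + (2 - a) + -1 = 1 by ring.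
  by rewrite e2; move: rx ry; rewrite e1 !mul1r => -> ->; split; ring.
apply/ffunP => C; rewrite [RHS]ffunE.
rewrite (skel_vec_inner rt0 cf C hb' hbr n1 onlyb bx1 by1).
rewrite (skel_vec_inner rt0 cf C hrb hr' n2 onlyr rx1 ry1).
have onlyb' T : T \in D -> pt (- a) (-1) \in T ->
    T = [fset pt (- a) (-1); pt 0 0; pt (-1) 0]%fset \/
    T = [fset pt (- a) (-1); pt (- a - 1) (-1); pt (-1) 0]%fset.
  by move=> TD uT; case: (onlyb T TD uT); [right|left].
have n1' : pt 0 0 != pt (- a - 1) (-1) by rewrite eq_sym.
rewrite (inner_class rt0 cf C hbr hb' n1' onlyb').
rewrite (_ : 2 - (2 - a) = a); last by ring.
by rewrite (_ : 2 - 1 = 1 :> int) // mul1r.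
Qed.

End Corner.

(** * Counting in a strip *)

Section Strip.
Variables (R : realType) (D0 : {fset {fset lat}}) (c : lat -> R).
Variables (I L0 L : {fset lat}) (D : {fset {fset lat}}).
Hypotheses (rt0 : regtri c L0 D0) (cf : config D0 c I L D) (ne : no_ears I L D).

(* The interior lattice points occupy the rows [0, ..., 3], from [l y] to [r y]. *)
Record strip (pt : int -> int -> lat) (l r : int -> int) : Prop := {
  st_frame : frame pt;
  st_int : forall x y, pt x y \in I <-> (0 <= y <= 3) && (l y <= x <= r y);
  st_lr : forall y : int, 0 <= y <= 3 -> l y <= r y;
  st_row : forall x y, pt x y \in L -> -1 <= y <= 4;
  st_sub : forall x y : int, 0 <= y <= 3 -> pt x y \in L -> l y - 1 <= x <= r y + 1 }.

Lemma frame_ext pt pt' : (forall x y, pt x y = pt' x y) -> frame pt -> frame pt'.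
Proof.
move=> e [z0 [e1 [e2 [dt h]]]]; exists z0, e1, e2; split=> // x y.
by rewrite -e.
Qed.

Lemma strip_flipx pt l r : strip pt l r ->
  strip (fun x y => pt (- x) y) (fun y => - r y) (fun y => - l y).
Proof.
move=> [h1 h2 h3 h4 h5]; split.
- apply: (frame_ext _ (frame_comp 0 0 h1 (_ : `|(-1) * 1 - 0 * 0| = 1))) => // x y.
  by rewrite /= !mul0r mul1r mulN1r !addr0 add0r.
- by move=> x y; rewrite h2; clear; lia.
- by move=> y /h3; clear; lia.
- by move=> x y /h4.
- by move=> x y hy /(h5 _ _ hy); clear; lia.
Qed.

Lemma strip_flipy pt l r : strip pt l r ->
  strip (fun x y => pt x (3 - y)) (fun y => l (3 - y)) (fun y => r (3 - y)).
Proof.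
move=> [h1 h2 h3 h4 h5]; split.
- apply: (frame_ext _ (frame_comp 0 3 h1 (_ : `|1 * (-1) - 0 * 0| = 1))) => // x y.
  by rewrite /= !mul0r mul1r mulN1r !addr0 add0r addrC.
- by move=> x y; rewrite h2; clear; lia.
- by move=> y hy; apply: h3; move: hy; clear; lia.
- by move=> x y /h4; clear; lia.
- by move=> x y hy; apply: h5; move: hy; clear; lia.
Qed.

Lemma strip_shear pt l r (t s : int) : strip pt l r ->
  strip (fun x y => pt (x + t * y + s) y) (fun y => l y - t * y - s)
    (fun y => r y - t * y - s).
Proof.
move=> [h1 h2 h3 h4 h5]; split.
- apply: (frame_ext _ (frame_comp s 0 h1 (_ : `|1 * 1 - t * 0| = 1))) => [x y|].
    by rewrite /= !mul0r !mul1r !addr0 add0r.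
  by rewrite mulr0 subr0.
- by move=> x y; rewrite h2; clear; lia.
- by move=> y /h3; clear; lia.
- by move=> x y /h4.
- by move=> x y hy /(h5 _ _ hy); clear; lia.
Qed.

Section Chords.
Variables (pt : int -> int -> lat) (l r : int -> int).
Hypothesis st : strip pt l r.
Let fr := st_frame st.

Lemma strip_right (y : int) : 0 <= y <= 3 -> pt (r y) y \in I.
Proof. by move=> hy; apply/(st_int st); rewrite hy (st_lr st hy) lexx. Qed.

(** If the chord passed strictly to the right of [pt (r k + 1) k], that point would be a mean of the
    chord and the interior point [pt (r k) k] with positive weight on the latter, hence interior. *)
Lemma chord_le (x i x' j k : int) : 0 <= k <= 3 -> i < k -> k < j ->
  pt x i \in L -> pt x' j \in L ->
  (j - k) * x + (k - i) * x' <= (j - i) * (r k + 1).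
Proof.
move=> hk ik kj h1 h2; rewrite leNgt; apply/negP => lt.
have : pt (r k + 1) k \in I.
  apply: (config_mix cf fr (strip_right hk) h1 h2
    (k := (j - k) * x + (k - i) * x' - (j - i) * (r k + 1)) (m := j - k) (n := k - i)).
  - by rewrite subr_gt0.
  - by rewrite subr_ge0 ltW.
  - by rewrite subr_ge0 ltW.
  - by ring.
  - by ring.
by move/(st_int st); clear; lia.
Qed.

(** An interior end point supplies the positive weight by itself, so the chord may not even touch
    [pt (r k + 1) k]. *)
Lemma chord_lt (x i x' j k : int) : 0 <= k <= 3 -> i < k -> k < j ->
  pt x i \in I -> pt x' j \in L ->
  (j - k) * x + (k - i) * x' < (j - i) * (r k + 1).
Proof.
move=> hk ik kj h1 h2; rewrite ltNge; apply/negP => lt.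
have : pt (r k + 1) k \in I.
  apply: (config_mix cf fr h1 (cf_int cf (strip_right hk)) h2
    (k := j - k) (m := (j - k) * x + (k - i) * x' - (j - i) * (r k + 1)) (n := k - i)).
  - by rewrite subr_gt0.
  - by rewrite subr_ge0.
  - by rewrite subr_ge0 ltW.
  - by ring.
  - by ring.
by move/(st_int st); clear; lia.
Qed.

Lemma chord_lt' (x i x' j k : int) : 0 <= k <= 3 -> i < k -> k < j ->
  pt x i \in L -> pt x' j \in I ->
  (j - k) * x + (k - i) * x' < (j - i) * (r k + 1).
Proof.
move=> hk ik kj h1 h2; rewrite ltNge; apply/negP => lt.
have : pt (r k + 1) k \in I.
  apply: (config_mix cf fr h2 (cf_int cf (strip_right hk)) h1
    (k := k - i) (m := (j - k) * x + (k - i) * x' - (j - i) * (r k + 1)) (n := j - k)).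
  - by rewrite subr_gt0.
  - by rewrite subr_ge0.
  - by rewrite subr_ge0 ltW.
  - by ring.
  - by ring.
by move/(st_int st); clear; lia.
Qed.

Definition rho y : int := (pt (r y + 1) y \in L)%:R.

Let I0 : is_true ((0 : int) <= (0 : int) <= (3 : int)). Proof. by []. Qed.
Let I1 : is_true ((0 : int) <= (1 : int) <= (3 : int)). Proof. by []. Qed.
Let I2 : is_true ((0 : int) <= (2 : int) <= (3 : int)). Proof. by []. Qed.
Let I3 : is_true ((0 : int) <= (3 : int) <= (3 : int)). Proof. by []. Qed.

(** Rows 1 and 2 are compared with the chord from row 0 to row 3; where an end of the boundary chord
    is missing, an interior point and a strict inequality replace it. The combination [x + 2 * m] is
    what this side takes off twice the generic count. *)
Lemma right_defect : let m := 4 - (rho 0 + rho 1 + rho 2 + rho 3) in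
  let x := r 1 + r 2 - r 0 - r 3 in
  [/\ 0 <= m, m = 0 -> 0 <= x & 0 < m -> 2 <= x + 2 * m].
Proof.
rewrite /rho; move: (pt (r 1 + 1) 1 \in L) (pt (r 2 + 1) 2 \in L) => b1 b2.
have [h0|h0] := boolP (pt (r 0 + 1) 0 \in L); have [h3|h3] := boolP (pt (r 3 + 1) 3 \in L).
- have := chord_le I1 _ _ h0 h3; have := chord_le I2 _ _ h0 h3.
  by move=> /(_ isT isT) + /(_ isT isT); clear; case: b1; case: b2 => /= ? ?; split; lia.
- have := chord_lt' I1 _ _ h0 (strip_right I3); have := chord_lt' I2 _ _ h0 (strip_right I3).
  by move=> /(_ isT isT) + /(_ isT isT); clear; case: b1; case: b2 => /= ? ?; split; lia.
- have := chord_lt I1 _ _ (strip_right I0) h3; have := chord_lt I2 _ _ (strip_right I0) h3.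
  by move=> /(_ isT isT) + /(_ isT isT); clear; case: b1; case: b2 => /= ? ?; split; lia.
- have h := cf_int cf (strip_right I3).
  have := chord_lt I1 _ _ (strip_right I0) h; have := chord_lt I2 _ _ (strip_right I0) h.
  by move=> /(_ isT isT) + /(_ isT isT); clear; case: b1; case: b2 => /= ? ?; split; lia.
Qed.

Lemma right_straight : (forall y : int, 0 <= y <= 3 -> pt (r y + 1) y \in L) ->
  r 1 + r 2 <= r 0 + r 3 -> forall y : int, 0 <= y <= 3 -> r y = r 0 + (r 1 - r 0) * y.
Proof.
move=> h hx y hy.
have h1 : (2 - 1) * (r 0 + 1) + (1 - 0) * (r 2 + 1) <= (2 - 0) * (r 1 + 1).
  by apply: (chord_le I1) => //; apply: h.
have h2 : (3 - 2) * (r 1 + 1) + (2 - 1) * (r 3 + 1) <= (3 - 1) * (r 2 + 1).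
  by apply: (chord_le I2) => //; apply: h.
have : y = 0 \/ y = 1 \/ y = 2 \/ y = 3 by move: hy; clear; lia.
by case=> [->|[->|[->|->]]]; move: hx h1 h2; clear; lia.
Qed.

End Chords.

Section Rows.
Variable pt : int -> int -> lat.
Hypothesis fr : frame pt.

Lemma row_extents (F : {fset lat}) (y : int) :
  (forall x x' z, pt x y \in F -> pt x' y \in F -> x < z -> z < x' -> pt z y \in F) ->
  (forall x, pt x y \notin F) \/
  exists s e, s <= e /\ forall x, pt x y \in F <-> s <= x <= e.
Proof.
move=> cv; have [X [Y XY]] := frame_inv fr.
have XE x z : X (pt x z) = x by have /(frame_inj fr)[] := XY (pt x z).
have YE x z : Y (pt x z) = z by have /(frame_inj fr)[] := XY (pt x z).
have [[x0 hx0]|no] := pselect (exists x, pt x y \in F); last first.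
  by left=> x; apply/negP => h; apply: no; exists x.
right; pose S := [fset z in F | Y z == y]%fset.
have SE x : (pt x y \in S) = (pt x y \in F) by rewrite !inE /= YE eqxx andbT.
have exS : exists z, z \in S by exists (pt x0 y); rewrite SE.
have [zs zsS mins] := fset_min (fun z => (X z)%:~R : R) exS.
have [ze zeS maxs] := fset_min (fun z => - (X z)%:~R : R) exS.
have pS z : z \in S -> z = pt (X z) y.
  by rewrite !inE /= => /andP[_ /eqP <-]; rewrite XY.
have lo x : pt x y \in F -> X zs <= x.
  by rewrite -SE => /mins; rewrite XE ler_int.
have hi x : pt x y \in F -> x <= X ze.
  by rewrite -SE => /maxs; rewrite XE lerN2 ler_int.
have sF : pt (X zs) y \in F by rewrite -SE -pS.
have eF : pt (X ze) y \in F by rewrite -SE -pS.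
exists (X zs), (X ze); split; first exact: lo.
move=> x; split; first by move=> h; rewrite lo ?hi.
move=> /andP[h1 h2].
have [->//|n1] := eqVneq x (X zs); have [->//|n2] := eqVneq x (X ze).
by apply: (cv _ _ _ sF eF); move: h1 h2 n1 n2; clear; lia.
Qed.

Lemma row_extents_L (y : int) : (forall x, pt x y \notin L) \/
  exists s e, s <= e /\ forall x, pt x y \in L <-> s <= x <= e.
Proof.
apply: row_extents => x x' z h1 h2 xz zx.
apply: (config_conv cf fr h1 h2 (m := x' - z) (n := z - x)); rewrite ?subr_gt0 //; by ring.
Qed.

Lemma row_extents_I (y : int) : (forall x, pt x y \notin I) \/
  exists s e, s <= e /\ forall x, pt x y \in I <-> s <= x <= e.
Proof.
apply: row_extents => x x' z h1 h2 xz zx.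
have h2L := cf_int cf h2.
apply: (config_mix cf fr h1 h2L h2L (k := x' - z) (m := z - x) (n := 0)); rewrite ?subr_gt0 // ?subr_ge0 1?ltW //; by ring.
Qed.

End Rows.

Definition cover (X : seq lat) : Prop := forall z, z \in L -> z \notin I ->
  skel_vec D0 (delta R z) \in <<[seq skel_vec D0 (delta R y) | y <- X]>>%VS.

Section Cover.
Variables (pt : int -> int -> lat) (l r : int -> int).
Hypothesis st : strip pt l r.
Let fr := st_frame st.

Lemma strip_boundary_row s e : s <= e -> (forall x, pt x (-1) \in L <-> s <= x <= e) ->
  boundary_row I L pt (l 0) (r 0) s e.
Proof.
move=> se hse; split=> //.
- by move=> x y /(st_row st)/andP[].
- exact: (st_lr st).
- by move=> x; rewrite (st_int st).
- by move=> x; apply: (st_sub st).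
- by move=> x; apply/negP => /(st_int st).
Qed.

(** The second alternative records the case without saving: the row is longer than the interior one
    and its last apex is the last interior point. This triangle is what the relation at a corner
    needs. *)
Lemma bottom_cover : exists B : seq lat,
  [/\ forall x, pt x (-1) \in L -> pt x (-1) \in B \/ skel_vec D0 (delta R (pt x (-1))) = 0,
    (size B)%:Z <= r 0 - l 0 + 2 &
    (size B)%:Z <= r 0 - l 0 + 1 \/ exists s e, [/\ s < e, r 0 - l 0 + 1 <= e - s,
      (forall x, pt x (-1) \in L <-> s <= x <= e), pt e (-1) \in B &
      [fset pt (e - 1) (-1); pt e (-1); pt (r 0) 0]%fset \in D]].
Proof.
have lr : l 0 <= r 0 by apply: (st_lr st).
have [emp|[s [e [se hse]]]] := row_extents_L fr (-1).
  exists [::]; split=> [x|//|]; first by rewrite (negbTE (emp x)).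
    by move: lr; clear => /= ; lia.
  by left; move: lr; clear => /= ; lia.
have br := strip_boundary_row se hse.
pose B := [seq pt x (-1) | x <- [seq x <- irange s e | kept R D0 pt s e x]].
have [c1 c2] := row_count rt0 cf ne br.
have sB : size B = size [seq x <- irange s e | kept R D0 pt s e x] by rewrite size_map.
exists B; split; rewrite ?sB //.
  move=> x /hse hx; have [k|] := boolP (kept R D0 pt s e x).
    by left; apply: map_f; rewrite mem_filter k mem_irange.
  by rewrite /kept !negb_or negbK => /and3P[_ _ /eqP ->]; right.
have [h|h] := leP (e - s) (r 0 - l 0).
  left; have : (size [seq x <- irange s e | kept R D0 pt s e x] <= size (irange s e))%N.
    by rewrite size_filter count_size.
  by have := size_irange s e; move: h se; clear; lia.
case: c2 => [c2|[se' hT]]; [by left|right]; exists s, e; split=> //.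
  by move: h; clear; lia.
by apply: map_f; rewrite mem_filter mem_irange /kept eqxx orbT se lexx.
Qed.

End Cover.
End Strip.

(** * Spanning sets for the vectors of the boundary points *)

Section StripCover.
Variables (R : realType) (D0 : {fset {fset lat}}) (c : lat -> R).
Variables (I L0 L : {fset lat}) (D : {fset {fset lat}}).
Hypotheses (rt0 : regtri c L0 D0) (cf : config D0 c I L D) (ne : no_ears I L D).
Local Notation strip := (strip I L).
Local Notation cover := (cover R D0 I L).
Local Notation vec z := (skel_vec D0 (delta R z)).
Local Notation in_span X z := (vec z \in <<[seq vec y | y <- X]>>%VS).

Lemma in_span_mem (X : seq lat) z : z \in X -> in_span X z.
Proof. by move=> zX; apply: memv_span; apply: map_f. Qed.

Lemma in_span_zero (X : seq lat) z : vec z = 0 -> in_span X z.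
Proof. by move=> ->; apply: mem0v. Qed.

Definition rows4 : seq int := [:: 0; 1; 2; 3].

Lemma rows4P (y : int) : (y \in rows4) = (0 <= y <= 3).
Proof. by rewrite !inE; lia. Qed.

Section Fixed.
Variables (pt : int -> int -> lat) (l r : int -> int).
Hypothesis st : strip pt l r.
Let fr := st_frame st.

Lemma strip_coverP X :
  (forall x, pt x (-1) \in L -> in_span X (pt x (-1))) ->
  (forall x, pt x 4 \in L -> in_span X (pt x 4)) ->
  (forall y : int, 0 <= y <= 3 -> pt (r y + 1) y \in L -> in_span X (pt (r y + 1) y)) ->
  (forall y : int, 0 <= y <= 3 -> pt (l y - 1) y \in L -> in_span X (pt (l y - 1) y)) ->
  cover X.
Proof.
move=> hb ht hr hl z zL zI; have [A [B AB]] := frame_inv fr.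
rewrite -(AB z) in zL zI *; move: (A z) (B z) zL zI => x y zL zI {z A B AB}.
have hy := st_row st zL.
have [ey|ny] := eqVneq y (-1); first by rewrite ey in zL *; apply: hb.
have [ey|ny'] := eqVneq y 4; first by rewrite ey in zL *; apply: ht.
have hy' : 0 <= y <= 3 by move: hy ny ny'; clear; lia.
have hx := st_sub st hy' zL.
have [ex|nx] := eqVneq x (r y + 1); first by rewrite ex in zL *; apply: hr.
have [ex|nx'] := eqVneq x (l y - 1); first by rewrite ex in zL *; apply: hl.
by case/negP: zI; apply/(st_int st); rewrite hy'; move: hx nx nx'; clear; lia.
Qed.

Lemma top_cover : exists B : seq lat,
  [/\ forall x, pt x 4 \in L -> pt x 4 \in B \/ vec (pt x 4) = 0,
    (size B)%:Z <= r 3 - l 3 + 2 &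
    (size B)%:Z <= r 3 - l 3 + 1 \/ exists s e, [/\ s < e, r 3 - l 3 + 1 <= e - s &
      (forall x, pt x 4 \in L <-> s <= x <= e)]].
Proof.
have [B [h1 h2 h3]] := bottom_cover rt0 cf ne (strip_flipy st).
exists B; split; [exact: h1|exact: h2|case: h3 => [h3|]; first by left].
by move=> [s [e [h4 h5 h6 _ _]]]; right; exists s, e.
Qed.

Lemma generic_cover : exists2 X, cover X &
  (size X)%:Z <= r 0 - l 0 + (r 3 - l 3) + 4
    + (size [seq y <- rows4 | pt (r y + 1) y \in L])%:Z
    + (size [seq y <- rows4 | pt (l y - 1) y \in L])%:Z.
Proof.
have [B [b1 b2 _]] := bottom_cover rt0 cf ne st.
have [T [t1 t2 _]] := top_cover.
exists (B ++ T ++ [seq pt (r y + 1) y | y <- [seq y <- rows4 | pt (r y + 1) y \in L]]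
   ++ [seq pt (l y - 1) y | y <- [seq y <- rows4 | pt (l y - 1) y \in L]]).
  apply: strip_coverP => [x|x|y hy|y hy] h.
  - case: (b1 _ h) => k; [apply: in_span_mem|exact: in_span_zero].
    by rewrite !mem_cat k.
  - case: (t1 _ h) => k; [apply: in_span_mem|exact: in_span_zero].
    by rewrite !mem_cat k orbT.
  - apply: in_span_mem; rewrite !mem_cat; apply/or4P/Or43/map_f.
    by rewrite mem_filter h rows4P.
  - apply: in_span_mem; rewrite !mem_cat; apply/or4P/Or44.
    by apply: (map_f (fun y => pt (l y - 1) y)); rewrite mem_filter h rows4P.
by rewrite !size_cat !size_map; move: b2 t2; clear; lia.
Qed.

(* When the right boundary is a vertical line, every saving on it or on one of
   the horizontal sides improves the generic count by one. *)
Lemma saving_cover (B T : seq lat) (y0 : int) :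
  (forall x, pt x (-1) \in L -> pt x (-1) \in B \/ vec (pt x (-1)) = 0) ->
  (forall x, pt x 4 \in L -> pt x 4 \in T \/ vec (pt x 4) = 0) ->
  (size B)%:Z <= r 0 - l 0 + 2 -> (size T)%:Z <= r 3 - l 3 + 2 ->
  0 <= y0 <= 3 ->
  in_span (B ++ T ++ [seq pt (l y - 1) y | y <- rows4]
    ++ [seq pt (r y + 1) y | y <- rem y0 rows4]) (pt (r y0 + 1) y0) ->
  exists2 X, cover X & (size X)%:Z <= r 0 - l 0 + (r 3 - l 3) + 11.
Proof.
move=> b1 t1 b2 t2 hy0 h0.
exists (B ++ T ++ [seq pt (l y - 1) y | y <- rows4]
    ++ [seq pt (r y + 1) y | y <- rem y0 rows4]).
  apply: strip_coverP => [x|x|y hy|y hy] h.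
  - case: (b1 _ h) => k; [apply: in_span_mem|exact: in_span_zero].
    by rewrite !mem_cat k.
  - case: (t1 _ h) => k; [apply: in_span_mem|exact: in_span_zero].
    by rewrite !mem_cat k orbT.
  - have [->//|ny] := eqVneq y y0.
    apply: in_span_mem; rewrite !mem_cat; apply/or4P/Or44.
    apply: (map_f (fun y => pt (r y + 1) y)).
    by rewrite mem_rem_uniq // inE ny rows4P.
  - apply: in_span_mem; rewrite !mem_cat; apply/or4P/Or43.
    by apply: (map_f (fun y => pt (l y - 1) y)); rewrite rows4P.
rewrite !size_cat !size_map size_rem ?rows4P //= .
by move: b2 t2; clear; lia.
Qed.

(** The constant is 3, instead of the generic 4, for the two horizontal rows plus 8 for the
    sides. *)
Lemma tight_cover (B T : seq lat) :
  (forall x, pt x (-1) \in L -> pt x (-1) \in B \/ vec (pt x (-1)) = 0) ->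
  (forall x, pt x 4 \in L -> pt x 4 \in T \/ vec (pt x 4) = 0) ->
  (size B)%:Z + (size T)%:Z <= r 0 - l 0 + (r 3 - l 3) + 3 ->
  exists2 X, cover X & (size X)%:Z <= r 0 - l 0 + (r 3 - l 3) + 11.
Proof.
move=> b1 t1 bt.
exists (B ++ T ++ [seq pt (l y - 1) y | y <- rows4]
    ++ [seq pt (r y + 1) y | y <- rows4]).
  apply: strip_coverP => [x|x|y hy|y hy] h.
  - case: (b1 _ h) => k; [apply: in_span_mem|exact: in_span_zero].
    by rewrite !mem_cat k.
  - case: (t1 _ h) => k; [apply: in_span_mem|exact: in_span_zero].
    by rewrite !mem_cat k orbT.
  - apply: in_span_mem; rewrite !mem_cat; apply/or4P/Or44.
    by apply: (map_f (fun y => pt (r y + 1) y)); rewrite rows4P.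
  - apply: in_span_mem; rewrite !mem_cat; apply/or4P/Or43.
    by apply: (map_f (fun y => pt (l y - 1) y)); rewrite rows4P.
by rewrite !size_cat !size_map /=; move: bt; clear; lia.
Qed.

Section RightLine.
Hypothesis rc : forall y : int, 0 <= y <= 3 -> r y = r 0.
Hypothesis rL : forall y : int, 0 <= y <= 3 -> pt (r 0 + 1) y \in L.

Lemma right_bound x y : pt x y \in L -> x <= r 0 + 1.
Proof.
move=> h; have hy := st_row st h.
have [ey|ny] := eqVneq y (-1).
  have h0 : (1 - 0) * x + (0 - -1) * (r 0 + 1) <= (1 - -1) * (r 0 + 1).
    by apply: (chord_le cf st) => //; [rewrite -ey|apply: rL].
  by move: h0; clear; lia.
have [ey|ny'] := eqVneq y 4.
  have h0 : (4 - 3) * (r 0 + 1) + (3 - 2) * x <= (4 - 2) * (r 3 + 1).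
    by apply: (chord_le cf st) => //; [apply: rL|rewrite -ey].
  by move: h0; rewrite (@rc 3 isT); clear; lia.
have hy' : 0 <= y <= 3 by move: hy ny ny'; clear; lia.
by have := st_sub st hy' h; rewrite (rc hy'); clear; lia.
Qed.

(** Seen as a boundary row, the right side has six points next to an interior row of four, and
    [row_count] keeps at most five. *)
Lemma six_line : pt (r 0 + 1) (-1) \in L -> pt (r 0 + 1) 4 \in L ->
  exists y : int, 0 <= y <= 3 /\ vec (pt (r 0 + 1) y) = 0.
Proof.
move=> h1 h4; pose pt' := fun x y => pt (r 0 - y) x.
have E x : pt' x (-1) = pt (r 0 + 1) x by rewrite /pt' opprK.
have br : boundary_row I L pt' 0 3 (-1) 4.
  split=> //.
  - apply: (frame_ext _ (frame_comp (r 0) 0 fr (_ : `|0 * 0 - (-1) * 1| = 1))) => // x y.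
    by rewrite /pt' /= !mul0r mul1r mulN1r !addr0 add0r addrC.
  - by move=> x y /right_bound; clear; lia.
  - move=> x; rewrite /pt' subr0 (st_int st); split=> [/andP[]//|hx].
    by rewrite hx -(rc hx) lexx (st_lr st hx).
  - by move=> x /(st_row st).
  - move=> x; rewrite E; apply/negP => /(st_int st)/andP[hx].
    by rewrite (rc hx); clear; lia.
  - move=> x; rewrite E; split=> [/(st_row st)//|hx].
    have [->//|nx] := eqVneq x (-1); have [->//|nx'] := eqVneq x 4.
    by apply: rL; move: hx nx nx'; clear; lia.
have [c1 _] := row_count rt0 cf ne br.
have /allPn[x] : ~~ all (kept R D0 pt' (-1) 4) (irange (-1) 4).
  by apply/negP => /all_filterP h; move: c1; rewrite h size_irange; clear; lia.
rewrite mem_irange /kept !negb_or negbK E => hx /and3P[n1 n4 /eqP v0].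
by exists x; split=> //; move: hx n1 n4; clear; lia.
Qed.

End RightLine.
End Fixed.

Section Normalized.
Variables (pt : int -> int -> lat) (l r : int -> int).
Hypothesis st : strip pt l r.
Let fr := st_frame st.
Hypothesis rN : forall y : int, 0 <= y <= 3 -> r y = -1.
Hypothesis rL : forall y : int, 0 <= y <= 3 -> pt 0 y \in L.

Let rc (y : int) : 0 <= y <= 3 -> r y = r 0.
Proof. by move=> hy; rewrite rN // rN. Qed.

Let rL' (y : int) : 0 <= y <= 3 -> pt (r 0 + 1) y \in L.
Proof. by move=> hy; rewrite rN // rL. Qed.

Let bound x y : pt x y \in L -> x <= 0.
Proof. by move=> /(right_bound st rc rL'); rewrite rN. Qed.

(** Without a saving in the bottom row or on the right side, both end triangles at the cut corner
    have the apex [pt (-1) 0]. Then [corner_relation] makes the vector of [pt 0 0] a multiple of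
    that of [pt e (-1)], which is already in the family. *)
Lemma corner_cover : pt 0 (-1) \notin L -> pt 0 4 \in L ->
  exists2 X, cover X & (size X)%:Z <= r 0 - l 0 + (r 3 - l 3) + 11.
Proof.
move=> h1 h4.
have [B [b1 b2 b3]] := bottom_cover rt0 cf ne st.
have [T [t1 t2 _]] := top_cover st.
case: b3 => [b3|[s [e [se tight hse eB hT]]]].
  by apply: (tight_cover st b1 t1); move: b3 t2; clear; lia.
have eL : pt e (-1) \in L by apply/hse; move: se; clear; lia.
have e1 : e <= -1.
  have := bound eL; rewrite le_eqVlt => /orP[/eqP e0|]; last by clear; lia.
  by rewrite -e0 eL in h1.
(* The right side becomes the row -1, read downwards so that its last point is [pt 0 0] at the cut
   corner. *)
pose pt' := fun x y => pt (-1 - y) (- x).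
have E x : pt' x (-1) = pt 0 (- x) by rewrite /pt' opprK addNr.
have br : boundary_row I L pt' (-3) 0 (-4) 0.
  split=> //.
  - apply: (frame_ext _ (frame_comp (-1) 0 fr (_ : `|0 * 0 - (-1) * (-1)| = 1))) => // x y.
    by rewrite /pt' /= !mul0r !mulN1r !addr0 add0r addrC.
  - by move=> x y /bound; clear; lia.
  - move=> x; rewrite /pt' subr0 (st_int st); split=> [/andP[]|hx]; first by clear; lia.
    have hx' : 0 <= - x <= 3 by move: hx; clear; lia.
    by rewrite hx' -(rN hx') lexx (st_lr st hx').
  - by move=> x /(st_row st); clear; lia.
  - move=> x; rewrite E; apply/negP => /(st_int st)/andP[hx].
    by rewrite (rN hx); clear; lia.
  - move=> x; rewrite E; split=> [h|hx].
      have := st_row st h; suff : - x != -1 by clear; lia.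
      by apply: contraNneq h1 => <-.
    have [->//|nx] := eqVneq x (-4).
    by apply: rL; move: hx nx; clear; lia.
have [_ [c1|[_ hr]]] := row_count rt0 cf ne br.
  have /allPn[x] : ~~ all (kept R D0 pt' (-4) 0) (irange (-4) 0).
    by apply/negP => /all_filterP h; move: c1; rewrite h size_irange; clear; lia.
  rewrite mem_irange /kept !negb_or negbK E => hx /and3P[n1 n4 /eqP v0].
  have hy : 0 <= - x <= 3 by move: hx n1 n4; clear; lia.
  apply: (saving_cover st b1 t1 b2 t2 hy).
  by apply: in_span_zero; rewrite (rN hy).
have hr' : [fset pt 0 1; pt 0 0; pt (-1) 0]%fset \in D by [].
have hb : [fset pt (- - e - 1) (-1); pt (- - e) (-1); pt (-1) 0]%fset \in D.
  by rewrite opprK; move: hT; rewrite (@rN 0 isT).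
have a1 : 1 <= - e by move: e1; clear; lia.
have rel := corner_relation rt0 cf ne fr a1 _ _ _ _ _ _ hb hr'.
have {rel} rel : vec (pt 0 0) = (- e)%:~R *: vec (pt (- - e) (-1)).
  apply: rel.
  - by move=> x y /(st_row st)/andP[].
  - exact: bound.
  - by move=> x /hse; rewrite opprK => /andP[].
  - by apply/negP => /(st_int st).
  - by apply/negP => /(st_int st); rewrite (@rN 0 isT); clear; lia.
  - by apply/(st_int st); rewrite -(@rN 0 isT) lexx (st_lr st).
apply: (saving_cover st b1 t1 b2 t2 (_ : 0 <= 0 <= 3)) => //.
rewrite (@rN 0 isT) addNr rel opprK memvZ //.
by apply: in_span_mem; rewrite mem_cat eB.
Qed.

End Normalized.

Lemma chord_ge pt l r (x i x' j k : int) : strip pt l r -> 0 <= k <= 3 -> i < k ->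
  k < j -> pt x i \in L -> pt x' j \in L ->
  (j - i) * (l k - 1) <= (j - k) * x + (k - i) * x'.
Proof.
move=> st hk ik kj h1 h2.
have := chord_le cf (strip_flipx st) hk ik kj (x := - x) (x' := - x').
by rewrite !opprK => /(_ h1 h2); clear; lia.
Qed.

(** The cases are given by which of [pt 0 (-1)] and [pt 0 4] prolong the right side: both give six
    points on it, one gives a cut corner, and none moves the problem to the left side. *)
Lemma straight_cover_normalized pt l r : strip pt l r ->
  (forall y : int, 0 <= y <= 3 -> r y = -1) ->
  (forall y : int, 0 <= y <= 3 -> pt 0 y \in L) ->
  (forall y : int, 0 <= y <= 3 -> pt (l y - 1) y \in L) ->
  exists2 X, cover X & (size X)%:Z <= r 0 - l 0 + (r 3 - l 3) + 11.
Proof.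
move=> st rN rL lL.
have rc (y : int) : 0 <= y <= 3 -> r y = r 0 by move=> hy; rewrite rN // rN.
have rL' (y : int) : 0 <= y <= 3 -> pt (r 0 + 1) y \in L by move=> hy; rewrite rN // rL.
have bound x y : pt x y \in L -> x <= 0 by move=> /(right_bound st rc rL'); rewrite rN.
have [B [b1 b2 b3]] := bottom_cover rt0 cf ne st.
have [T [t1 t2 t3]] := top_cover st.
have [h1|h1] := boolP (pt 0 (-1) \in L); have [h4|h4] := boolP (pt 0 4 \in L).
- have [||y [hy v0]] := six_line st rc rL'; try by rewrite (@rN 0 isT).
  apply: (saving_cover st b1 t1 b2 t2 hy).
  by apply: in_span_zero; rewrite rc.
- have rNf (y : int) : 0 <= y <= 3 -> r (3 - y) = -1.
    by move=> hy; apply: rN; move: hy; clear; lia.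
  have rLf (y : int) : 0 <= y <= 3 -> pt 0 (3 - y) \in L.
    by move=> hy; apply: rL; move: hy; clear; lia.
  have [X cX sX] := corner_cover (strip_flipy st) rNf rLf h4 h1.
  exists X => //; have {}sX : (size X)%:Z <= r 3 - l 3 + (r 0 - l 0) + 11 := sX.
  by move: sX; clear; lia.
- exact: (corner_cover st rN rL h1 h4).
case: b3 => [b3|[s [e [se tight hse _ _]]]].
  by apply: (tight_cover st b1 t1); move: b3 t2; clear; lia.
case: t3 => [t3|[s' [e' [se' tight' hse']]]].
  by apply: (tight_cover st b1 t1); move: t3 b2; clear; lia.
have eL : pt e (-1) \in L by apply/hse; move: se; clear; lia.
have e1 : e <= -1.
  have := bound _ _ eL; rewrite le_eqVlt => /orP[/eqP e0|]; last by clear; lia.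
  by rewrite -e0 eL in h1.
have eL' : pt e' 4 \in L by apply/hse'; move: se'; clear; lia.
have e1' : e' <= -1.
  have := bound _ _ eL'; rewrite le_eqVlt => /orP[/eqP e0|]; last by clear; lia.
  by rewrite -e0 eL' in h4.
have sL : pt s (-1) \in L by apply/hse; move: se; clear; lia.
have sL' : pt s' 4 \in L by apply/hse'; move: se'; clear; lia.
rewrite (@rN 0 isT) in tight; rewrite (@rN 3 isT) in tight'.
have c0 : (1 - -1) * (l 0 - 1) <= (1 - 0) * s + (0 - -1) * (l 1 - 1).
  by apply: (chord_ge st) => //; apply: lL.
have c1 : (2 - 0) * (l 1 - 1) <= (2 - 1) * (l 0 - 1) + (1 - 0) * (l 2 - 1).
  by apply: (chord_ge st) => //; apply: lL.
have c2 : (3 - 1) * (l 2 - 1) <= (3 - 2) * (l 1 - 1) + (2 - 1) * (l 3 - 1).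
  by apply: (chord_ge st) => //; apply: lL.
have c3 : (4 - 2) * (l 3 - 1) <= (4 - 3) * (l 2 - 1) + (3 - 2) * s'.
  by apply: (chord_ge st) => //; apply: lL.
(* Both rows are tight but end before the right line, so they reach at least to [l 0 - 1] and
   [l 3 - 1] on the left. Convexity then makes the left side vertical, with six points. *)
have [l1 [l2 [l3 [ss ss']]]] : l 1 = l 0 /\ l 2 = l 0 /\ l 3 = l 0 /\ s = l 0 - 1 /\ s' = l 0 - 1.
  by move: tight tight' c0 c1 c2 c3 e1 e1'; clear; lia.
have lc (y : int) : 0 <= y <= 3 -> l y = l 0.
  move=> hy; have : y \in rows4 by rewrite rows4P.
  by rewrite !inE => /or4P[] /eqP ->.
have F (y : int) : pt (- (- l 0 + 1)) y = pt (l 0 - 1) y by congr pt; ring.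
have [||||y [hy]] := six_line (strip_flipx st).
- by move=> y /lc ->.
- by move=> y hy; rewrite F -(lc y hy); apply: lL.
- by rewrite F -ss.
- by rewrite F -ss'.
rewrite F => v0.
have [X cX sX] : exists2 X, cover X & (size X)%:Z <= - l 0 - - r 0 + (- l 3 - - r 3) + 11.
  have sx := strip_flipx st.
  have [B' [b1' b2' _]] := bottom_cover rt0 cf ne sx.
  have [T' [t1' t2' _]] := top_cover sx.
  apply: (saving_cover sx b1' t1' b2' t2' hy).
  by apply: in_span_zero; rewrite (lc y hy) F.
by exists X => //; move: sX; clear; lia.
Qed.

Lemma straight_cover pt l r : strip pt l r ->
  (forall y : int, 0 <= y <= 3 -> pt (r y + 1) y \in L) ->
  (forall y : int, 0 <= y <= 3 -> pt (l y - 1) y \in L) ->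
  r 1 + r 2 <= r 0 + r 3 ->
  exists2 X, cover X & (size X)%:Z <= r 0 - l 0 + (r 3 - l 3) + 11.
Proof.
move=> st rL lL hx; have hr := right_straight cf st rL hx.
set t := r 1 - r 0 in hr; have ss := strip_shear t (r 0 + 1) st.
have [|||X cX sX] := straight_cover_normalized ss.
- by move=> y /hr ->; ring.
- by move=> y hy; have := rL y hy; rewrite (hr _ hy); congr (pt _ _ \in L); ring.
- by move=> y hy; have := lL y hy; congr (pt _ _ \in L); ring.
by exists X => //; move: sX; clear; lia.
Qed.

(** Twice the generic count is at most the number of interior points plus 20, minus [x + 2 * m] for
    each of the two sides. A side with a missing point takes off 2. If no point is missing and the
    [x] do not add up to 2, one side has [x = 0], hence is straight, and [straight_cover] saves one
    vector. *)
Lemma strip_cover_bound pt l r : strip pt l r -> exists2 X, cover X &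
  2 * (size X)%:Z <= (r 0 - l 0 + 1) + (r 1 - l 1 + 1) + (r 2 - l 2 + 1)
    + (r 3 - l 3 + 1) + 18.
Proof.
move=> st; have sx := strip_flipx st.
have F (y : int) : pt (- (- l y + 1)) y = pt (l y - 1) y by congr pt; ring.
have F' (y : int) : pt (- (- r y - 1)) y = pt (r y + 1) y by congr pt; ring.
have cnt (f : int -> bool) : (size [seq y <- rows4 | f y])%:Z =
    (f 0)%:R + (f 1)%:R + (f 2)%:R + (f 3)%:R :> int.
  by rewrite /=; case: (f 0); case: (f 1); case: (f 2); case: (f 3).
have all4 (f : int -> bool) : (f 0)%:R + (f 1)%:R + (f 2)%:R + (f 3)%:R = 4 :> int ->
    forall y : int, 0 <= y <= 3 -> f y.
  move=> h y; rewrite -rows4P !inE => hy; move: h.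
  by case/or4P: hy => /eqP ->; case: (f 0); case: (f 1); case: (f 2); case: (f 3).
have [X cX] := generic_cover st; rewrite !cnt => sX.
set nr : int := (pt (r 0 + 1) 0 \in L)%:R + (pt (r 1 + 1) 1 \in L)%:R
  + (pt (r 2 + 1) 2 \in L)%:R + (pt (r 3 + 1) 3 \in L)%:R in sX.
set nl : int := (pt (l 0 - 1) 0 \in L)%:R + (pt (l 1 - 1) 1 \in L)%:R
  + (pt (l 2 - 1) 2 \in L)%:R + (pt (l 3 - 1) 3 \in L)%:R in sX.
have [hr0 hr1 hr2] : [/\ 0 <= 4 - nr, 4 - nr = 0 -> 0 <= r 1 + r 2 - r 0 - r 3
    & 0 < 4 - nr -> 2 <= r 1 + r 2 - r 0 - r 3 + 2 * (4 - nr)] := right_defect cf st.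
have [hl0 hl1 hl2] : [/\ 0 <= 4 - nl, 4 - nl = 0 -> 0 <= l 0 + l 3 - l 1 - l 2
    & 0 < 4 - nl -> 2 <= l 0 + l 3 - l 1 - l 2 + 2 * (4 - nl)].
  have e : l 0 + l 3 - l 1 - l 2 = - l 1 + - l 2 - - l 0 - - l 3 by ring.
  by rewrite e; have := right_defect cf sx; rewrite /rho !F.
have [er|nr4] := eqVneq nr 4; have [el|nl4] := eqVneq nl 4; last 3 first.
- by exists X => //; move: sX hr0 hr1 hr2 hl0 hl1 hl2 nl4 er; clear; lia.
- by exists X => //; move: sX hr0 hr1 hr2 hl0 hl1 hl2 el nr4; clear; lia.
- by exists X => //; move: sX hr0 hr1 hr2 hl0 hl1 hl2 nl4 nr4; clear; lia.
have rL := all4 (fun y => pt (r y + 1) y \in L) er.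
have lL := all4 (fun y => pt (l y - 1) y \in L) el.
have [hx|hx] := leP (r 1 + r 2) (r 0 + r 3).
  have [Y cY sY] := straight_cover st rL lL hx.
  by exists Y => //; move: sY hr1 hl1 er el; clear; lia.
have [hx'|hx'] := leP (l 0 + l 3) (l 1 + l 2); last first.
  by exists X => //; move: sX hx hx' er el; clear; lia.
have [|||Y cY sY] := straight_cover sx.
- by move=> y hy; rewrite F; apply: lL.
- by move=> y hy; rewrite F'; apply: rL.
- by move: hx'; clear; lia.
by exists Y => //; move: sY hr1 hl1 er el; clear; lia.
Qed.

End StripCover.

(** * Existence of the strip for at least 12 interior points *)

Section StripExists.
Variables (R : realType) (D0 : {fset {fset lat}}) (c : lat -> R).
Variables (I L : {fset lat}) (D : {fset {fset lat}}).
Hypothesis cf : config D0 c I L D.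

Section Count.
Variable pt : int -> int -> lat.
Hypothesis fr : frame pt.
Hypothesis rows : forall x y, pt x y \in I -> 0 <= y <= 3.

Lemma row_list (y w : int) : 0 <= w ->
  (forall x x' : int, pt x y \in I -> pt x' y \in I -> x' - x < w) ->
  exists2 B : seq lat, (size B)%:Z <= w & forall x, pt x y \in I -> pt x y \in B.
Proof.
move=> w0 hw; have [emp|[s [e [se hse]]]] := row_extents_I cf fr y.
  by exists [::] => // x; rewrite (negbTE (emp x)).
exists [seq pt x y | x <- irange s e].
  have he := hw s e ltac:(by apply/hse; rewrite lexx se) ltac:(by apply/hse; rewrite lexx se).
  by rewrite size_map; have := size_irange s e; move: he se; clear; lia.
by move=> x /hse hx; apply: (map_f (fun x => pt x y)); rewrite mem_irange.
Qed.

Lemma card_rows (w0 w1 w2 w3 : int) : 0 <= w0 -> 0 <= w1 -> 0 <= w2 -> 0 <= w3 ->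
  (forall x x' : int, pt x 0 \in I -> pt x' 0 \in I -> x' - x < w0) ->
  (forall x x' : int, pt x 1 \in I -> pt x' 1 \in I -> x' - x < w1) ->
  (forall x x' : int, pt x 2 \in I -> pt x' 2 \in I -> x' - x < w2) ->
  (forall x x' : int, pt x 3 \in I -> pt x' 3 \in I -> x' - x < w3) ->
  (#|` I|)%:Z <= w0 + w1 + w2 + w3.
Proof.
move=> p0 p1 p2 p3 h0 h1 h2 h3.
have [B0 s0 b0] := row_list p0 h0; have [B1 s1 b1] := row_list p1 h1.
have [B2 s2 b2] := row_list p2 h2; have [B3 s3 b3] := row_list p3 h3.
have : (#|` I| <= size (B0 ++ B1 ++ B2 ++ B3))%N.
  apply: uniq_leq_size (fset_uniq I) _ => z zI.
  have [X [Y XY]] := frame_inv fr; rewrite -(XY z) in zI *.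
  move: (X z) (Y z) zI => x y zI; have hy := rows zI; rewrite !mem_cat.
  have : y = 0 \/ y = 1 \/ y = 2 \/ y = 3 by move: hy; clear; lia.
  case=> [ey|[ey|[ey|ey]]]; rewrite ey in zI *.
  - by rewrite b0.
  - by rewrite b1 ?orbT.
  - by rewrite b2 ?orbT.
  - by rewrite b3 ?orbT.
by rewrite !size_cat; move: s0 s1 s2 s3; clear; lia.
Qed.

Lemma multiple_between (M A B : int) : 0 < M -> A + M - 1 <= B ->
  exists j : int, A <= j * M <= B.
Proof.
move=> M0 h; exists (B %/ M)%Z.
have := divz_eq B M; have := modz_ge0 B (lt0r_neq0 M0); have := ltz_pmod B M0.
by move: h; clear; lia.
Qed.

(* Seen from a lattice point at height [- m <= -2], the row [y = -1] has no
   interior lattice point, so the row at height [k] has at most [k + 1] of them. *)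
Lemma low_row_width (x0 m x1 x2 k : int) : 2 <= m -> pt x0 (- m) \in L -> 0 <= k ->
  pt x1 k \in I -> pt x2 k \in I -> x2 - x1 < k + 1.
Proof.
move=> m2 pL k0 h1 h2; rewrite ltNge; apply/negP => le.
(* The segments from [pt x0 (- m)] to the two points cross the row -1 at [x0 + A / (m + k)] and
   [x0 + B / (m + k)]. A multiple of [m + k] between [A] and [B] gives a lattice point there. *)
set A := (m - 1) * (x1 - x0); set B := (m - 1) * (x2 - x0).
have BA : (m - 1) * (k + 1) <= B - A.
  rewrite (_ : B - A = (m - 1) * (x2 - x1)); last by rewrite /A /B; ring.
  by rewrite ler_pM2l //; move: m2; clear; lia.
have mk : 0 <= (m - 2) * k by rewrite mulr_ge0 //; move: m2; clear; lia.
have M0 : 0 < m + k by move: m2 k0; clear; lia.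
have AB : A < B by move: BA mk m2 k0; clear; lia.
have [|j /andP[j1 j2]] := @multiple_between (m + k) A B M0.
  by move: BA mk; clear; lia.
(* A positive weight on an interior point is needed; if the multiple equals [B], the weight of
   [pt x1 k] vanishes and [pt x2 k] takes over. *)
have bad : pt (x0 + j) (-1) \in I by
  have [e|n] := eqVneq (B - j * (m + k)) 0;
  [ apply: (config_mix cf fr h2 (cf_int cf h1) pL (k := (m - 1) * (j * (m + k) - A))
      (m := (m - 1) * (B - j * (m + k))) (n := (B - A) * (k + 1)));
    [ apply: mulr_gt0; [by move: m2; clear; lia | by move: e AB; clear; lia]
    | by rewrite e mulr0
    | by apply: mulr_ge0; [by move: AB; clear; lia | by move: k0; clear; lia]
    | by rewrite /A /B; ring
    | by rewrite /A /B; ring ]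
  | apply: (config_mix cf fr h1 (cf_int cf h2) pL (k := (m - 1) * (B - j * (m + k)))
      (m := (m - 1) * (j * (m + k) - A)) (n := (B - A) * (k + 1)));
    [ apply: mulr_gt0; [by move: m2; clear; lia | by move: n j2; clear; lia]
    | by apply: mulr_ge0; [by move: m2; clear; lia | by move: j1; clear; lia]
    | by apply: mulr_ge0; [by move: AB; clear; lia | by move: k0; clear; lia]
    | by rewrite /A /B; ring
    | by rewrite /A /B; ring ] ].
by have := rows bad.
Qed.

Lemma low_rows : (12 <= #|` I|)%N -> forall x y, pt x y \in L -> -1 <= y.
Proof.
move=> g12 x y h; rewrite leNgt; apply/negP => hy.
have m2 : 2 <= - y by move: hy; clear; lia.
rewrite -(opprK y) in h.
have w := low_row_width m2 h.
have : (#|` I|)%:Z <= 1 + 2 + 3 + 4.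
  by apply: card_rows => // a b ha hb; apply: (w a b _ _ ha hb).
by move: g12; clear; lia.
Qed.

(** Among three consecutive interior points of row 0 or row 3, one yields a lattice point of row 1
    on the segment to the opposite row, by residues modulo 3; row 2 is treated by parity with row 0.
    An empty row 1 leaves at most 2 + 0 + 1 + 2 points. *)
Lemma row1_nonempty : (12 <= #|` I|)%N -> (exists x, pt x 0 \in I) ->
  (exists x, pt x 3 \in I) -> exists x, pt x 1 \in I.
Proof.
move=> g12 [x0 h0] [x3 h3]; apply: contrapT => no.
have emp x : pt x 1 \notin I by apply/negP => h; apply: no; exists x.
have conv (y a b z : int) : pt a y \in I -> pt b y \in I -> a <= z <= b -> pt z y \in I.
  move=> ha hb hz; have [e|[s [e [se hse]]]] := row_extents_I cf fr y.
    by rewrite (negbTE (e a)) in ha.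
  by move: ha hb => /hse ha /hse hb; apply/hse; move: ha hb hz; clear; lia.
have bad3 a b m : pt a 0 \in I -> pt b 3 \in I -> 3 * m = 2 * a + b -> False.
  move=> ha hb e; have hbL := cf_int cf hb; case/negP: (emp m).
  apply: (config_mix cf fr ha hbL hbL (k := 2) (m := 1) (n := 0)) => //.
    by rewrite mul0r addr0 addr0 mul1r -e.
have bad2 a b m : pt a 0 \in I -> pt b 2 \in I -> 2 * m = a + b -> False.
  move=> ha hb e; have hbL := cf_int cf hb; case/negP: (emp m).
  apply: (config_mix cf fr ha hbL hbL (k := 1) (m := 1) (n := 0)) => //.
    by rewrite mul0r addr0 addr0 !mul1r -e.
have : (#|` I|)%:Z <= 2 + 0 + 1 + 2.
  apply: card_rows => // a b ha hb.
  - rewrite ltNge; apply/negP => ab; pose v := 2 * a + x3.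
    have hv := divz_eq v 3; have hv0 := modz_ge0 v (isT : (3 : int) != 0).
    have hv1 := @ltz_pmod v 3 isT.
    have : (v %% 3)%Z = 0 \/ (v %% 3)%Z = 1 \/ (v %% 3)%Z = 2 by move: hv0 hv1; clear; lia.
    case=> [e|[e|e]].
    + by apply: (bad3 a x3 (v %/ 3)%Z) => //; move: hv e; rewrite /v; clear; lia.
    + apply: (bad3 (a + 1) x3 ((v %/ 3)%Z + 1)) => //; last by move: hv e; rewrite /v; clear; lia.
      by apply: conv ha hb _; move: ab; clear; lia.
    + apply: (bad3 (a + 2) x3 ((v %/ 3)%Z + 2)) => //; last by move: hv e; rewrite /v; clear; lia.
      by apply: conv ha hb _; move: ab; clear; lia.
  - by rewrite (negbTE (emp a)) in ha.
  - rewrite ltNge; apply/negP => ab; pose v := x0 + a.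
    have hv := divz_eq v 2; have hv0 := modz_ge0 v (isT : (2 : int) != 0).
    have hv1 := @ltz_pmod v 2 isT.
    have : (v %% 2)%Z = 0 \/ (v %% 2)%Z = 1 by move: hv0 hv1; clear; lia.
    case=> [e|e].
    + by apply: (bad2 x0 a (v %/ 2)%Z) => //; move: hv e; rewrite /v; clear; lia.
    + apply: (bad2 x0 (a + 1) ((v %/ 2)%Z + 1)) => //; last by move: hv e; rewrite /v; clear; lia.
      by apply: conv ha hb _; move: ab; clear; lia.
  - rewrite ltNge; apply/negP => ab; pose v := 2 * x0 + a.
    have hv := divz_eq v 3; have hv0 := modz_ge0 v (isT : (3 : int) != 0).
    have hv1 := @ltz_pmod v 3 isT.
    have : (v %% 3)%Z = 0 \/ (v %% 3)%Z = 1 \/ (v %% 3)%Z = 2 by move: hv0 hv1; clear; lia.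
    case=> [e|[e|e]].
    + by apply: (bad3 x0 a (v %/ 3)%Z) => //; move: hv e; rewrite /v; clear; lia.
    + apply: (bad3 x0 (a + 2) ((v %/ 3)%Z + 1)) => //; last by move: hv e; rewrite /v; clear; lia.
      by apply: conv ha hb _; move: ab; clear; lia.
    + apply: (bad3 x0 (a + 1) ((v %/ 3)%Z + 1)) => //; last by move: hv e; rewrite /v; clear; lia.
      by apply: conv ha hb _; move: ab; clear; lia.
by move: g12; clear; lia.
Qed.

End Count.

Lemma frame_flipy pt : frame pt -> frame (fun x y => pt x (3 - y)).
Proof.
move=> fr; apply: (frame_ext _ (frame_comp 0 3 fr (_ : `|1 * (-1) - 0 * 0| = 1))) => // x y.
by rewrite /= !mul0r mul1r mulN1r !addr0 add0r addrC.
Qed.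

Lemma strip_exists pt : frame pt -> (forall x y, pt x y \in I -> 0 <= y <= 3) ->
  (exists x, pt x 0 \in I) -> (exists x, pt x 3 \in I) -> (12 <= #|` I|)%N ->
  exists l r, strip I L pt l r.
Proof.
move=> fr rows h0 h3 g12; have fr' := frame_flipy fr.
have rows' x y : pt x (3 - y) \in I -> 0 <= y <= 3 by move/rows; clear; lia.
have h1 := row1_nonempty fr rows g12 h0 h3.
have h2 := row1_nonempty fr' rows' g12 h3 h0.
have ex (y : int) : exists p : int * int, 0 <= y <= 3 -> p.1 <= p.2 /\
    forall x, pt x y \in I <-> p.1 <= x <= p.2.
  have [emp|[s [e [se hse]]]] := row_extents_I cf fr y; last by exists (s, e).
  exists (0, 0) => hy; exfalso.
  have : y = 0 \/ y = 1 \/ y = 2 \/ y = 3 by move: hy; clear; lia.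
  case=> [ey|[ey|[ey|ey]]]; rewrite ey in emp.
  - by case: h0 => x; apply/negP.
  - by case: h1 => x; apply/negP.
  - by case: h2 => x; apply/negP.
  - by case: h3 => x; apply/negP.
have [p hp] := choice ex; exists (fun y => (p y).1), (fun y => (p y).2); split=> //.
- move=> x y; split=> [h|/andP[hy hx]]; last by apply/(proj2 (hp y hy)).
  have hy := rows _ _ h; rewrite hy; exact/(proj2 (hp y hy)).
- by move=> y /hp[].
- move=> x y h; rewrite (low_rows fr rows g12 h) /=.
  have h' : pt x (3 - (3 - y)) \in L by rewrite opprB addrC subrK.
  by have := low_rows fr' rows' g12 h'; clear; lia.
- move=> x y hy h; have [lr hx] := hp y hy.
  have rI : pt (p y).2 y \in I by apply/hx; rewrite lexx lr.
  have lI : pt (p y).1 y \in I by apply/hx; rewrite lexx lr.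
  apply/andP; split; rewrite leNgt; apply/negP => lt.
    have : pt ((p y).1 - 1) y \in I.
      apply: (config_mix cf fr lI h h (k := (p y).1 - 1 - x) (m := 1) (n := 0)) => //.
      + by rewrite subr_gt0.
      + by ring.
      + by ring.
    by move/hx; clear; lia.
  have : pt ((p y).2 + 1) y \in I.
    apply: (config_mix cf fr rI h h (k := x - ((p y).2 + 1)) (m := 1) (n := 0)) => //.
    + by rewrite subr_gt0.
    + by ring.
    + by ring.
  by move/hx; clear; lia.
Qed.

End StripExists.

(** The spanning family consists of the cover [X] and all interior points but three affinely
    independent ones, and 2|X| <= g + 18 gives g + 18 + 2(g - 3). *)
Lemma moduli_dim_le (R : realType) (P : set 'cV[R]_2) (D0 D : {fset {fset lat}})
    (c : lat -> R) (I L : {fset lat}) pt (n : nat) :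
  finite_set (lattice_points P) -> regtri c (fset_set (lattice_points P)) D0 ->
  config D0 c I L D -> no_ears I L D ->
  (L `<=` fset_set (lattice_points P))%fset ->
  frame pt -> (forall x y, pt x y \in I -> 0 <= y <= 3) ->
  (exists x, pt x 0 \in I) -> (exists x, pt x 3 \in I) -> (12 <= #|` I|)%N ->
  cone_dim (@moduli_cone R P D0) n -> (2 * n <= 3 * #|` I| + 12)%N.
Proof.
move=> finP rt0 cf ne sub fr rows h0 h3 g12 cd.
have [l [r st]] := strip_exists cf fr rows h0 h3 g12.
have [X cX sX] := strip_cover_bound rt0 cf ne st.
have memI (y : int) : y \in rows4 -> forall x, x \in irange (l y) (r y) -> pt x y \in I.
  by rewrite rows4P => hy x; rewrite mem_irange => hx; apply/(st_int st); rewrite hy.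
have sizeI : (r 0 - l 0 + 1) + (r 1 - l 1 + 1) + (r 2 - l 2 + 1) + (r 3 - l 3 + 1)
    <= (#|` I|)%:Z.
  pose row (y : int) := [seq pt x y | x <- irange (l y) (r y)].
  have un (y : int) : uniq (row y).
    by rewrite map_inj_uniq ?irange_uniq // => a b /(frame_inj fr)[].
  have dis (y y' : int) : y != y' -> ~~ has (mem (row y)) (row y').
    move=> yy; apply/hasPn => z /mapP[a _ ->]; apply/negP => /mapP[b _ /(frame_inj fr)[_ e]].
    by rewrite e eqxx in yy.
  have u4 : uniq (row 0 ++ row 1 ++ row 2 ++ row 3).
    rewrite !cat_uniq !un !has_cat !negb_or /= !andbT.
    by rewrite !dis.
  have : (size (row 0 ++ row 1 ++ row 2 ++ row 3) <= #|` I|)%N.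
    apply: (uniq_leq_size u4) => z; rewrite !mem_cat => /or4P[] /mapP[x hx ->];
    by apply: memI hx; rewrite rows4P.
  have s4 (y : int) : 0 <= y <= 3 -> (size (row y))%:Z = r y - l y + 1.
    by move=> /(st_lr st) lr; rewrite size_map size_irange; move: lr; clear; lia.
  by rewrite !size_cat -lez_nat !PoszD !s4 // !addrA.
(* More than four interior points in four rows: some row has two, which together with a point of
   another row are affinely independent. *)
have [y [y' [hy hy' yy' lr]]] : exists y y' : int,
    [/\ 0 <= y <= 3, 0 <= y' <= 3, y != y' & l y < r y].
  apply: contrapT => no.
  have small (y : int) : 0 <= y <= 3 -> r y <= l y.
    move=> hy; rewrite leNgt; apply/negP => lt; apply: no.
    have [e|ny] := eqVneq y 0; first by exists y, 1; rewrite hy lt e.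
    by exists y, 0; rewrite hy lt.
  have : (#|` I|)%:Z <= 1 + 1 + 1 + 1.
    apply: (card_rows cf fr rows) => // a b.
    - by move=> /(st_int st)/andP[/small + +] /(st_int st)/andP[_]; clear; lia.
    - by move=> /(st_int st)/andP[/small + +] /(st_int st)/andP[_]; clear; lia.
    - by move=> /(st_int st)/andP[/small + +] /(st_int st)/andP[_]; clear; lia.
    - by move=> /(st_int st)/andP[/small + +] /(st_int st)/andP[_]; clear; lia.
  by move: g12; clear; lia.
pose z1 := pt (l y) y; pose z2 := pt (l y + 1) y; pose z3 := pt (l y') y'.
have i1 : z1 \in I by apply/(st_int st); rewrite hy lexx ltW.
have i2 : z2 \in I by apply/(st_int st); rewrite hy; move: lr; clear; lia.
have i3 : z3 \in I by apply/(st_int st); rewrite hy' lexx (st_lr st hy').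
have [d d1 dE] := frame_area fr.
have a0 : area2 z1 z2 z3 != 0.
  rewrite dE -normr_eq0 normrM d1 mul1r normr_eq0.
  by move: yy'; clear; lia.
have inL0 z : z \in I -> z \in fset_set (lattice_points P).
  by move=> /(cf_int cf)/(fsubsetP sub).
pose T := [fset z1; z2; z3]%fset.
pose S := X ++ [seq z <- I | z \notin T].
have cT : (size [seq z <- I | z \notin T] + 3 = #|` I|)%N.
  have [n12 n13 n23] := area2_neq a0.
  have <- : #|` T| = 3%N.
    by rewrite /T fsetUC cardfsU1 cardfs2 !inE negb_or n12 !(eq_sym z3) n13 n23.
  have -> : #|` T| = count (mem T) I.
    rewrite -size_filter; apply/eqP; rewrite -uniq_size_uniq ?fset_uniq //.
      by rewrite filter_uniq // fset_uniq.
    move=> z; rewrite mem_filter; apply/andP/idP => [[]//|zT]; split=> //.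
    by move: zT; rewrite /= fset3P => /or3P[] /eqP->.
  by rewrite size_filter addnC; apply: count_predC.
have : (n <= size S)%N.
  apply: (cone_dim_le finP rt0 cd a0 (inL0 _ i1) (inL0 _ i2) (inL0 _ i3)) => z zL zT.
  have [zL'|zL'] := boolP (z \in L); last by rewrite (skel_vec_out rt0 cf zL') mem0v.
  have [zI|zI] := boolP (z \in I).
    by apply: memv_span; apply: map_f; rewrite mem_cat mem_filter zT zI orbT.
  have := cX z zL' zI; apply: subvP; rewrite /S map_cat span_cat; exact: addvSl.
have {}sX : 2 * (size X)%:Z <= (#|` I|)%:Z + 18.
  by apply: le_trans sX _; rewrite lerD2r.
have : (size S + 3 = size X + #|` I|)%N by rewrite size_cat -addnA cT.
by move: sX; move: #|` I| (size S) (size X); clear; lia.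
Qed.

(** * The upper bound for polygons *)

Section Hulls.
Variable R : realType.
Local Notation plane := 'cV[R]_2.
Implicit Types (X P : set plane) (x y : plane).

Lemma px_comb (a b : R) x y : px (a *: x + b *: y) = a * px x + b * px y.
Proof. by rewrite !mxE. Qed.

Lemma py_comb (a b : R) x y : py (a *: x + b *: y) = a * py x + b * py y.
Proof. by rewrite !mxE. Qed.

Lemma px_emb (v : lat) : px (emb R v) = (px v)%:~R. Proof. by rewrite mxE. Qed.
Lemma py_emb (v : lat) : py (emb R v) = (py v)%:~R. Proof. by rewrite mxE. Qed.

Lemma sub_conv_hull X x : X x -> conv_hull X x.
Proof.
move=> Xx; exists 1%N, (fun=> x), (fun=> 1).
by split=> //; rewrite big_ord_recl big_ord0 ?addr0 // scale1r.
Qed.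

Lemma conv_hull_convex X x y (a b : R) : conv_hull X x -> conv_hull X y ->
  0 <= a -> 0 <= b -> a + b = 1 -> conv_hull X (a *: x + b *: y).
Proof.
move=> [n [p [t [Xp t0 t1 ->]]]] [m [q [s [Xq s0 s1 ->]]]] a0 b0 ab.
exists (n + m)%N.
exists (fun i => match fintype.split i with inl j => p j | inr j => q j end).
exists (fun i => match fintype.split i with inl j => a * t j | inr j => b * s j end).
have El (j : 'I_n) : fintype.split (lshift m j) = inl j.
  by rewrite (_ : lshift m j = unsplit (inl j)) // unsplitK.
have Er (j : 'I_m) : fintype.split (rshift n j) = inr j.
  by rewrite (_ : rshift n j = unsplit (inr j)) // unsplitK.
split.
- by move=> i; case: (fintype.split i).
- by move=> i; case: (fintype.split i) => j; apply: mulr_ge0.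
- rewrite big_split_ord /=; under eq_bigr do rewrite El.
  under [X in _ + X]eq_bigr do rewrite Er.
  by rewrite -!mulr_sumr t1 s1 !mulr1.
- rewrite big_split_ord /=; under [X in _ = X + _]eq_bigr do rewrite El -scalerA.
  under [X in _ = _ + X]eq_bigr do rewrite Er -scalerA.
  by rewrite !scaler_sumr.
Qed.

Lemma conv_hull_affine X (a b d : R) x : (forall y, X y -> 0 <= a + b * px y + d * py y) ->
  conv_hull X x -> 0 <= a + b * px x + d * py x.
Proof.
move=> h [n [p [t [Xp t0 t1 ->]]]].
rewrite !summxE !mulr_sumr -[a]mulr1 -t1 mulr_sumr -!big_split /=.
apply: sumr_ge0 => i _; have := h _ (Xp i); have := t0 i; rewrite !mxE => ti hi.
rewrite (_ : _ + _ = t i * (a + b * px (p i) + d * py (p i))); last by ring.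
exact: mulr_ge0.
Qed.

Lemma interior_box P x : interior P x <->
  exists2 e : R, 0 < e & forall y, `|px y - px x| < e -> `|py y - py x| < e -> P y.
Proof.
split.
  move=> /nbhs_ballP[e /= e0 h]; exists e => // y hx hy; apply: h; split=> // i j.
  rewrite (ord1 j) /ball /= distrC; case: (unliftP 0 i) => [k ->|-> //].
  by rewrite (ord1 k) (_ : lift 0 0 = 1) //; apply/val_inj.
move=> [e e0 h]; apply/nbhs_ballP; exists e => //= y [_ hy]; apply: h.
  by rewrite distrC; apply: hy.
by rewrite distrC; apply: hy.
Qed.

Lemma interior_sub P x : interior P x -> P x.
Proof.
by move=> /interior_box[e e0]; apply; rewrite subrr normr0.
Qed.

(** A point near [a v + b w] is the image of a point near [v] under the homothety of ratio [a] that
    fixes [w] direction by direction, [x |-> a x + b w]. *)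
Lemma interior_mix P v w (a b : R) :
  (forall x y (a b : R), P x -> P y -> 0 <= a -> 0 <= b -> a + b = 1 -> P (a *: x + b *: y)) ->
  interior P v -> P w -> 0 < a -> 0 <= b -> a + b = 1 -> interior P (a *: v + b *: w).
Proof.
move=> cv /interior_box[e e0 h] Pw a0 b0 ab; apply/interior_box.
exists (a * e); first exact: mulr_gt0.
move=> y hx hy; have an : a != 0 by rewrite gt_eqF.
have -> : y = a *: (a^-1 *: (y - b *: w)) + b *: w.
  by rewrite scalerA mulfV // scale1r subrK.
apply: cv => //; last exact: ltW.
apply: h.
  move: hx; rewrite px_comb !mxE => hx.
  rewrite (_ : _ - _ = a^-1 * (px y - (a * px v + b * px w))); last by field.
  by rewrite normrM normfV (gtr0_norm a0) ltr_pdivrMl.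
move: hy; rewrite py_comb !mxE => hy.
rewrite (_ : _ - _ = a^-1 * (py y - (a * py v + b * py w))); last by field.
by rewrite normrM normfV (gtr0_norm a0) ltr_pdivrMl.
Qed.

Lemma lattice_points_finite P : lattice_polygon P -> finite_set (lattice_points P).
Proof.
move=> [S S0 ->].
have [M hM] : exists M : nat, forall z, z \in S -> (`|px z| <= M)%N /\ (`|py z| <= M)%N.
  exists (\sum_(z <- S) (`|px z| + `|py z|))%N => z zS.
  by rewrite (big_rem z) //=; split; lia.
pose B := [fset mkpt (x : int) (y : int) | x in irange (- M%:Z) M%:Z, y in irange (- M%:Z) M%:Z]%fset.
apply: (finite_subfset B) => v /= hv.
have bd (a b : R) : (forall z, z \in S -> 0 <= M%:R + a * (px z)%:~R + b * (py z)%:~R) ->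
    0 <= M%:R + a * (px v)%:~R + b * (py v)%:~R.
  move=> h; rewrite -px_emb -py_emb; apply: conv_hull_affine hv => y [z zS <-].
  by rewrite px_emb py_emb; apply: h.
have MR (k : int) : (`|k| <= M)%N -> - M%:R <= k%:~R :> R /\ k%:~R <= M%:R :> R.
  by move=> kM; rewrite (pmulrn (1 : R) M) -rmorphN /= !ler_int; move: kM; clear; lia.
have h1 := bd 1 0 ltac:(by move=> z /hM[/MR[? ?] _]; lra).
have h2 := bd (-1) 0 ltac:(by move=> z /hM[/MR[? ?] _]; lra).
have h3 := bd 0 1 ltac:(by move=> z /hM[_ /MR[? ?]]; lra).
have h4 := bd 0 (-1) ltac:(by move=> z /hM[_ /MR[? ?]]; lra).
have toZ (k : int) : 0 <= M%:R + k%:~R :> R -> 0 <= M%:R - k%:~R :> R -> - M%:Z <= k <= M%:Z.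
  by rewrite (pmulrn (1 : R) M) -rmorphD -rmorphB /= !ler0z; clear; lia.
apply/imfset2P; exists (px v); first by rewrite mem_irange; apply: toZ; lra.
exists (py v); first by rewrite mem_irange; apply: toZ; lra.
by apply: lat_eq; rewrite ?px_mkpt ?py_mkpt.
Qed.

Section Config.
Variables (P : set plane) (D : {fset {fset lat}}) (c : lat -> R).
Hypotheses (polP : lattice_polygon P).
Let L := fset_set (lattice_points P).
Let I := fset_set (interior_lattice_points P).
Let finP := lattice_points_finite polP.

Lemma interior_points_finite : finite_set (interior_lattice_points P).
Proof. by apply: sub_finite_set finP => v; apply: interior_sub. Qed.

Lemma mem_interior_points z : z \in I <-> interior P (emb R z).
Proof.
rewrite in_fset_set; last exact: interior_points_finite.
by split=> [/set_mem|/mem_set].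
Qed.

Let cvP x y (a b : R) : P x -> P y -> 0 <= a -> 0 <= b -> a + b = 1 -> P (a *: x + b *: y).
Proof. by have [S _ ->] := polP; apply: conv_hull_convex. Qed.

Lemma polygon_config : regtri c L D -> config D c I L D.
Proof.
move=> rt; split=> //.
- by move=> e T _; rewrite starP => /andP[].
- by move=> z /mem_interior_points/interior_sub h; apply/(mem_latpts finP).
- move=> p q z m n /(mem_latpts finP) hp /(mem_latpts finP) hq m0 n0 hx hy.
  apply/(mem_latpts finP); rewrite /lattice_points /=.
  have N0 : 0 < m + n by rewrite addr_gt0.
  have NR : (m + n)%:~R != 0 :> R by rewrite intr_eq0 gt_eqF.
  have -> : emb R z = (m%:~R / (m + n)%:~R) *: emb R p + (n%:~R / (m + n)%:~R) *: emb R q.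
    apply: plane_eq; rewrite ?px_comb ?py_comb !(px_emb, py_emb); apply: (mulfI NR);
    rewrite -rmorphM ?hx ?hy rmorphD !rmorphM /=; field;
    by rewrite -rmorphD intr_eq0 gt_eqF.
  apply: cvP => //; try by rewrite divr_ge0 // ler0z ltW.
  by rewrite -mulrDl -rmorphD mulfV.
- move=> v p q z k m n /mem_interior_points hv /(mem_latpts finP) hp /(mem_latpts finP) hq k0 m0 n0 hx hy.
  apply/mem_interior_points.
  have NR : (k + m + n)%:~R != 0 :> R.
    by rewrite intr_eq0 gt_eqF //; move: k0 m0 n0; clear; lia.
  have [mn0|mn0] := eqVneq (m + n) 0.
    have [em en] : m = 0 /\ n = 0 by move: mn0 m0 n0; clear; lia.
    suff -> : z = v by [].
    rewrite em en !addr0 !mul0r !addr0 in hx hy.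
    have kn : k != 0 by rewrite gt_eqF.
    by apply: lat_eq; apply: (mulfI kn).
  have mnR : (m + n)%:~R != 0 :> R by rewrite intr_eq0.
  have -> : emb R z = (k%:~R / (k + m + n)%:~R) *: emb R v + ((m + n)%:~R / (k + m + n)%:~R) *:
      ((m%:~R / (m + n)%:~R) *: emb R p + (n%:~R / (m + n)%:~R) *: emb R q).
    apply: plane_eq; rewrite ?px_comb ?py_comb !(px_emb, py_emb); apply: (mulfI NR);
    rewrite -rmorphM ?hx ?hy !rmorphD !rmorphM /=; field;
    by rewrite -!rmorphD !intr_eq0; rewrite !intr_eq0 in NR mnR; rewrite NR mnR.
  apply: interior_mix => //.
  - apply: cvP => //; try (rewrite divr_ge0 // ler0z; move: m0 n0; clear; lia).
    by rewrite -mulrDl -rmorphD mulfV.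
  - by rewrite divr_gt0 // ltr0z //; move: k0 m0 n0; clear; lia.
  - by rewrite divr_ge0 // ler0z; move: k0 m0 n0; clear; lia.
  - by rewrite -mulrDl -rmorphD addrA mulfV.
Qed.

End Config.

Lemma affine_map_y A b x : py (affine_map A b x) =
  (A 1 0)%:~R * px x + (A 1 1)%:~R * py x + (py b)%:~R.
Proof.
rewrite /affine_map /emb !mxE !big_ord_recl big_ord0 !mxE addr0.
by have -> : lift ord0 ord0 = 1 :> 'I_2 by apply/val_inj.
Qed.

Lemma unitmx_det2 (A : 'M[int]_2) : A \in unitmx ->
  `|A 0 0 * A 1 1 - A 0 1 * A 1 0| = 1.
Proof.
move=> uA; have e i j := congr1 (fun M : 'M[int]_2 => M i j) (mulmxV uA).
have E i j : A i 0 * invmx A 0 j + A i 1 * invmx A 1 j = (i == j)%:R.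
  have := e i j; rewrite /= !mxE !big_ord_recl big_ord0 addr0.
  by have -> : lift ord0 ord0 = 1 :> 'I_2 by apply/val_inj.
have : (A 0 0 * A 1 1 - A 0 1 * A 1 0) *
    (invmx A 0 0 * invmx A 1 1 - invmx A 0 1 * invmx A 1 0) = 1.
  transitivity ((A 0 0 * invmx A 0 0 + A 0 1 * invmx A 1 0) *
      (A 1 0 * invmx A 0 1 + A 1 1 * invmx A 1 1) -
      (A 0 0 * invmx A 0 1 + A 0 1 * invmx A 1 1) *
      (A 1 0 * invmx A 0 0 + A 1 1 * invmx A 1 0)); first by ring.
  by rewrite !E.
by case/mulz_eq1 => ->.
Qed.

(** The inverse of the map [x |-> A x + b] as a frame, so that its second coordinate is the height
    in the strip. *)
Lemma frame_of_unitmx (A : 'M[int]_2) (b : lat) : A \in unitmx ->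
  exists2 pt, frame pt & forall x y : int,
    A 1 0 * px (pt x y) + A 1 1 * py (pt x y) + py b = y.
Proof.
move=> /unitmx_det2; set d := _ - _ => d1.
have d2 : d * d = 1 by move: (d) d1; clear; nia.
pose pt (x y : int) := mkpt (d * ((x - px b) * A 1 1 - (y - py b) * A 0 1))
  (d * ((y - py b) * A 0 0 - (x - px b) * A 1 0)).
exists pt; last first.
  move=> x y; rewrite px_mkpt py_mkpt; transitivity (d * d * (y - py b) + py b).
    by rewrite {4}/d; ring.
  by rewrite d2 mul1r subrK.
exists (pt 0 0), (mkpt (d * A 1 1) (- d * A 1 0)), (mkpt (- d * A 0 1) (d * A 0 0)).
split.
  rewrite !px_mkpt !py_mkpt (_ : _ - _ = d * d * d); last by rewrite {7}/d; ring.
  by rewrite d2 mul1r.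
by move=> x y; rewrite !px_mkpt !py_mkpt; split; ring.
Qed.

Lemma moduli_dim_bound (P : set plane) (D : {fset {fset lat}}) (g n : nat) :
  (12 <= g)%N -> lattice_polygon P -> genus P = g -> egon P = 5 ->
  regular_unimodular P D -> cone_dim (@moduli_cone R P D) n -> (2 * n <= 3 * g + 12)%N.
Proof.
move=> g12 polP gP eP [c ind] cd; rewrite -gP /genus.
have finP := lattice_points_finite polP.
have rt := regtri_of_induces finP ind.
have cf := polygon_config polP rt.
have [L [D' [cf' ne sub]]] := config_reduce rt cf.
move: eP; rewrite /egon; case: pselect => //= _ eP.
have : lattice_width (interior_polygon P) = 3 by apply: (addIr 2).
rewrite /lattice_width; case: pselect => //= nQ.
case: xgetP => [s _ [[A [b [uA hA]]] mins] es|_ e0]; last by move: e0; clear; lia.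
have [es3] : Posz s = Posz 3 := es.
rewrite es3 in hA mins.
have [pt fr ptE] := frame_of_unitmx b uA.
have memI z : z \in fset_set (interior_lattice_points P) -> interior_polygon P (emb R z).
  by move=> /(mem_interior_points polP) h; apply: sub_conv_hull; exists z.
have yE (v : lat) : py (affine_map A b (emb R v)) = (A 1 0 * px v + A 1 1 * py v + py b)%:~R.
  by rewrite affine_map_y px_emb py_emb !rmorphD !rmorphM.
have rows (x y : int) : pt x y \in fset_set (interior_lattice_points P) -> 0 <= y <= 3.
  move=> /memI h; have : (affine_map A b @` interior_polygon P) (affine_map A b (emb R (pt x y))).
    by exists (emb R (pt x y)).
  by move=> /hA /=; rewrite yE ptE ler0z -(ler_int R).
have [X [Y XY]] := frame_inv fr.
(* If the row 0 or the row 3 had no interior point, the others would fit, after a translation, into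
   a strip of height 2, against the minimality of the width. *)
have strip2 (b' : lat) : (forall x y : int, pt x y \in fset_set (interior_lattice_points P) ->
     0 <= y + py b' - py b <= 2) -> in_strip (interior_polygon P) 2.
  move=> h; exists A, b'; split=> // _ [x hx <-] /=; rewrite affine_map_y.
  have hy (z : lat) : interior_lattice_points P z ->
      0 <= A 1 0 * px z + A 1 1 * py z + py b' <= 2.
    move=> hz; have zI : z \in fset_set (interior_lattice_points P).
      by apply/(mem_interior_points polP).
    have [u [w ez]] : exists u w : int, z = pt u w by exists (X z), (Y z).
    rewrite ez in zI *; have := h _ _ zI; have e := ptE u w.
    suff -> : A 1 0 * px (pt u w) + A 1 1 * py (pt u w) + py b' = w + py b' - py b by [].
    by rewrite -[X in _ = X + _ - _]e; ring.
  have lo : 0 <= (py b')%:~R + (A 1 0)%:~R * px x + (A 1 1)%:~R * py x.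
    apply: conv_hull_affine hx => _ [z /hy/andP[h1 _] <-].
    by rewrite px_emb py_emb -!rmorphM -!rmorphD ler0z; move: h1; clear; lia.
  have hi : 0 <= (2 - py b')%:~R + (- A 1 0)%:~R * px x + (- A 1 1)%:~R * py x.
    apply: conv_hull_affine hx => _ [z /hy/andP[_ h2] <-].
    by rewrite px_emb py_emb -!rmorphM -!rmorphD ler0z; move: h2; clear; lia.
  by move: lo hi; rewrite !(rmorphB, rmorphN) /=; clear; lra.
have no2 : ~ in_strip (interior_polygon P) 2 by move=> /mins.
apply: (moduli_dim_le finP rt cf' ne sub fr rows _ _ _ cd).
- apply: contrapT => no; apply/no2/(strip2 (b - mkpt 0 1)) => x y h.
  have := rows _ _ h; rewrite !mxE /=; suff : y != 0 by clear; lia.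
  by apply/eqP => y0; apply: no; exists x; rewrite -y0.
- apply: contrapT => no; apply/no2/(strip2 b) => x y h.
  have := rows _ _ h; rewrite addrK; suff : y != 3 by clear; lia.
  by apply/eqP => y0; apply: no; exists x; rewrite -y0.
- by move: g12; rewrite -gP.
Qed.

End Hulls.

(** * The hexagons *)

Lemma pt_eta (z : lat) : mkpt (px z) (py z) = z.
Proof. by apply: lat_eq; rewrite ?px_mkpt ?py_mkpt. Qed.

Lemma mkpt_eq a b a' b' : (mkpt a b == mkpt a' b') = (a == a') && (b == b').
Proof.
apply/eqP/andP => [e|[/eqP-> /eqP->]//].
by rewrite -(px_mkpt a b) -{2}(py_mkpt a b) e px_mkpt py_mkpt.
Qed.

Section Hexagon.
Variables M i j : int.

(** All six sides run along edges of the standard triangulation, so the hexagon is a union of its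
    triangles. The parameters [j] and [i] control how much is cut off at [(0, 0)] and at
    [(M, 5)]. *)
Definition hexb (x y : int) : bool :=
  [&& 0 <= x, x <= M, 0 <= y, y <= 5, j <= x + y & x + y <= M + i].

Definition hex : {fset lat} :=
  [fset z in [fset mkpt (x : int) (y : int) | x in irange 0 M, y in irange 0 5]%fset
    | hexb (px z) (py z)]%fset.

Lemma mem_hex (z : lat) : (z \in hex) = hexb (px z) (py z).
Proof.
rewrite !inE /=; case h: (hexb _ _); rewrite ?andbF // andbT.
move: h => /and5P[h1 h2 h3 h4 _].
apply/imfset2P; exists (px z); first by rewrite mem_irange h1 h2.
by exists (py z); rewrite ?mem_irange ?h3 ?h4 ?pt_eta.
Qed.

(* The triangles of the standard triangulation of the lattice, pointing up for
   [s = 1] and down for [s = -1]. *)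
Definition tri (s x y : int) : {fset lat} :=
  [fset mkpt x y; mkpt (x + s)%R y; mkpt x (y + s)%R]%fset.

Definition hexD : {fset {fset lat}} :=
  [fset T in fpowerset hex | `[< exists s x y : int, `|s| = 1 /\ T = tri s x y >]]%fset.

Lemma hexDP T : T \in hexD <-> (T `<=` hex)%fset /\
  exists s x y : int, `|s| = 1 /\ T = tri s x y.
Proof.
by rewrite !inE /= fpowersetE; split=> [/andP[-> /asboolP]|[-> h]] //=; apply/asboolP.
Qed.

Lemma mem_tri s x y (z : lat) : (z \in tri s x y) =
  [|| (px z == x) && (py z == y), (px z == x + s) && (py z == y)
    | (px z == x) && (py z == y + s)].
Proof. by rewrite /tri fset3P -{1 2 3}(pt_eta z) !mkpt_eq. Qed.

Lemma tri_hexD s x y : `|s| = 1 -> hexb x y -> hexb (x + s) y -> hexb x (y + s) ->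
  tri s x y \in hexD.
Proof.
move=> s1 h1 h2 h3; apply/hexDP; split; last by exists s, x, y.
apply/fsubsetP => z; rewrite mem_tri mem_hex.
by case/or3P => /andP[/eqP-> /eqP->].
Qed.

Lemma tri_unimodular s x y : `|s| = 1 -> unimodular_triangle (tri s x y).
Proof.
move=> s1; exists (mkpt x y), (mkpt (x + s) y), (mkpt x (y + s)); split=> //.
by rewrite area2E !px_mkpt !py_mkpt; move: s1; clear; lia.
Qed.

Variable R : realType.

(* Its regular subdivision is the standard triangulation of the lattice. *)
Definition quadratic (z : lat) : R := (px z * px z + px z * py z + py z * py z)%:~R.

Section Perturbed.
Variables (c : lat -> R) (e : R) (w : lat).
Hypotheses (e0 : 0 <= e) (eM : e * (M + 6)%:~R < 1).
Hypothesis cE : forall z, c z = quadratic z + e * delta R w z.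

Lemma delta_bound (z : lat) : 0 <= delta R w z <= 1.
Proof. by rewrite /delta; case: (_ == _); rewrite /= ?lexx ?ler01. Qed.

(** In coordinates [(a, b)] adapted to the triangle, the quadratic function exceeds its
    interpolation by [a^2 + ab + b^2 - a - b], which is at least 1 off the triangle. The
    perturbation changes this gap by less than 1. *)
Lemma hex_support s x y : `|s| = 1 -> tri s x y \in hexD ->
  exists2 f, supports c hex f & contact c hex f = tri s x y.
Proof.
move=> s1 /hexDP[/fsubsetP sub _].
set A := mkpt x y; set B := mkpt (x + s) y; set C := mkpt x (y + s).
have ss : s * s = 1 by move: s1; clear; nia.
have ssR : s%:~R * s%:~R = 1 :> R by rewrite -rmorphM ss.
have AL : A \in hex by apply: sub; rewrite /tri fset3P eqxx.
pose p : R := s%:~R * (c B - c A); pose q : R := s%:~R * (c C - c A).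
pose f : R * R * R := (c A - p * x%:~R - q * y%:~R, p, q).
have fE (z : lat) : af f z = c A + p * (px z - x)%:~R + q * (py z - y)%:~R.
  by rewrite /af /f /= !rmorphB /=; ring.
have gap (z : lat) : z \in hex -> z \notin tri s x y -> af f z < c z.
  move=> zL zT.
  have [a aE] : exists a, px z - x = s * a.
    by exists (s * (px z - x)); rewrite mulrA ss mul1r.
  have [b bE] : exists b, py z - y = s * b.
    by exists (s * (py z - y)); rewrite mulrA ss mul1r.
  have key : c z - af f z = (a * a + a * b + b * b - a - b)%:~R + e * (delta R w z
      - (delta R w A * (1 - a - b)%:~R + delta R w B * a%:~R + delta R w C * b%:~R)).
    rewrite fE aE bE /p /q !rmorphM /= (_ : _ - _ = c z - (c A +
      (s%:~R * s%:~R) * (c B - c A) * a%:~R + (s%:~R * s%:~R) * (c C - c A) * b%:~R)); last by ring.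
    rewrite ssR !cE /quadratic /A /B /C !px_mkpt !py_mkpt.
    have -> : px z = x + s * a by rewrite -aE addrC subrK.
    have -> : py z = y + s * b by rewrite -bE addrC subrK.
    rewrite (_ : (x + s * a) * (x + s * a) + (x + s * a) * (y + s * b) + (y + s * b) * (y + s * b)
      = x * x + x * y + y * y + s * (2 * x * a + x * b + y * a + 2 * y * b)
        + s * s * (a * a + a * b + b * b)); last by ring.
    rewrite (_ : (x + s) * (x + s) + (x + s) * y + y * y
      = x * x + x * y + y * y + s * (2 * x + y) + s * s); last by ring.
    rewrite (_ : x * x + x * (y + s) + (y + s) * (y + s)
      = x * x + x * y + y * y + s * (x + 2 * y) + s * s); last by ring.
    by rewrite ss !mul1r !(rmorphD, rmorphB, rmorphM) /=; ring.
  have ab : 1 <= a * a + a * b + b * b - a - b.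
    have : [|| (a == 0) && (b == 0), (a == 1) && (b == 0) | (a == 0) && (b == 1)] = false.
      apply: contraNF zT; rewrite mem_tri.
      have -> : px z = x + s * a by rewrite -aE addrC subrK.
      have -> : py z = y + s * b by rewrite -bE addrC subrK.
      by case/or3P => /andP[/eqP-> /eqP->]; rewrite !(mulr0, mulr1, addr0) !eqxx ?orbT.
    (* Twice the gap is the sum of [n * (n - 1)] over [n = a], [b] and [a + b]. *)
    have sq (n : int) : 0 <= n * (n - 1) by clear; nia.
    have := sq a; have := sq b; have := sq (a + b); clear; nia.
  (* The hexagon lies in a box of size [M] by 5, so [1 + |a| + |b|] is at most [M + 6]. *)
  have bd : - (M + 6) <= - (1 + `|a| + `|b|).
    have hA := AL; rewrite mem_hex /A px_mkpt py_mkpt /hexb in hA.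
    rewrite mem_hex /hexb in zL.
    have na : `|px z - x| = `|a| by rewrite aE normrM s1 mul1r.
    have nb : `|py z - y| = `|b| by rewrite bE normrM s1 mul1r.
    by move: hA zL na nb; clear; lia.
  rewrite -subr_gt0 key.
  have ABC : delta R w A * (1 - a - b)%:~R + delta R w B * a%:~R + delta R w C * b%:~R
      <= (1 + `|a| + `|b|)%:~R.
    have nAB : A != B by rewrite mkpt_eq negb_and; move: s1; clear; lia.
    have nAC : A != C by rewrite mkpt_eq negb_and; move: s1; clear; lia.
    have nBC : B != C by rewrite mkpt_eq negb_and; move: s1; clear; lia.
    rewrite /delta; have [eA|_] := eqVneq A w.
      rewrite -eA !(eq_sym _ A) (negbTE nAB) (negbTE nAC) /= mul1r !mul0r !addr0 ler_int.
      by clear; lia.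
    have [eB|_] := eqVneq B w.
      rewrite -eB (eq_sym C) (negbTE nBC) /= mul1r !mul0r add0r !addr0 ler_int.
      by clear; lia.
    have [eC|_] := eqVneq C w; rewrite /= ?mul1r !mul0r ?add0r ?addr0 ?ler_int ?ler0z;
    by clear; lia.
  have /andP[dz _] := delta_bound z.
  have abR : 1 <= (a * a + a * b + b * b - a - b)%:~R :> R by rewrite ler1z.
  have bdR : (1 + `|a| + `|b|)%:~R <= (M + 6)%:~R :> R by rewrite ler_int -lerN2.
  have : - (e * (M + 6)%:~R) <= e * (delta R w z - (delta R w A * (1 - a - b)%:~R +
      delta R w B * a%:~R + delta R w C * b%:~R)).
    rewrite -mulrN ler_wpM2l //; move: dz ABC bdR.
    by move: (_ + delta R w C * _) => Q; lra.
  move=> h; apply: (lt_le_trans (y := 1 - e * (M + 6)%:~R)); first by rewrite subr_gt0.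
  exact: lerD.
have eqT (z : lat) : z \in tri s x y -> af f z = c z.
  rewrite /tri fset3P fE => /or3P[] /eqP->; rewrite ?px_mkpt ?py_mkpt ?subrr ?mulr0 ?addr0 //.
  - rewrite (_ : x + s - x = s); last by ring.
    by rewrite /p mulrAC ssR mul1r addrC subrK.
  - rewrite (_ : y + s - y = s); last by ring.
    by rewrite /q mulrAC ssR mul1r addrC subrK.
exists f.
  move=> z zL; have [zT|zT] := boolP (z \in tri s x y); first by rewrite eqT.
  exact/ltW/gap.
apply/fsetP => z; apply/contactP/idP => [[zL fz]|zT].
  by apply: contraPT fz => zT; apply/eqP; rewrite lt_eqF ?gap.
by split; [apply: sub|apply: eqT].
Qed.

(** The centroid is strictly inside the hexagon, as no side contains all three points. Its
    coordinates times 3, divided by 3 with remainder, locate it in a standard triangle, which then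
    lies in the hexagon too. *)
Lemma centroid_triangle (u v t : lat) : u \in hex -> v \in hex -> t \in hex ->
  area2 u v t != 0 -> exists s x y a b : int, [/\ `|s| = 1, tri s x y \in hexD,
    0 <= a, 0 <= b & a + b <= 3] /\
    px u + px v + px t = 3 * x + s * a /\ py u + py v + py t = 3 * y + s * b.
Proof.
rewrite !mem_hex /hexb => hu hv ht ar.
have col (p q d : int) : (p != 0) || (q != 0) ->
    p * px u + q * py u = d -> p * px v + q * py v = d -> p * px t + q * py t = d -> False.
  move=> pq eu ev et; case/eqP: ar; rewrite area2E.
  have e1 : p * (px v - px u) + q * (py v - py u) = 0 by move: eu ev; clear; lia.
  have e2 : p * (px t - px u) + q * (py t - py u) = 0 by move: eu et; clear; lia.
  set d1 := px v - px u in e1 *; set d2 := py v - py u in e1 *.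
  set d3 := px t - px u in e2 *; set d4 := py t - py u in e2 *.
  case/orP: pq => h; apply: (mulfI h); rewrite mulr0.
    transitivity ((p * d1 + q * d2) * d4 - d2 * (p * d3 + q * d4)); first by ring.
    by rewrite e1 e2; ring.
  transitivity (d1 * (p * d3 + q * d4) - (p * d1 + q * d2) * d3); first by ring.
  by rewrite e1 e2; ring.
set X := px u + px v + px t; set Y := py u + py v + py t.
have X1 : 0 < X.
  rewrite lt_neqAle eq_sym; apply/andP; split; last by move: hu hv ht; rewrite /X; clear; lia.
  apply/eqP => eq0; apply: (col 1 0 0); rewrite // ?mul1r ?mul0r ?addr0;
  by move: hu hv ht eq0; rewrite /X; clear; lia.
have X2 : X < 3 * M.
  rewrite lt_neqAle; apply/andP; split; last by move: hu hv ht; rewrite /X; clear; lia.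
  apply/eqP => eq0; apply: (col 1 0 M); rewrite // ?mul1r ?mul0r ?addr0;
  by move: hu hv ht eq0; rewrite /X; clear; lia.
have Y1 : 0 < Y.
  rewrite lt_neqAle eq_sym; apply/andP; split; last by move: hu hv ht; rewrite /Y; clear; lia.
  apply/eqP => eq0; apply: (col 0 1 0); rewrite // ?mul1r ?mul0r ?add0r;
  by move: hu hv ht eq0; rewrite /Y; clear; lia.
have Y2 : Y < 15.
  rewrite lt_neqAle; apply/andP; split; last by move: hu hv ht; rewrite /Y; clear; lia.
  apply/eqP => eq0; apply: (col 0 1 5); rewrite // ?mul1r ?mul0r ?add0r;
  by move: hu hv ht eq0; rewrite /Y; clear; lia.
have S1 : 3 * j < X + Y.
  rewrite lt_neqAle eq_sym; apply/andP; split; last by move: hu hv ht; rewrite /X /Y; clear; lia.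
  apply/eqP => eq0; apply: (col 1 1 j); rewrite // ?mul1r;
  by move: hu hv ht eq0; rewrite /X /Y; clear; lia.
have S2 : X + Y < 3 * (M + i).
  rewrite lt_neqAle; apply/andP; split; last by move: hu hv ht; rewrite /X /Y; clear; lia.
  apply/eqP => eq0; apply: (col 1 1 (M + i)); rewrite // ?mul1r;
  by move: hu hv ht eq0; rewrite /X /Y; clear; lia.
have dX := divz_eq X 3; have dX0 := modz_ge0 X (isT : (3 : int) != 0).
have dX1 := @ltz_pmod X 3 isT.
have dY := divz_eq Y 3; have dY0 := modz_ge0 Y (isT : (3 : int) != 0).
have dY1 := @ltz_pmod Y 3 isT.
move: dX dX0 dX1 dY dY0 dY1; move: (X %/ 3)%Z (X %% 3)%Z (Y %/ 3)%Z (Y %% 3)%Z.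
move=> x0 a y0 b dX dX0 dX1 dY dY0 dY1.
have [ab|ab] := leP (a + b) 3.
  exists 1, x0, y0, a, b; rewrite !mul1r; split; last by move: dX dY; clear; lia.
  split=> //; apply: tri_hexD => //; rewrite /hexb;
  by move: X1 X2 Y1 Y2 S1 S2 dX dX0 dX1 dY dY0 dY1 ab; clear; lia.
exists (-1), (x0 + 1), (y0 + 1), (3 - a), (3 - b); split; last by move: dX dY; clear; lia.
split=> //; try by move: dX0 dX1 dY0 dY1 ab; clear; lia.
by apply: tri_hexD => //; rewrite /hexb;
   move: X1 X2 Y1 Y2 S1 S2 dX dX0 dX1 dY dY0 dY1 ab; clear; lia.
Qed.

(** At the centroid of three contact points of [f], compare with the function [g] of the standard
    triangle containing it. There [f <= g] because [f <= c = g] at the vertices, and [g <= f]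
    because [g <= c = f] at the three points; equality forces [f = g]. *)
Lemma hex_regtri : regtri c hex hexD.
Proof.
split.
- by move=> T /hexDP[_ [s [x [y [s1 ->]]]]]; apply: tri_unimodular.
- by move=> T TD; have [_ [s [x [y [s1 eT]]]]] := proj1 (hexDP T) TD;
    rewrite eT in TD *; apply: hex_support.
move=> f sf [u [v [t [/= hu hv ht ar]]]].
have [uL fu] := contactP _ _ _ _ hu; have [vL fv] := contactP _ _ _ _ hv.
have [tL ft] := contactP _ _ _ _ ht.
have [s [x [y [a [b [[s1 TD a0 b0 ab] [eX eY]]]]]]] := centroid_triangle uL vL tL ar.
have [g sg eg] := hex_support s1 TD.
have [/fsubsetP sub _] := proj1 (hexDP _) TD.
have inT z : z \in tri s x y -> z \in hex /\ af g z = c z by rewrite -eg => /contactP.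
have [AL gA] := inT (mkpt x y) ltac:(by rewrite /tri fset3P eqxx).
have [BL gB] := inT (mkpt (x + s) y) ltac:(by rewrite /tri fset3P eqxx orbT).
have [CL gC] := inT (mkpt x (y + s)) ltac:(by rewrite /tri fset3P eqxx !orbT).
have bary (h : R * R * R) : af h u + af h v + af h t = (3 - a - b)%:~R * af h (mkpt x y)
    + a%:~R * af h (mkpt (x + s) y) + b%:~R * af h (mkpt x (y + s)).
  have eXR := congr1 (fun n : int => n%:~R : R) eX.
  have eYR := congr1 (fun n : int => n%:~R : R) eY.
  move: eXR eYR; rewrite /= !(rmorphD, rmorphM) /= => eXR eYR.
  transitivity (3 * h.1.1 + h.1.2 * ((px u)%:~R + (px v)%:~R + (px t)%:~R)
    + h.2 * ((py u)%:~R + (py v)%:~R + (py t)%:~R)); first by rewrite /af; ring.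
  by rewrite eXR eYR /af !px_mkpt !py_mkpt !(rmorphB, rmorphD) /=; ring.
have aR : 0 <= a%:~R :> R by rewrite ler0z.
have bR : 0 <= b%:~R :> R by rewrite ler0z.
have cR : 0 <= (3 - a - b)%:~R :> R by rewrite ler0z; move: ab; clear; lia.
have le : af f u + af f v + af f t <= af g u + af g v + af g t.
  by rewrite !bary gA gB gC !lerD // ler_wpM2l // sf.
have gu := sg u uL; have gv := sg v vL; have gt := sg t tL.
have gu' : af g u = c u by lra.
have gv' : af g v = c v by lra.
have gt' : af g t = c t by lra.
have fg z : af f z = af g z.
  have arR : (area2 u v t)%:~R != 0 :> R by rewrite intr_eq0.
  apply: (mulIf arR); rewrite !(af_bary _ u v t z).
  by rewrite fu fv ft gu' gv' gt'.
rewrite (_ : contact c hex f = tri s x y) // -eg.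
by apply/fsetP => z; rewrite !inE fg.
Qed.

End Perturbed.
End Hexagon.

Lemma card_rows_fset (F : {fset lat}) (ys : seq int) (lo hi : int -> int) : uniq ys ->
  (forall z : lat, (z \in F) = (py z \in ys) && (lo (py z) <= px z <= hi (py z))) ->
  (#|` F|)%:Z = \sum_(y <- ys) Num.max 0 (hi y - lo y + 1).
Proof.
move=> uys memF.
pose s := [seq mkpt x y | y <- ys, x <- irange (lo y) (hi y)].
have us : uniq s.
  apply: allpairs_uniq_dep => // [y _|[y x] [y' x'] _ _ /= e].
    exact: irange_uniq.
  move/eqP: e; rewrite mkpt_eq => /andP[/eqP ex /eqP ey].
  by rewrite ex ey.
have -> : #|` F| = size s.
  apply/esym/eqP; rewrite -uniq_size_uniq ?fset_uniq // => z.
  rewrite memF; apply/andP/allpairsPdep => [[h1 h2]|].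
    by exists (py z), (px z); rewrite mem_irange h1 h2 pt_eta.
  by move=> [y [x [hy]]]; rewrite mem_irange => hx ->; rewrite px_mkpt py_mkpt hy hx.
rewrite size_allpairs_dep sumnE big_map.
rewrite (big_morph Posz PoszD (erefl : 0%:Z = 0)).
by apply: eq_bigr => y _; rewrite size_irange.
Qed.

Section HexPolygon.
Variables (R : realType) (M i j : int).
Hypotheses (M5 : 5 <= M) (hi : 2 <= i <= 3) (hj : 1 <= j <= 2).
Local Notation plane := 'cV[R]_2.

Definition hex_polygon : set plane := conv_hull (@emb R @` [set` hex M i j]).
Local Notation P := hex_polygon.

Definition hexIb (x y : int) : bool :=
  [&& 0 < x, x < M, 0 < y, y < 5, j < x + y & x + y < M + i].

Definition hexI : {fset lat} := [fset z in hex M i j | hexIb (px z) (py z)]%fset.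

Lemma mem_hexI (z : lat) : (z \in hexI) = hexIb (px z) (py z).
Proof.
transitivity ((z \in hex M i j) && hexIb (px z) (py z)); first by rewrite in_fset.
by rewrite mem_hex andb_idl //; rewrite /hexb /hexIb; clear; lia.
Qed.

Lemma hex_lattice_polygon : lattice_polygon P.
Proof.
exists (hex M i j) => //; apply/fset0Pn; exists (mkpt 1 1).
by rewrite mem_hex px_mkpt py_mkpt /hexb; move: M5 hi hj; clear; lia.
Qed.

Lemma hex_form (a b d : int) (x : plane) :
  (forall u w : int, hexb M i j u w -> 0 <= a + b * u + d * w) -> P x ->
  0 <= a%:~R + b%:~R * px x + d%:~R * py x.
Proof.
move=> h; apply: conv_hull_affine => _ [z /= zL <-].
by rewrite px_emb py_emb -!rmorphM -!rmorphD ler0z h // -mem_hex.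
Qed.

Lemma hex_lattice_points v : lattice_points P v <-> v \in hex M i j.
Proof.
split=> [h|vL]; last by apply: sub_conv_hull; exists v.
have f (a b d : int) : (forall u w : int, hexb M i j u w -> 0 <= a + b * u + d * w) ->
    0 <= a + b * px v + d * py v.
  move=> /hex_form/(_ h); rewrite px_emb py_emb -!rmorphM -!rmorphD ler0z.
  by [].
have h1 := f 0 1 0 ltac:(by rewrite /hexb; clear; lia).
have h2 := f M (-1) 0 ltac:(by rewrite /hexb; clear; lia).
have h3 := f 0 0 1 ltac:(by rewrite /hexb; clear; lia).
have h4 := f 5 0 (-1) ltac:(by rewrite /hexb; clear; lia).
have h5 := f (- j) 1 1 ltac:(by rewrite /hexb; clear; lia).
have h6 := f (M + i) (-1) (-1) ltac:(by rewrite /hexb; clear; lia).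
by rewrite mem_hex /hexb; move: h1 h2 h3 h4 h5 h6; clear; lia.
Qed.

Lemma hex_fset_points : fset_set (lattice_points P) = hex M i j.
Proof.
rewrite (_ : lattice_points P = [set` hex M i j]) ?set_fsetK //.
by apply/seteqP; split=> v /hex_lattice_points.
Qed.

Lemma hex_interior v : interior P (emb R v) <-> v \in hexI.
Proof.
rewrite mem_hexI; split.
  move=> /interior_box[e e0 he].
  have f (a b d : int) : `|b| <= 1 -> `|d| <= 1 -> (b != 0) || (d != 0) ->
      (forall u w : int, hexb M i j u w -> 0 <= a + b * u + d * w) ->
      0 < a + b * px v + d * py v.
    move=> b1 d1 bd /hex_form hf.
    have b1R : `|b%:~R : R| <= 1 by rewrite -intr_norm lerz1.
    have d1R : `|d%:~R : R| <= 1 by rewrite -intr_norm lerz1.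
    have e2 : 0 < e / 2 by rewrite divr_gt0.
    (* A small step against the gradient of the form stays in [P], so the form is positive at [v]
       itself. *)
    pose y := mkplane ((px v)%:~R - e / 2 * b%:~R) ((py v)%:~R - e / 2 * d%:~R).
    have small (k : R) : `|k| <= 1 -> `|- (e / 2 * k)| < e.
      move=> k1; rewrite normrN normrM (gtr0_norm e2).
      by apply: (le_lt_trans (y := e / 2 * 1)); [rewrite ler_pM2l|lra].
    have yP : P y.
      by apply: he; rewrite ?px_mkplane ?py_mkplane ?px_emb ?py_emb addrAC subrr add0r; apply: small.
    have := hf y yP; rewrite px_mkplane py_mkplane => h0.
    have bd1 : 1 <= b%:~R * b%:~R + d%:~R * d%:~R :> R.
      rewrite -!rmorphM -rmorphD ler1z; move: bd; clear.
      by case/orP => /eqP; nia.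
    rewrite -(ltr0z R) !(rmorphD, rmorphM) /=.
    apply: (lt_le_trans (y := e / 2 * (b%:~R * b%:~R + d%:~R * d%:~R))); last by lra.
    by rewrite mulr_gt0 //; lra.
  have h1 := f 0 1 0 isT isT isT ltac:(by rewrite /hexb; clear; lia).
  have h2 := f M (-1) 0 isT isT isT ltac:(by rewrite /hexb; clear; lia).
  have h3 := f 0 0 1 isT isT isT ltac:(by rewrite /hexb; clear; lia).
  have h4 := f 5 0 (-1) isT isT isT ltac:(by rewrite /hexb; clear; lia).
  have h5 := f (- j) 1 1 isT isT isT ltac:(by rewrite /hexb; clear; lia).
  have h6 := f (M + i) (-1) (-1) isT isT isT ltac:(by rewrite /hexb; clear; lia).
  by rewrite /hexIb; move: h1 h2 h3 h4 h5 h6; clear; lia.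
move=> hv; apply/interior_box; exists (1 / 2); first by lra.
move=> y hx hy; rewrite px_emb in hx; rewrite py_emb in hy.
set dx := px y - (px v)%:~R in hx; set dy := py y - (py v)%:~R in hy.
have nb (a b : int) : hexb M i j (px v + a) (py v + b) ->
    P (emb R (mkpt (px v + a) (py v + b))).
  move=> h; apply: sub_conv_hull; exists (mkpt (px v + a) (py v + b)) => //=.
  by rewrite mem_hex px_mkpt py_mkpt.
(* With [t = dx] and [t = dy] this gives [v + 2 dx e1] and [v + 2 dy e2], from opposite neighbours
   of [v]; the point [y] is their midpoint. *)
have cv (p q : plane) (t : R) : P p -> P q -> `|t| < 1 / 2 ->
    P ((1 / 2 + t) *: p + (1 / 2 - t) *: q).
  rewrite ltr_norml => hp hq /andP[t1 t2]; apply: conv_hull_convex => //; lra.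
have pA := cv _ _ dx (nb 1 0 ltac:(by move: hv; rewrite /hexIb /hexb; clear; lia))
  (nb (-1) 0 ltac:(by move: hv; rewrite /hexIb /hexb; clear; lia)) hx.
have pB := cv _ _ dy (nb 0 1 ltac:(by move: hv; rewrite /hexIb /hexb; clear; lia))
  (nb 0 (-1) ltac:(by move: hv; rewrite /hexIb /hexb; clear; lia)) hy.
have := cv _ _ 0 pA pB; rewrite normr0 => /(_ ltac:(lra)).
congr (P _); apply: plane_eq; rewrite ?px_comb ?py_comb !(px_emb, py_emb) !(px_mkpt, py_mkpt);
by rewrite !(rmorphD, rmorphN) /=; rewrite /dx /dy; field.
Qed.

Lemma hex_fset_interior : fset_set (interior_lattice_points P) = hexI.
Proof.
rewrite (_ : interior_lattice_points P = [set` hexI]) ?set_fsetK //.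
by apply/seteqP; split=> v /hex_interior.
Qed.

Lemma hex_genus : (genus P)%:Z =
  4 * (M - 1) - (if i == 2 then 3 else 1) - (if j == 2 then 1 else 0).
Proof.
rewrite /genus hex_fset_interior.
rewrite (@card_rows_fset hexI [:: 1; 2; 3; 4] (fun y => Num.max 1 (j + 1 - y))
  (fun y => Num.min (M - 1) (M + i - 1 - y))) //.
  rewrite !big_cons big_nil; have : i = 2 \/ i = 3 by move: hi; clear; lia.
  have : j = 1 \/ j = 2 by move: hj; clear; lia.
  by case=> -> [] -> /=; move: M5; clear; lia.
by move=> z; rewrite mem_hexI /hexIb !inE; clear; lia.
Qed.

Lemma hex_card : (#|` hex M i j|)%:Z =
  6 * (M + 1) - (if i == 2 then 6 else 3) - (if j == 2 then 3 else 1).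
Proof.
rewrite (@card_rows_fset (hex M i j) [:: 0; 1; 2; 3; 4; 5] (fun y => Num.max 0 (j - y))
  (fun y => Num.min M (M + i - y))) //.
  rewrite !big_cons big_nil; have : i = 2 \/ i = 3 by move: hi; clear; lia.
  have : j = 1 \/ j = 2 by move: hj; clear; lia.
  by case=> -> [] -> /=; move: M5; clear; lia.
by move=> z; rewrite mem_hex /hexb !inE; clear; lia.
Qed.

(** An equivalence would embed the lattice points of the hexagon, at least 27, into a box with
    25. *)
Lemma hex_not_exceptional : ~ equivalent P (@exceptional_triangle R).
Proof.
move=> [A [b [uA eq]]].
pose phi (v : lat) : lat := A *m v + b.
have phiE v : affine_map A b (emb R v) = emb R (phi v).
  by rewrite /affine_map /phi /emb map_mxD map_mxM.
have inj : injective phi.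
  by move=> u v /addIr e; rewrite -[u](mulKmx uA) e mulKmx.
have form (a q d : int) (x : plane) : 0 <= a - 2 * q - 2 * d -> 0 <= a + 2 * q ->
    0 <= a + 2 * d -> exceptional_triangle x -> 0 <= a%:~R + q%:~R * px x + d%:~R * py x.
  move=> h1 h2 h3; apply: conv_hull_affine => _ [z hz <-].
  rewrite px_emb py_emb -!rmorphM -!rmorphD ler0z.
  by case: hz => [[->|->]|->]; rewrite px_mkpt py_mkpt; move: h1 h2 h3; clear; lia.
have box v : v \in hex M i j -> phi v \in [seq mkpt x y | y <- irange (-2) 2, x <- irange (-2) 2].
  move=> vL; have : exceptional_triangle (emb R (phi v)).
    rewrite -phiE -eq; exists (emb R v) => //.
    by apply: sub_conv_hull; exists v.
  move=> hT.
  have h1 := form 2 1 0 _ isT isT isT hT; have h2 := form 2 (-1) 0 _ isT isT isT hT.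
  have h3 := form 2 0 1 _ isT isT isT hT; have h4 := form 2 0 (-1) _ isT isT isT hT.
  move: h1 h2 h3 h4; rewrite px_emb py_emb -!rmorphM -!rmorphD !ler0z => h1 h2 h3 h4.
  apply/allpairsP; exists (py (phi v), px (phi v)); rewrite /= !mem_irange pt_eta.
  by split=> //; move: h1 h2 h3 h4; clear; lia.
have : (size [seq phi v | v <- hex M i j] <=
    size [seq mkpt x y | y <- irange (-2) 2, x <- irange (-2) 2])%N.
  apply: uniq_leq_size; first by rewrite map_inj_uniq ?fset_uniq.
  by move=> _ /mapP[v vL ->]; apply: box.
rewrite size_map size_allpairs (_ : (size (irange (-2) 2) * size (irange (-2) 2))%N = 25%N) // => le; have := hex_card; move: le.
have : i = 2 \/ i = 3 by move: hi; clear; lia.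
have : j = 1 \/ j = 2 by move: hj; clear; lia.
by move: M5; clear; move=> m [] -> [] -> /=; move: m; lia.
Qed.

Lemma hex_width : lattice_width (interior_polygon P) = 3.
Proof.
have memI (x y : int) : hexIb x y -> interior_polygon P (emb R (mkpt x y)).
  move=> h; apply: sub_conv_hull; exists (mkpt x y) => //.
  by apply/hex_interior; rewrite mem_hexI px_mkpt py_mkpt.
rewrite /lattice_width; case: pselect => [e0|ne0].
  suff h12 : hexIb 1 2 by exfalso; have := memI 1 2 h12; rewrite e0.
  by rewrite /hexIb; move: M5 hi hj; clear; lia.
have h3 : in_strip (interior_polygon P) 3.
  exists 1%:M, (mkpt 0 (-1)); split; first exact: unitmx1.
  move=> _ [x hx <-] /=; rewrite affine_map_y !mxE /= mul0r add0r mul1r.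
  have hI z : interior_lattice_points P z -> 1 <= py z <= 4.
    by move=> /hex_interior; rewrite mem_hexI /hexIb; clear; lia.
  have lo : 0 <= (-1)%:~R + 0%:~R * px x + 1%:~R * py x.
    apply: conv_hull_affine hx => _ [z /hI hz <-].
    by rewrite px_emb py_emb -!rmorphM -!rmorphD ler0z; move: hz; clear; lia.
  have up : 0 <= 4%:~R + 0%:~R * px x + (-1)%:~R * py x.
    apply: conv_hull_affine hx => _ [z /hI hz <-].
    by rewrite px_emb py_emb -!rmorphM -!rmorphD ler0z; move: hz; clear; lia.
  by move: lo up; rewrite /=; lra.
have min3 t : in_strip (interior_polygon P) t -> (3 <= t)%N.
  move=> [A [b [uA hA]]].
  have h (x y : int) : hexIb x y -> 0 <= A 1 0 * x + A 1 1 * y + py b <= t%:Z.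
    move=> hxy; have : (affine_map A b @` interior_polygon P) (affine_map A b (emb R (mkpt x y))).
      by exists (emb R (mkpt x y)) => //; apply: memI.
    move=> /hA /=; rewrite affine_map_y px_emb py_emb px_mkpt py_mkpt (pmulrn (1 : R) t).
    by rewrite -!rmorphM -!rmorphD ler0z ler_int.
  (* A horizontal and a vertical segment of length 3 inside the interior polygon: the first settles
     the case [A 1 0 != 0], the second the case [A 1 0 = 0], where [A 1 1] is a unit. *)
  have a1 := h 1 2 ltac:(by rewrite /hexIb; move: M5 hi hj; clear; lia).
  have a2 := h 4 2 ltac:(by rewrite /hexIb; move: M5 hi hj; clear; lia).
  have a3 := h 2 1 ltac:(by rewrite /hexIb; move: M5 hi hj; clear; lia).
  have a4 := h 2 4 ltac:(by rewrite /hexIb; move: M5 hi hj; clear; lia).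
  have [p0|p0] := eqVneq (A 1 0) 0.
    have d1 := unitmx_det2 uA; rewrite p0 mulr0 subr0 normrM in d1.
    have q1 : `|A 1 1| = 1.
      move: d1 (normr_ge0 (A 1 1)); rewrite mulrC.
      by case/mulz_eq1 => [->|->].
    by move: a3 a4 q1; rewrite p0 !mul0r !add0r; clear; lia.
  by move: a1 a2 p0; clear; lia.
case: xgetP => [s _ [hs mins]|none].
  by congr Posz; apply/eqP; rewrite eqn_leq mins // min3.
by case: (none 3%N).
Qed.

Lemma hex_egon : egon P = 5.
Proof.
rewrite /egon; case: pselect => [/hex_not_exceptional//|ne] /=.
by rewrite hex_width.
Qed.

End HexPolygon.

(** * The skeleton of the hexagons *)

(* The triangle with vertices [z], [z + d] and [z + r d], where [d = (a, b)] has
   norm [a^2 + ab + b^2 = 1] and [r] is the rotation of order six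
   [(a, b) |-> (- b, a + b)] of the hexagonal lattice. *)
Definition fan (x y a b : int) : {fset lat} :=
  [fset mkpt x y; mkpt (x + a)%R (y + b)%R; mkpt (x - b)%R (y + a + b)%R]%fset.

Lemma mem_fan x y a b (z : lat) : (z \in fan x y a b) =
  [|| (px z == x) && (py z == y), (px z == x + a) && (py z == y + b)
    | (px z == x - b) && (py z == y + a + b)].
Proof. by rewrite /fan fset3P -{1 2 3}(pt_eta z) !mkpt_eq. Qed.

(** These are the six units of the Eisenstein integers, with [a^2 + ab + b^2] as norm. *)
Lemma sixth_root (a b : int) : a * a + a * b + b * b = 1 ->
  [\/ (a = 1 /\ b = 0) \/ (a = 0 /\ b = 1), (a = -1 /\ b = 1) \/ (a = -1 /\ b = 0)
    | (a = 0 /\ b = -1) \/ (a = 1 /\ b = -1)].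
Proof.
move=> h; have := sqr_ge0 (a + b); have := sqr_ge0 a; have := sqr_ge0 b.
rewrite !expr2 => h1 h2 h3.
have a1 : -1 <= a <= 1 by move: h h1 h2 h3; clear; nia.
have b1 : -1 <= b <= 1 by move: h h1 h2 h3; clear; nia.
have : a = -1 \/ a = 0 \/ a = 1 by move: a1; clear; lia.
have : b = -1 \/ b = 0 \/ b = 1 by move: b1; clear; lia.
clear h1 h2 h3 a1 b1 => -[eb|[eb|eb]] [ea|[ea|ea]]; rewrite ea eb in h *;
 by [apply: Or31; left|apply: Or31; right|apply: Or32; left|apply: Or32; right|apply: Or33; left|apply: Or33; right].
Qed.

Lemma fan_tri x y :
  [/\ fan x y 1 0 = tri 1 x y, fan x y 0 1 = tri (-1) x (y + 1),
      fan x y (-1) 1 = tri 1 (x - 1) y, fan x y (-1) 0 = tri (-1) x y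
    & fan x y 0 (-1) = tri 1 x (y - 1) /\ fan x y 1 (-1) = tri (-1) (x + 1) y].
Proof.
rewrite /fan /tri !(addr0, oppr0, opprK, addrK, subrK).
by split=> //; [exact: fset3_rot|exact/esym/fset3_rot| split; [exact: fset3_rot|exact/esym/fset3_rot]].
Qed.

Section Fans.
Variables M i j : int.

Lemma fan_hexD x y a b : a * a + a * b + b * b = 1 -> hexb M i j x y ->
  hexb M i j (x + a) (y + b) -> hexb M i j (x - b) (y + a + b) ->
  fan x y a b \in hexD M i j.
Proof.
move=> ab h1 h2 h3; apply/hexDP; split; last first.
  have [e1 e2 e3 e4 [e5 e6]] := fan_tri x y.
  case/sixth_root: ab => [[]|[]|[]] [-> ->]; rewrite ?e1 ?e2 ?e3 ?e4 ?e5 ?e6;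
  by eexists _, _, _; split; last reflexivity.
apply/fsubsetP => z; rewrite mem_fan mem_hex.
by case/or3P => /andP[/eqP-> /eqP->].
Qed.

Lemma hexD_fan (T : {fset lat}) (z : lat) : T \in hexD M i j -> z \in T ->
  exists a b : int, [/\ a * a + a * b + b * b = 1, T = fan (px z) (py z) a b,
    hexb M i j (px z + a) (py z + b) & hexb M i j (px z - b) (py z + a + b)].
Proof.
move=> /hexDP[sub [s [x [y [s1 eT]]]]] zT.
suff [a [b [ab e]]] : exists a b : int, a * a + a * b + b * b = 1 /\
    T = fan (px z) (py z) a b.
  exists a, b; split=> //.
    have := fsubsetP sub (mkpt (px z + a) (py z + b)).
    by rewrite mem_hex px_mkpt py_mkpt; apply; rewrite e /fan fset3P eqxx orbT.
  have := fsubsetP sub (mkpt (px z - b) (py z + a + b)).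
  by rewrite mem_hex px_mkpt py_mkpt; apply; rewrite e /fan fset3P eqxx !orbT.
have [e1 _ _ e4 _] := fan_tri x y.
have [_ _ e3 _ _] := fan_tri (x + 1) y; have [_ _ _ _ [e5 _]] := fan_tri x (y + 1).
have [_ _ _ _ [_ e6]] := fan_tri (x - 1) y; have [_ e2 _ _ _] := fan_tri x (y - 1).
rewrite addrK in e3; rewrite addrK in e5; rewrite subrK in e6; rewrite subrK in e2.
have : s = 1 \/ s = -1 by move: s1; clear; lia.
move: zT; rewrite eT mem_tri => zT; case=> es; move: zT; rewrite es.
  by case/or3P => /andP[/eqP-> /eqP->];
    [exists 1, 0; rewrite e1|exists (-1), 1; rewrite e3|exists 0, (-1); rewrite e5].
by case/or3P => /andP[/eqP-> /eqP->];
  [exists (-1), 0; rewrite e4|exists 1, (-1); rewrite e6|exists 0, 1; rewrite e2].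
Qed.

End Fans.

Section HexSkeleton.
Variables (R : realType) (M i j : int).
Hypotheses (M5 : 5 <= M) (hi : 2 <= i <= 3) (hj : 1 <= j <= 2).
Local Notation L := (hex M i j).
Local Notation D := (hexD M i j).

Lemma quadratic_regtri : regtri (@quadratic R) L D.
Proof.
apply: (@hex_regtri M i j R _ 0 0); rewrite ?mul0r ?ltr01 //.
by move=> z; rewrite mul0r addr0.
Qed.

Lemma rot_norm (a b : int) : a * a + a * b + b * b = 1 ->
  (a + b) * (a + b) + (a + b) * - a + - a * - a = 1 /\
  - b * - b + - b * (a + b) + (a + b) * (a + b) = 1.
Proof. by move=> <-; split; ring. Qed.

Lemma hexIb_near x y a b : a * a + a * b + b * b = 1 -> hexIb M i j x y ->
  hexb M i j (x + a) (y + b).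
Proof.
by move=> /sixth_root[[]|[]|[]] [-> ->]; rewrite /hexIb /hexb; clear; lia.
Qed.

Lemma hexIb_hexb x y : hexIb M i j x y -> hexb M i j x y.
Proof. by rewrite /hexIb /hexb; clear; lia. Qed.

(** The apexes over the edge from [z] to [z + d] are [z + r d] and [z + r^-1 d], for the rotation
    [r] of order six. *)
Lemma hex_quad x y a b : a * a + a * b + b * b = 1 -> hexIb M i j x y ->
  is_quad D [fset mkpt x y; mkpt (x + a) (y + b)]%fset
    (mkpt x y) (mkpt (x + a) (y + b))
    (mkpt (x - b) (y + a + b)) (mkpt (x + a + b) (y - a)).
Proof.
move=> ab hI; have [r1 r2] := rot_norm ab; have hb := hexIb_hexb hI.
have n0 := hexIb_near ab hI; have := hexIb_near r1 hI; have := hexIb_near r2 hI.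
rewrite !addrA => n2 n1.
apply: (quad_of_pair quadratic_regtri); first exact: fan_hexD.
- rewrite fset3_swap fset3_rot.
  have := fan_hexD r1 hb; rewrite /fan opprK (_ : y + (a + b) + - a = y + b); last by ring.
  by rewrite !addrA; apply.
- by rewrite area2E !px_mkpt !py_mkpt -ab; ring.
- by rewrite area2E !px_mkpt !py_mkpt -ab; ring.
Qed.

Lemma hex_edge_form (c : lat -> R) x y a b : a * a + a * b + b * b = 1 ->
  hexIb M i j x y ->
  edge_form D c [fset mkpt x y; mkpt (x + a) (y + b)]%fset =
  c (mkpt (x - b) (y + a + b)) + c (mkpt (x + a + b) (y - a))
  - c (mkpt x y) - c (mkpt (x + a) (y + b)).
Proof.
move=> ab hI; rewrite (edge_formE _ (hex_quad ab hI)) /lam.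
set p := mkpt x y; set q := mkpt (x + a) _; set s := mkpt (x - b) _; set t := mkpt _ (y - a).
have -> : area2 q s t = 1 by rewrite area2E /q /s /t !px_mkpt !py_mkpt -ab; ring.
have -> : area2 p t s = 1 by rewrite area2E /p /s /t !px_mkpt !py_mkpt -ab; ring.
by rewrite !mul1r.
Qed.

(** Both edges of the triangle at an interior vertex are bounded, so no triangle is a leaf and the
    core is the whole bounded graph. *)
Lemma hex_triangle_interior T : T \in D ->
  exists2 z, z \in T & hexIb M i j (px z) (py z).
Proof.
move=> TD; have [/fsubsetP sub [s [x [y [s1 eT]]]]] := proj1 (hexDP _ _ _ _) TD.
have inT u w : (u, w) \in [:: (x, y); (x + s, y); (x, y + s)] -> mkpt u w \in T.
  by rewrite eT /tri fset3P !mkpt_eq !inE !xpair_eqE.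
have h0 := inT x y ltac:(by rewrite !inE eqxx).
have h1 := inT (x + s) y ltac:(by rewrite !inE eqxx orbT).
have h2 := inT x (y + s) ltac:(by rewrite !inE eqxx !orbT).
have := sub _ h0; have := sub _ h1; have := sub _ h2.
rewrite !mem_hex !px_mkpt !py_mkpt => b2 b1 b0.
suff : [|| hexIb M i j x y, hexIb M i j (x + s) y | hexIb M i j x (y + s)].
  by case/or3P => h; [exists (mkpt x y)|exists (mkpt (x + s) y)|exists (mkpt x (y + s))];
    rewrite ?px_mkpt ?py_mkpt.
have : s = 1 \/ s = -1 by move: s1; clear; lia.
move: b0 b1 b2 M5 hi hj; rewrite /hexb; clear => b0 b1 b2 M5 hi hj [es|es]; rewrite es in b1 b2 *.
  have [y0|y0] := eqVneq y 0.
    by apply/or3P/Or33; rewrite /hexIb; move: b0 b1 b2 M5 hi hj y0; clear; lia.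
  have [xy|xy] := boolP ((x == 0) || (x + y == j)).
    by apply/or3P/Or32; rewrite /hexIb; move: b0 b1 b2 M5 hi hj y0 xy; clear; lia.
  by apply/or3P/Or31; rewrite /hexIb; move: b0 b1 b2 M5 hi hj y0 xy; clear; lia.
have [y5|y5] := eqVneq y 5.
  by apply/or3P/Or33; rewrite /hexIb; move: b0 b1 b2 M5 hi hj y5; clear; lia.
have [xy|xy] := boolP ((x == M) || (x + y == M + i)).
  by apply/or3P/Or32; rewrite /hexIb; move: b0 b1 b2 M5 hi hj y5 xy; clear; lia.
by apply/or3P/Or31; rewrite /hexIb; move: b0 b1 b2 M5 hi hj y5 xy; clear; lia.
Qed.

Lemma hex_star_edge T (z t : lat) : T \in D -> z \in T -> t \in T -> t != z ->
  hexIb M i j (px z) (py z) -> [fset z; t]%fset \in bounded_edges D.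
Proof.
move=> TD zT tT tz hI; have [a [b [ab eT _ _]]] := hexD_fan TD zT.
have [_ r2] := rot_norm ab.
move: tT; rewrite eT /fan pt_eta fset3P (negbTE tz) /= => /orP[] /eqP->.
  by have := quad_bounded (hex_quad ab hI); rewrite pt_eta.
by have := quad_bounded (hex_quad r2 hI); rewrite pt_eta !addrA.
Qed.

Lemma degree_ge (E F : {fset {fset lat}}) T : (F `<=` E)%fset ->
  (forall e, e \in F -> (e `<=` T)%fset) -> (#|` F| <= degree E T)%N.
Proof.
move=> /fsubsetP FE FT; apply: fsubset_leq_card; apply/fsubsetP => e eF.
by rewrite !inE /= FE //= FT.
Qed.

Lemma hex_triangle_at T (z : lat) : T \in D -> z \in T ->
  exists s t, [/\ T = [fset z; s; t]%fset, z != s, z != t & s != t].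
Proof.
move=> TD zT; have [a [b [ab eT _ _]]] := hexD_fan TD zT.
exists (mkpt (px z + a) (py z + b)), (mkpt (px z - b) (py z + a + b)).
have e : T = [fset z; mkpt (px z + a) (py z + b); mkpt (px z - b) (py z + a + b)]%fset.
  by rewrite eT /fan pt_eta.
have := rt_tri quadratic_regtri TD; rewrite e.
by move=> /unimodular_neq[-> -> ->].
Qed.

Lemma fset2_eq_mem (p q r : lat) : [fset p; q]%fset = [fset p; r]%fset -> q = r.
Proof.
move=> h; have : q \in [fset p; r]%fset by rewrite -h !inE eqxx orbT.
rewrite !inE => /orP[/eqP qp|/eqP//].
have : r \in [fset p; q]%fset by rewrite h !inE eqxx orbT.
by rewrite qp !inE orbb => /eqP.
Qed.

Lemma hex_core : core D = bounded_edges D.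
Proof.
apply: core_maximal => e T _; rewrite starP => /andP[TD _].
have [z zT hI] := hex_triangle_interior TD.
have [s [t [eT zs zt st]]] := hex_triangle_at TD zT.
have c2 : #|` [fset [fset z; s]; [fset z; t]]%fset| = 2%N.
  rewrite cardfs2; case: eqP => // h; move: st; rewrite (fset2_eq_mem h) eqxx //.
rewrite -c2; apply: degree_ge.
  apply/fsubsetP => f; rewrite in_fset2 => /orP[] /eqP->;
  by apply: (hex_star_edge TD); rewrite // ?eT ?fset3P ?eqxx ?orbT // eq_sym.
move=> f; rewrite in_fset2 eT => /orP[] /eqP->; apply/fsubsetP => y;
by rewrite fset3P in_fset2 => /orP[] ->; rewrite ?orbT.
Qed.

Lemma degree_third T (z : lat) e : T \in D -> z \in T -> hexIb M i j (px z) (py z) ->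
  e \in core D -> (e `<=` T)%fset -> z \notin e -> (2 < degree (core D) T)%N.
Proof.
move=> TD zT hI he eT' ze.
have [s [t [eT zs zt st]]] := hex_triangle_at TD zT.
have zne y : e != [fset z; y]%fset.
  by apply: contraNneq ze => ->; rewrite !inE eqxx.
have zst : [fset z; s]%fset != [fset z; t]%fset.
  by apply: contraNneq st => /fset2_eq_mem ->.
have c3 : #|` e |` [fset [fset z; s]; [fset z; t]]|%fset = 3%N.
  by rewrite cardfsU1 in_fset2 !(negbTE (zne _)) cardfs2 zst.
rewrite -c3; apply: degree_ge.
  apply/fsubsetP => f; rewrite in_fset1U in_fset2 => /or3P[] /eqP-> //;
  rewrite hex_core; apply: (hex_star_edge TD);
  by rewrite // ?eT ?fset3P ?eqxx ?orbT // eq_sym.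
move=> f; rewrite in_fset1U in_fset2 => /or3P[] /eqP-> //; rewrite eT; apply/fsubsetP => y;
by rewrite fset3P in_fset2 => /orP[] ->; rewrite ?orbT.
Qed.

(* Edges merge only in triangles of degree 2, and those of [T] pass through each
   interior vertex of [T]. *)
Lemma class_center (z : lat) (e f : core D) : hexIb M i j (px z) (py z) ->
  z \in val e -> connect (@merged D) e f -> z \in val f.
Proof.
move=> hI + /connectP[p pth ->]; elim: p e pth => //= g p IH e /andP[/hasP[T TD]].
move=> /and3P[/eqP d2 eT gT] pth ze; apply: IH pth _; apply: contraT => zg.
by have := degree_third TD (fsubsetP eT _ ze) hI (valP g) gT zg; rewrite d2.
Qed.

(** All edges of a class pass through both interior end points by [class_center], so the class is a
    single edge. *)
Lemma class_inner (z t : lat) (e f : core D) : hexIb M i j (px z) (py z) ->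
  hexIb M i j (px t) (py t) -> val e = [fset z; t]%fset -> z != t ->
  connect (@merged D) e f -> f = e.
Proof.
move=> hz ht ee zt h; apply/val_inj/eqP; rewrite eq_sym eqEfcard ee.
have -> : ([fset z; t] `<=` val f)%fset.
  apply/fsubsetP => y; rewrite in_fset2 => /orP[] /eqP->;
  by apply: class_center h; rewrite // ee !inE eqxx ?orbT.
have := fsubsetP (core_bounded D) _ (valP f); move=> /boundedP[_ -> _].
by rewrite cardfs2 zt.
Qed.

Lemma hex_relation (c : lat -> R) x y a b : a * a + a * b + b * b = 1 ->
  skel_vec D c = 0 -> hexIb M i j x y -> hexIb M i j (x + a) (y + b) ->
  c (mkpt (x - b) (y + a + b)) + c (mkpt (x + a + b) (y - a)) =
  c (mkpt x y) + c (mkpt (x + a) (y + b)).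
Proof.
move=> ab c0 h1 h2; have := quad_bounded (hex_quad ab h1); rewrite -hex_core => he.
have [C [_ CE]] := class_exists he.
have := congr1 (fun v : {ffun skel_edge D -> R^o} => v C) c0; rewrite !ffunE CE.
have [ne _ _] := quad_neq (hex_quad ab h1).
rewrite (big_pred1 [` he]%fset); last first.
  move=> f; rewrite !inE; apply/idP/eqP => [|->]; last exact: connect0.
  by apply: class_inner (ne); rewrite ?px_mkpt ?py_mkpt.
by rewrite /= hex_edge_form // => h; apply/eqP; rewrite -subr_eq0 opprD addrA h.
Qed.
End HexSkeleton.

(** * The kernel of the length map of a hexagon *)

Section HexKernel.
Variables (R : realType) (M i j : int).
Hypotheses (M5 : 5 <= M) (hi : 2 <= i <= 3) (hj : 1 <= j <= 2).
Local Notation L := (hex M i j).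
Local Notation D := (hexD M i j).

Lemma weighted_ge (k m n s p q : int) : 0 < m -> 0 < n -> (m + n) * s = m * p + n * q ->
  k <= p -> k <= q -> k <= s.
Proof.
move=> m0 n0 e hp hq; have mn : 0 < m + n by rewrite addr_gt0.
rewrite -(ler_pM2l mn) e mulrDl lerD // ler_pM2l //.
Qed.

(* No ear has to be removed, hence the empty set of interior points. *)
Lemma hex_config : config D (@quadratic R) fset0 L D.
Proof.
have rt := quadratic_regtri R M i j.
split=> //; first by move=> e T _; rewrite starP => /andP[].
move=> p q z m n; rewrite !mem_hex /hexb => hp hq m0 n0 ex ey.
have f (k u w : int) : k <= u * px p + w * py p -> k <= u * px q + w * py q ->
    k <= u * px z + w * py z.
  apply: weighted_ge m0 n0 _.
  transitivity (u * ((m + n) * px z) + w * ((m + n) * py z)); first by ring.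
  by rewrite ex ey; ring.
have h1 := f 0 1 0 ltac:(by move: hp; clear; lia) ltac:(by move: hq; clear; lia).
have h2 := f (- M) (-1) 0 ltac:(by move: hp; clear; lia) ltac:(by move: hq; clear; lia).
have h3 := f 0 0 1 ltac:(by move: hp; clear; lia) ltac:(by move: hq; clear; lia).
have h4 := f (-5) 0 (-1) ltac:(by move: hp; clear; lia) ltac:(by move: hq; clear; lia).
have h5 := f j 1 1 ltac:(by move: hp; clear; lia) ltac:(by move: hq; clear; lia).
have h6 := f (- (M + i)) (-1) (-1) ltac:(by move: hp; clear; lia) ltac:(by move: hq; clear; lia).
by move: h1 h2 h3 h4 h5 h6; clear; lia.
Qed.

Lemma sixth_power (a b a' b' : int) : a * a + a * b + b * b = 1 ->
  a' * a' + a' * b' + b' * b' = 1 ->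
  [\/ (a' = a /\ b' = b) \/ (a' = - b /\ b' = a + b),
      (a' = - a - b /\ b' = a) \/ (a' = - a /\ b' = - b)
    | (a' = b /\ b' = - a - b) \/ (a' = a + b /\ b' = - a)].
Proof.
by move=> /sixth_root[[]|[]|[]] [-> ->] /sixth_root[[]|[]|[]] [-> ->];
 [apply: Or31; left|apply: Or31; right|apply: Or32; left|apply: Or32; right
 |apply: Or33; left|apply: Or33; right
 |apply: Or33; right|apply: Or31; left|apply: Or31; right|apply: Or32; left|apply: Or32; right
 |apply: Or33; left
 |apply: Or33; left|apply: Or33; right|apply: Or31; left|apply: Or31; right|apply: Or32; left
 |apply: Or32; right
 |apply: Or32; right|apply: Or33; left|apply: Or33; right|apply: Or31; left|apply: Or31; right
 |apply: Or32; left
 |apply: Or32; left|apply: Or32; right|apply: Or33; left|apply: Or33; right|apply: Or31; left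
 |apply: Or31; right
 |apply: Or31; right|apply: Or32; left|apply: Or32; right|apply: Or33; left|apply: Or33; right
 |apply: Or31; left].
Qed.

(* The corner [v + d] of the hexagon, seen from the interior point [v = (x, y)]
   with [d = (a, b)]. *)
Definition hex_corner (x y a b : int) : Prop :=
  [/\ a * a + a * b + b * b = 1, hexIb M i j x y,
      ~~ hexb M i j (x + 2 * a) (y + 2 * b),
      ~~ hexb M i j (x + a - b) (y + a + 2 * b)
    & ~~ hexb M i j (x + 2 * a + b) (y + b - a)].

(** The corner has only two triangles, with common edge to [v], and its neighbours [v + r d] and
    [v + r^-1 d] add up to [(v + d) + v]; thus [skel_vec_inner] applies with [k = 1]. *)
Lemma hex_corner_vec x y a b (C : skel_edge D) : hex_corner x y a b ->
  skel_vec D (delta R (mkpt (x + a) (y + b))) C =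
  (class_has C [fset mkpt (x + a) (y + b); mkpt x y]%fset)%:R :> R.
Proof.
move=> [ab hI o1 o2 o3]; have [q1 q2] := quad_in (hex_quad R ab hI).
have only (T : {fset lat}) : T \in D -> mkpt (x + a) (y + b) \in T ->
    T = [fset mkpt (x + a)%R (y + b)%R; mkpt (x - b)%R (y + a + b)%R; mkpt x y]%fset \/
    T = [fset mkpt (x + a)%R (y + b)%R; mkpt (x + a + b)%R (y - a)%R; mkpt x y]%fset.
  move=> TD uT; have [a' [b' [ab' eT]]] := hexD_fan TD uT.
  rewrite !px_mkpt !py_mkpt in eT *; move=> b1 b2.
  have no u w u' w' : hexb M i j u w -> ~~ hexb M i j u' w' -> u = u' -> w = w' -> False.
    by move=> h + eu ew; rewrite -eu -ew h.
  case: (sixth_power ab ab') => -[[ea eb]|[ea eb]]; rewrite ea eb in eT b1 b2 *.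
  - by case: (no _ _ _ _ b1 o1); ring.
  - by case: (no _ _ _ _ b1 o2); ring.
  - left; rewrite eT /fan (_ : x + a + (- a - b) = x - b); last by ring.
    rewrite (_ : y + b + a = y + a + b); last by ring.
    rewrite (_ : x + a - a = x); last by ring.
    by rewrite (_ : y + b + (- a - b) + a = y); last by ring.
  - right; rewrite eT /fan fset3_rot fset3_rot fset3_swap.
    rewrite (_ : x + a + - a = x); last by ring.
    rewrite (_ : y + b + - b = y); last by ring.
    rewrite (_ : x + a - - b = x + a + b); last by ring.
    by rewrite (_ : y + b + - a + - b = y - a); last by ring.
  - by case: (no _ _ _ _ b2 o3); ring.
  - by case: (no _ _ _ _ b1 o3); ring.
have [_ _ ne] := quad_neq (hex_quad R ab hI).
rewrite fset3_rot in q1; rewrite fset3_rot in q2.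
rewrite (skel_vec_inner (quadratic_regtri R M i j) hex_config (k := 1) C q1 q2 ne only).
- by rewrite (_ : 2 - 1 = 1) // mul1r.
- by rewrite !px_mkpt; ring.
- by rewrite !py_mkpt; ring.
Qed.

Variable c : lat -> R.
Hypothesis c0 : skel_vec D c = 0.
Hypothesis cZ : forall z, z \notin L -> c z = 0.
Hypotheses (c12 : c (mkpt 1 2) = 0) (c22 : c (mkpt 2 2) = 0) (c13 : c (mkpt 1 3) = 0).

Lemma rhombus x y a b u w u' w' p q : a * a + a * b + b * b = 1 ->
  hexIb M i j x y -> hexIb M i j p q -> p = x + a -> q = y + b ->
  u = x - b -> w = y + a + b -> u' = x + a + b -> w' = y - a ->
  c (mkpt u w) + c (mkpt u' w') = c (mkpt x y) + c (mkpt p q).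
Proof.
move=> ab h1 h2 ep eq eu ew eu' ew'; subst p q u w u' w'.
exact: (hex_relation M5 hi hj ab c0 h1 h2).
Qed.

Lemma rhombus_h x x' y yu yd : hexIb M i j x y -> hexIb M i j x' y ->
  x' = x + 1 -> yu = y + 1 -> yd = y - 1 ->
  c (mkpt x yu) + c (mkpt x' yd) = c (mkpt x y) + c (mkpt x' y).
Proof. by move=> h1 h2 *; apply: (@rhombus x y 1 0) => //; lia. Qed.

Lemma rhombus_v x xl xr y y' : hexIb M i j x y -> hexIb M i j x y' ->
  xl = x - 1 -> xr = x + 1 -> y' = y + 1 ->
  c (mkpt xl y') + c (mkpt xr y) = c (mkpt x y) + c (mkpt x y').
Proof. by move=> h1 h2 *; apply: (@rhombus x y 0 1) => //; lia. Qed.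

Lemma rhombus_d x x' y y' : hexIb M i j x y -> hexIb M i j x' y' ->
  x' = x - 1 -> y' = y + 1 ->
  c (mkpt x' y) + c (mkpt x y') = c (mkpt x y) + c (mkpt x' y').
Proof. by move=> h1 h2 *; apply: (@rhombus x y (-1) 1) => //; lia. Qed.

(** The rows 2 and 3 are swept by a strip of triangles: a diagonal rhombus gives the next zero in
    row 3, then a vertical one gives the next zero in row 2. *)
Lemma zigzag n : 2 + n%:Z <= M - 1 ->
  [/\ c (mkpt (1 + n%:Z) 2) = 0, c (mkpt (2 + n%:Z) 2) = 0 & c (mkpt (1 + n%:Z) 3) = 0].
Proof.
elim: n => [|n IH] h; first by rewrite !addr0.
have [a1 a2 a3] := IH ltac:(by move: h; clear; lia).
have e2 : 1 + n.+1%:Z = 2 + n%:Z by rewrite intS; ring.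
have g : c (mkpt (2 + n%:Z) 3) = 0.
  have := @rhombus_d (2 + n%:Z) (1 + n%:Z) 2 3; rewrite a1 a2 a3 !add0r; apply;
  by rewrite /hexIb; move: h M5 hi hj; clear; lia.
rewrite e2; split=> //.
have := @rhombus_v (2 + n%:Z) (1 + n%:Z) (2 + n.+1%:Z) 2 3; rewrite a2 a3 g !add0r; apply;
by rewrite /hexIb; move: h M5 hi hj; clear; lia.
Qed.

Lemma row2 x : 1 <= x <= M - 1 -> c (mkpt x 2) = 0.
Proof.
move=> h; have [->//|x1] := eqVneq x 1.
have [|_] := @zigzag `|x - 2|%N; first by move: h x1; clear; lia.
by rewrite (_ : 2 + (`|x - 2|%N)%:Z = x) //; move: h x1; clear; lia.
Qed.

Lemma row3 x : 1 <= x <= M - 1 -> c (mkpt x 3) = 0.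
Proof.
move=> h; have [e|ne] := eqVneq x (M - 1).
  have := @rhombus_d x (x - 1) 2 3; rewrite !row2; try by move: M5 h e; clear; lia.
  have [|_ _] := @zigzag `|M - 3|%N; first by move: M5; clear; lia.
  rewrite (_ : 1 + (`|M - 3|%N)%:Z = x - 1); last by move: M5 e; clear; lia.
  by move=> ->; rewrite !add0r; apply; rewrite /hexIb; move: h e M5 hi hj; clear; lia.
have [|_ _] := @zigzag `|x - 1|%N; first by move: h ne; clear; lia.
by rewrite (_ : 1 + (`|x - 1|%N)%:Z = x) //; move: h ne; clear; lia.
Qed.

(** Horizontal rhombi carry zeros from two adjacent rows to the next one. They miss the ends of the
    row, which come from rhombi of the other two directions. *)
Lemma row1 x : 1 <= x <= M -> c (mkpt x 1) = 0.
Proof.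
have mid y : 2 <= y <= M - 1 -> c (mkpt y 1) = 0.
  move=> h; have := @rhombus_h (y - 1) y 2 3 1; rewrite row3 ?row2; try by move: h; clear; lia.
  by rewrite !add0r; apply; rewrite /hexIb; move: h M5 hi hj; clear; lia.
move=> h; have [e|x1] := eqVneq x 1.
  have := @rhombus_d 2 1 1 2; rewrite c12 c22 (mid 2); last by move: M5; clear; lia.
  by rewrite e !addr0; apply; rewrite /hexIb; move: M5 hi hj; clear; lia.
have [e|xM] := eqVneq x M; last by apply: mid; move: h x1 xM; clear; lia.
have := @rhombus_v (M - 1) (M - 2) M 1 2; rewrite (mid (M - 1)) ?row2; try by move: M5; clear; lia.
by rewrite e !add0r; apply; rewrite /hexIb; move: M5 hi hj; clear; lia.
Qed.

Lemma row4 x : 1 <= x <= M + i - 4 -> c (mkpt x 4) = 0.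
Proof.
have mid y : 1 <= y <= M + i - 5 -> c (mkpt y 4) = 0.
  move=> h; have := @rhombus_h y (y + 1) 3 4 2; rewrite !row3 ?row2; try by move: h hi; clear; lia.
  by rewrite !addr0; apply; rewrite /hexIb; move: h M5 hi hj; clear; lia.
move=> h; have [e|ne] := eqVneq x (M + i - 4); last by apply: mid; move: h ne; clear; lia.
have := @rhombus_d x (x - 1) 3 4; rewrite !row3 ?(mid (x - 1)); try by move: M5 h hi e; clear; lia.
by rewrite !add0r; apply; rewrite /hexIb; move: M5 hi hj e; clear; lia.
Qed.

Lemma row0 x : j + 1 <= x <= M - 1 -> c (mkpt x 0) = 0.
Proof.
move=> h; have := @rhombus_h (x - 1) x 1 2 0; rewrite row2 ?row1; try by move: h hj; clear; lia.
by rewrite !add0r; apply; rewrite /hexIb; move: h M5 hi hj; clear; lia.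
Qed.

Lemma row5 x : 1 <= x <= M + i - 6 -> c (mkpt x 5) = 0.
Proof.
move=> h; have := @rhombus_h x (x + 1) 4 5 3; rewrite row3 ?row4; try by move: h hi; clear; lia.
by rewrite !addr0; apply; rewrite /hexIb; move: h M5 hi hj; clear; lia.
Qed.

Lemma column0 y : j + 1 <= y <= 4 -> c (mkpt 0 y) = 0.
Proof.
move=> h; have e (t : int) : 1 <= t <= 4 -> c (mkpt 1 t) = 0 /\ (t <= 3 -> c (mkpt 2 t) = 0).
  have : t = 1 \/ t = 2 \/ t = 3 \/ t = 4 \/ ~ (1 <= t <= 4) by clear; lia.
  case=> [->|[->|[->|[->|//]]]] _.
  - by split=> [|_]; apply: row1; move: M5; clear; lia.
  - by split=> [|_]; apply: row2; move: M5; clear; lia.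
  - by split=> [|_]; apply: row3; move: M5; clear; lia.
  - by split=> //; apply: row4; move: M5 hi; clear; lia.
have [e1 e2] := e (y - 1) ltac:(by move: h hj; clear; lia).
have [e3 _] := e y ltac:(by move: h hj; clear; lia).
have := @rhombus_v 1 0 2 (y - 1) y; rewrite e1 e3 e2; last by move: h; clear; lia.
by rewrite !addr0; apply; rewrite /hexIb; move: h M5 hi hj; clear; lia.
Qed.

Lemma columnM : i = 3 -> c (mkpt M 2) = 0.
Proof.
move=> e; have := @rhombus_v (M - 1) (M - 2) M 2 3; rewrite (@row2 (M - 1)) ?row3; try by move: M5; clear; lia.
by rewrite !add0r; apply; rewrite /hexIb; move: M5 hi hj e; clear; lia.
Qed.

(** Each entry consists of the interior neighbour of a corner and the direction from it to the
    corner. *)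
Definition corners : seq (int * int * (int * int)) :=
  [:: ((j, 1), (0, -1)); ((M - 1, 1), (1, -1)); ((M - 1, i), (1, 0));
      ((M + i - 5, 4), (0, 1)); ((1, 4), (-1, 1)); ((1, j), (-1, 0))].

Definition corner_point (q : int * int * (int * int)) : lat :=
  mkpt (q.1.1 + q.2.1) (q.1.2 + q.2.2).

Definition corner_base (q : int * int * (int * int)) : lat := mkpt q.1.1 q.1.2.

Lemma corners_corner q : q \in corners -> hex_corner q.1.1 q.1.2 q.2.1 q.2.2.
Proof.
rewrite !inE => /or4P[|||/or3P[]] /eqP-> /=; split=> //; rewrite /hexIb /hexb;
by move: M5 hi hj; clear; lia.
Qed.

Lemma corners_base_inj q q' : q \in corners -> q' \in corners ->
  corner_base q = corner_base q' -> q = q' \/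
  j = 1 /\ (corner_point q = mkpt 1 0 \/ corner_point q' = mkpt 1 0).
Proof.
rewrite !inE => h h' /eqP; move: h h'.
case/or4P => [|||/or3P[]] /eqP-> /or4P[|||/or3P[]] /eqP->; first [by left|
  rewrite /corner_base /corner_point /= mkpt_eq => /andP[/eqP e1 /eqP e2];
  exfalso; move: e1 e2 M5 hi hj; clear; lia|
  rewrite /corner_base /corner_point /= mkpt_eq => /andP[/eqP e1 /eqP e2]; right; split;
  [by move: e1 e2; clear; lia|left; congr mkpt; move: e1 e2; clear; lia]|
  rewrite /corner_base /corner_point /= mkpt_eq => /andP[/eqP e1 /eqP e2]; right; split;
  [by move: e1 e2; clear; lia|right; congr mkpt; move: e1 e2; clear; lia]].
Qed.

Lemma zero_or_corner z : c z = 0 \/ exists2 q, q \in corners & z = corner_point q.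
Proof.
have [zL|] := boolP (z \in L); last by move=> /cZ; left.
rewrite -(pt_eta z) in zL *; move: (px z) (py z) zL => x y; rewrite mem_hex px_mkpt py_mkpt => zL.
have K a b d e : (a, b, (d, e)) \in corners -> x = a + d -> y = b + e ->
    c (mkpt x y) = 0 \/ exists2 q, q \in corners & mkpt x y = corner_point q.
  by move=> h -> ->; right; exists (a, b, (d, e)).
have : y = 0 \/ y = 1 \/ y = 2 \/ y = 3 \/ y = 4 \/ y = 5.
  by move: zL; rewrite /hexb; clear; lia.
have m n (h : (n < 6)%N) : nth ((0, 0), (0, 0)) corners n \in corners by apply: mem_nth.
case=> [ey|[ey|[ey|[ey|[ey|ey]]]]]; rewrite ey in K zL *.
- have [e|n1] := eqVneq x j; first by apply: (K _ _ _ _ (m 0%N isT)); rewrite // addr0.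
  have [e|n2] := eqVneq x M; first by apply: (K _ _ _ _ (m 1%N isT)); rewrite // subrK.
  by left; apply: row0; move: zL n1 n2; rewrite /hexb; clear; lia.
- have [e|n1] := eqVneq x 0; last by left; apply: row1; move: zL n1; rewrite /hexb; clear; lia.
  by apply: (K _ _ _ _ (m 5%N isT)); rewrite // addr0; move: e zL hj; rewrite /hexb; clear; lia.
- have [e|n1] := eqVneq x 0.
    have [e'|n2] := eqVneq j 2.
      by apply: (K _ _ _ _ (m 5%N isT)); rewrite // addr0.
    by left; rewrite e; apply: column0; move: n2 hj; clear; lia.
  have [e|n2] := eqVneq x M; last by left; apply: row2; move: zL n1 n2; rewrite /hexb; clear; lia.
  have [e'|n3] := eqVneq i 2.
    by apply: (K _ _ _ _ (m 2%N isT)); rewrite // ?addr0 ?subrK.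
  by left; rewrite e; apply: columnM; move: n3 hi; clear; lia.
- have [e|n1] := eqVneq x 0; first by left; rewrite e; apply: column0; move: hj; clear; lia.
  have [e|n2] := eqVneq x M; last by left; apply: row3; move: zL n1 n2; rewrite /hexb; clear; lia.
  by apply: (K _ _ _ _ (m 2%N isT)); rewrite // ?addr0 ?subrK //;
    move: e zL hi; rewrite /hexb; clear; lia.
- have [e|n1] := eqVneq x 0; first by left; rewrite e; apply: column0; move: hj; clear; lia.
  by left; apply: row4; move: zL n1 hi; rewrite /hexb; clear; lia.
- have [e|n1] := eqVneq x 0; first by apply: (K _ _ _ _ (m 4%N isT)).
  have [e|n2] := eqVneq x (M + i - 5); first by apply: (K _ _ _ _ (m 3%N isT)); rewrite // addr0.
  by left; apply: row5; move: zL n1 n2; rewrite /hexb; clear; lia.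
Qed.

Hypothesis cj : j = 1 -> c (mkpt 1 0) = 0.

(** The lengths are evaluated at the class of the edge joining the corner to its interior neighbour.
    All edges of this class contain that neighbour, so only corners adjacent to it can
    contribute. *)
Lemma corner_zero q : q \in corners -> c (corner_point q) = 0.
Proof.
move=> hq; have [ab hI _ _ _] := corners_corner hq.
have he := quad_bounded (hex_quad R ab hI); rewrite -hex_core // in he.
have [C [hC CE]] := class_exists he.
have [[/cj + eu]|nj] := pselect (j = 1 /\ corner_point q = mkpt 1 0); first by rewrite eu.
have hquad e (h : e \in core D) := bounded_quad (quadratic_regtri R M i j)
  (fsubsetP (core_bounded _) _ h).
have := skel_vec_sum (rt_sub (quadratic_regtri R M i j)) c hquad; rewrite c0.
move=> /(congr1 (fun v : {ffun skel_edge D -> R^o} => v C)); rewrite sum_ffunE ffunE.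
have uL : corner_point q \in L by rewrite mem_hex px_mkpt py_mkpt; apply: hexIb_near.
rewrite (bigD1_seq _ uL (fset_uniq _)) /= big1; last first.
  move=> z zu; rewrite ffunE /GRing.scale /=.
  have [->|[q' hq' ez]] := zero_or_corner z; first by rewrite mul0r.
  have hc' := corners_corner hq'; rewrite ez hex_corner_vec //.
  have [h|] := boolP (class_has _ _); last by rewrite mulr0.
  case/existsP: h => f /andP[fC /eqP ef].
  have cf : connect (@merged D) [` he]%fset f by move: fC; rewrite CE inE.
  have : corner_base q \in val f.
    by apply: class_center cf; rewrite ?px_mkpt ?py_mkpt // !inE eqxx.
  rewrite ef in_fset2 => /orP[] /eqP eb.
    (* In this case the corner of [q'] would be interior; one more step in the same direction would
       then stay in the hexagon, which [o1] excludes. *)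
    have [ab' hI' o1 _ _] := hc'; case/negP: o1.
    rewrite (_ : _ + 2 * q'.2.1 = q'.1.1 + q'.2.1 + q'.2.1); last by ring.
    rewrite (_ : _ + 2 * q'.2.2 = q'.1.2 + q'.2.2 + q'.2.2); last by ring.
    apply: hexIb_near => //; move: hI; rewrite -(px_mkpt q.1.1 q.1.2) -{2}(py_mkpt q.1.1 q.1.2).
    by rewrite -/(corner_base q) eb px_mkpt py_mkpt.
  have [eq|[j1 [eu|eu]]] := corners_base_inj hq hq' eb.
  - by rewrite ez eq eqxx in zu.
  - by case: nj.
  - by rewrite -/(corner_point q') eu cj // mul0r.
rewrite addr0 ffunE /GRing.scale /= hex_corner_vec; last exact: corners_corner.
by rewrite fsetUC hC mulr1.
Qed.

Lemma hex_kernel z : c z = 0.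
Proof. by have [|[q hq ->]] := zero_or_corner z; last exact: corner_zero. Qed.

End HexKernel.

(** * The dimension *)

Lemma free_map (K : fieldType) (V : vectType K) (T : eqType) (w : T -> V) (Z : seq T) :
  uniq Z -> (forall c : T -> K, (forall z, z \notin Z -> c z = 0) ->
    \sum_(z <- Z) c z *: w z = 0 -> forall z, c z = 0) ->
  free (map w Z).
Proof.
move=> uZ h; apply/(@freeP _ _ _ (map_tuple w (in_tuple Z))) => k k0 n.
have nE (m : 'I_(size Z)) : (map_tuple w (in_tuple Z))`_m = w (tnth (in_tuple Z) m).
  by rewrite -tnth_nth tnth_map.
pose c z := \sum_(m < size Z) k m * (z == tnth (in_tuple Z) m)%:R.
have cE m : c (tnth (in_tuple Z) m) = k m.
  rewrite /c (bigD1 m) //= eqxx mulr1 big1 ?addr0 // => m' mm'.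
  by rewrite (inj_eq (@tuple_uniqP _ _ (in_tuple Z) uZ)) eq_sym (negbTE mm') mulr0.
rewrite -cE; apply: h => [z zZ|].
  rewrite /c big1 // => m _; case: eqP => [e|_]; last by rewrite mulr0.
  by case/negP: zZ; rewrite e; apply: (mem_tnth m (in_tuple Z)).
rewrite (big_tuple _ _ (in_tuple Z)) -[RHS]k0; apply: eq_bigr => m _.
by rewrite cE nE.
Qed.

Section HexDimension.
Variables (R : realType) (M i j : int).
Hypotheses (M5 : 5 <= M) (hi : 2 <= i <= 3) (hj : 1 <= j <= 2).
Local Notation L := (hex M i j).
Local Notation D := (hexD M i j).
Local Notation P := (@hex_polygon R M i j).

Lemma hex_secondary c : regtri c L D -> secondary_cone P D c.
Proof.
move=> rt; apply: induces_of_regtri; last by rewrite hex_fset_points.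
exact/lattice_points_finite/hex_lattice_polygon.
Qed.

Lemma hex_skeleton_length c : regtri c L D -> @moduli_cone R P D (skel_vec D c).
Proof.
move=> rt; exists c; first exact: hex_secondary.
apply: skeleton_length; last by rewrite hex_fset_points.
exact/lattice_points_finite/hex_lattice_polygon.
Qed.

Lemma edge_form_comb (c d : lat -> R) (a : R) e :
  edge_form D (fun z => c z + a * d z) e = edge_form D c e + a * edge_form D d e.
Proof.
rewrite /edge_form; case: pselect => [h|_]; last by rewrite mulr0 addr0.
by case: (cid h) => q hq; rewrite /lam; ring.
Qed.

Lemma skel_vec_comb (c d : lat -> R) (a : R) :
  skel_vec D (fun z => c z + a * d z) = skel_vec D c + a *: skel_vec D d.
Proof.
apply/ffunP => C; rewrite !ffunE /GRing.scale /= mulr_sumr -big_split /=.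
by apply: eq_bigr => e _; rewrite edge_form_comb.
Qed.

Definition hex_span : {vspace {ffun skel_edge D -> R^o}} :=
  <<[seq skel_vec D (delta R z) | z <- L]>>%VS.

Lemma hex_cone_dim : cone_dim (@moduli_cone R P D) (\dim hex_span).
Proof.
exists hex_span; split=> // [x [c hc <-]|W hW].
  have finP := lattice_points_finite (hex_lattice_polygon R M5 hi hj).
  have rt := regtri_of_induces finP hc.
  have hq e (he : e \in core D) := bounded_quad rt (fsubsetP (core_bounded D) _ he).
  rewrite (skeleton_length finP rt); rewrite hex_fset_points // in rt.
  rewrite (skel_vec_sum (rt_sub rt) _ hq) big_seq memv_suml // => z zL.
  by apply/memvZ/memv_span/(map_f (fun z => skel_vec D (delta R z)) zL).
apply/span_subvP => _ /mapP[z zL ->].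
have M70 : 0 < (M + 7)%:~R :> R by rewrite ltr0z; move: M5; clear; lia.
(* Small enough for [e * (M + 6) < 1], so that the perturbed function induces the same
   triangulation. *)
pose e : R := (M + 7)%:~R^-1.
have e0 : 0 < e by rewrite invr_gt0.
have rt1 := quadratic_regtri R M i j.
have rt2 : regtri (fun y => quadratic R y + e * delta R z y) L D.
  apply: (@hex_regtri M i j R _ e z) => //; first exact: ltW.
  by rewrite mulrC ltr_pdivrMr // mul1r ltr_int; clear; lia.
have h1 := hW _ (hex_skeleton_length rt1); have h2 := hW _ (hex_skeleton_length rt2).
have -> : skel_vec D (delta R z) =
    e^-1 *: (skel_vec D (fun y => quadratic R y + e * delta R z y) - skel_vec D (@quadratic R)).
  by rewrite skel_vec_comb addrAC subrr add0r scalerA mulVf ?scale1r // gt_eqF.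
by rewrite memvZ // memvB.
Qed.

(** A linear dependence between the vectors of the points outside the initial zeros is a function
    with zero lengths that vanishes at those zeros, hence is 0 by [hex_kernel]. *)
Lemma hex_dim_ge : (#|` L| <= \dim hex_span + (3 + (j == 1%R)))%N.
Proof.
pose F := [fset mkpt 1 2; mkpt 2 2; mkpt 1 3]%fset.
pose G := (if j == 1 then [fset mkpt 1 0] else fset0)%fset.
have cF : (#|` F `|` G|%fset <= 3 + (j == 1))%N.
  rewrite (leq_trans (leq_card_fsetU _ _)) // leq_add //; last first.
    by rewrite /G; case: eqP => _; rewrite ?cardfs1 ?cardfs0.
  by rewrite (leq_trans (leq_card_fsetU _ _)) // cardfs2 cardfs1; case: (_ != _).
pose Z := (L `\` (F `|` G))%fset.
have -> : #|` L| = (#|` Z| + #|` (L `&` (F `|` G))%fset|)%N by rewrite addnC cardfsID.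
apply: leq_add; last first.
  by apply: leq_trans cF; apply/fsubset_leq_card/fsubsetIr.
have fr : free [seq skel_vec D (delta R z) | z <- Z].
  apply: free_map (fset_uniq _) _ => c cZ c0.
  have out z : z \notin L -> c z = 0.
    by move=> zL; apply: cZ; rewrite in_fsetD negb_and zL orbT.
  have inF z : z \in F -> c z = 0.
    by move=> zF; apply: cZ; rewrite in_fsetD in_fsetU zF.
  have v0 : skel_vec D c = 0.
    rewrite -[RHS]c0 (skel_vec_sum (rt_sub (quadratic_regtri R M i j))); last first.
      by move=> e he; apply: (bounded_quad (quadratic_regtri R M i j) (fsubsetP (core_bounded _) _ he)).
    rewrite (bigID (mem Z)) /= [X in _ + X]big1 ?addr0; last first.
      by move=> z /cZ ->; rewrite scale0r.
    rewrite -big_filter; apply: perm_big; apply: uniq_perm; rewrite ?filter_uniq ?fset_uniq // => z.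
    by rewrite mem_filter in_fsetD andbC; case: (z \in L); rewrite ?andbF.
  have cj : j = 1 -> c (mkpt 1 0) = 0.
    by move=> j1; apply: cZ; rewrite in_fsetD in_fsetU /G j1 eqxx in_fset1 eqxx orbT.
  move=> z; apply: (hex_kernel M5 hi hj v0 out _ _ _ cj); apply: inF;
  by rewrite fset3P eqxx ?orbT.
have -> : #|` Z| = size [seq skel_vec D (delta R z) | z <- Z] by rewrite size_map.
rewrite -(eqP fr); apply/dimvS/span_subvP => _ /mapP[z zZ ->].
apply/memv_span/(map_f (fun z => skel_vec D (delta R z))).
by move: zZ; rewrite in_fsetD => /andP[].
Qed.

End HexDimension.

(** The residue of [g] modulo 4 selects [i] and [j]. By the last equation the lattice points are
    exactly as many as the upper bound for the dimension and the initial zeros together. *)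
Lemma hexagon_of_genus g : (12 <= g)%N -> exists M i j : int,
  [/\ 5 <= M, 2 <= i <= 3, 1 <= j <= 2,
    g%:Z = 4 * (M - 1) - (if i == 2 then 3 else 1) - (if j == 2 then 1 else 0)
  & 6 * (M + 1) - (if i == 2 then 6 else 3) - (if j == 2 then 3 else 1) =
    ((3 * g + 12)./2 + (3 + (j == 1%R)))%N%:Z].
Proof.
move=> g12; pose k := (g %/ 4)%N; have gE := divn_eq g 4; rewrite -/k in gE.
have := ltn_pmod g (isT : (0 < 4)%N); move: gE; case: (g %% 4)%N => [|[|[|[|//]]]] gE _.
- exists (k%:Z + 2), 2, 2 => /=; split=> //; move: gE g12; clear; lia.
- exists (k%:Z + 2), 2, 1 => /=; split=> //; move: gE g12; clear; lia.
- exists (k%:Z + 2), 3, 2 => /=; split=> //; move: gE g12; clear; lia.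
- exists (k%:Z + 2), 3, 1 => /=; split=> //; move: gE g12; clear; lia.
Qed.

Lemma floor_U5 (g : nat) : Num.floor (U g 5) = ((3 * g + 12)./2)%:Z + 1.
Proof.
set n := (_./2); apply: floor_def.
have -> : U g 5 = (3 * g + 14)%N%:R / 2 by rewrite /U natrD natrM; field.
rewrite ler_pdivlMr // ltr_pdivrMr //.
rewrite (_ : ((3 * g + 14)%N%:R : rat) = (3 * g + 14)%N%:Z%:~R) //.
rewrite (_ : (2 : rat) = 2%:~R) // -!intrM ler_int ltr_int.
by rewrite /n; clear; lia.
Qed.

Theorem theorem7p4 (R : realType) (g : nat) (hg : (12 <= g)%N) :
  exists2 n : nat, dim_M_nd R g 5 n & n%:Z = Num.floor (U g 5) - 1.
Proof.
have [M [i [j [M5 hi hj gE cE]]]] := hexagon_of_genus hg.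
exists ((3 * g + 12)./2); last by rewrite floor_U5 addrK.
have bound P D n : lattice_polygon P -> genus P = g -> egon P = 5 ->
    regular_unimodular P D -> cone_dim (@moduli_cone R P D) n -> (n <= (3 * g + 12)./2)%N.
  move=> h1 h2 h3 h4 h5; have := moduli_dim_bound hg h1 h2 h3 h4 h5; clear; lia.
pose P := @hex_polygon R M i j; pose D := hexD M i j.
have pP : lattice_polygon P by apply: hex_lattice_polygon.
have gP : genus P = g by apply/eqP; rewrite -eqz_nat gE hex_genus.
have eP : egon P = 5 by apply: hex_egon.
have rP : regular_unimodular P D.
  by exists (@quadratic R); apply: hex_secondary (quadratic_regtri R M i j).
have cP : cone_dim (@moduli_cone R P D) (3 * g + 12)./2.
  have cd := hex_cone_dim R M5 hi hj.
  suff <- : \dim (hex_span R M i j) = (3 * g + 12)./2 by [].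
  (* The upper bound, applied to the hexagon itself, gives the other inequality for its
     dimension. *)
  apply/eqP; rewrite eqn_leq (bound _ _ _ pP gP eP rP cd) /=.
  rewrite -(leq_add2r (3 + (j == 1))) -lez_nat -cE -(hex_card M5 hi hj) lez_nat.
  exact: hex_dim_ge.
split.
  exists P; split=> //; split; first by exists D.
  by move=> n [D' [h1 h2]]; apply: bound h1 h2.
by move=> n [P' [h1 h2 h3 [[D' [h4 h5]] _]]]; apply: bound h4 h5.
Qed.
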